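(* Let $H^L,H^R,u_0,A_0$ satisfy the standing assumptions listed in the context. Let $\phi:\mathbb R\times[0,T]\to\mathbb R$ be continuous with compact support, and let $f:[A_0,0]\to\mathbb R$ be convex and of class $C^1$. For measurable $A:(0,T)\to[A_0,0]$ put $$\mathcal J(A)=\int_0^T\int_{\mathbb R}\phi(x,t)u^A(x,t)\,dx\,dt+\int_0^Tf(A(t))\,dt ,$$ and let $\bar A$ be a minimizer of $\mathcal J$ among measurable maps $A:(0,T)\to[A_0,0]$. Let $\hat\gamma^{\pm}_{x,t}$ be the extremal optimal trajectories for $u^{\bar A}(x,t)$ defined in the context. Then $$\int_s^T\int_{\mathbb R}\phi(x,t)\mathbf 1_{\{\hat\gamma^+_{x,t}(s)=0\}}\,dx\,dt-f'(\bar A(s))\le 0\qquad\text{for a.e. } s\in\{\bar A<0\},$$ and $$\int_s^T\int_{\mathbb R}\phi(x,t)\mathbf 1_{\{\hat\gamma^-_{x,t}(s)=0\}}\,dx\,dt-f'(\bar A(s))\ge 0\qquad\text{for a.e. } s\in\{\bar A>A_0\}.$$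
   Context: Standing assumptions and notation. Fix $T>0$. $H^L,H^R:\mathbb R\to\mathbb R$ are uniformly convex and of class $C^2$, and $R^L,R^R>0$ satisfy $H^L(-R^L)=H^L(0)=0=H^R(-R^R)=H^R(0)$. The function $u_0:\mathbb R\to\mathbb R$ is Lipschitz continuous with derivative $u_{0,x}\in(-R^L,0)$ (a.e.) on $(-\infty,0)$ and $u_{0,x}\in(-R^R,0)$ (a.e.) on $(0,\infty)$. Set $A_0=\max\{\min_p H^L(p),\min_p H^R(p)\}$. The Lagrangians are $L^L(\alpha)=\sup_{p\in[-R^L,0]}\{\alpha p-H^L(p)\}$ and $L^R(\alpha)=\sup_{p\in[-R^R,0]}\{\alpha p-H^R(p)\}$. For a measurable control $A:[0,T]\to[A_0,0]$, $t\in(0,T]$ and $\gamma\in H^1(0,t)$, put $$J^A(\gamma)=\int_0^t\big(L^R(\dot\gamma(s))\mathbf 1_{\{\gamma(s)>0\}}+L^L(\dot\gamma(s))\mathbf 1_{\{\gamma(s)<0\}}-A(s)\mathbf 1_{\{\gamma(s)=0\}}\big)ds+u_0(\gamma(0)),$$ and $u^A(x,t)=\inf\{J^A(\gamma):\gamma\in H^1(0,t),\ \gamma(t)=x\}$, $u^A(x,0)=u_0(x)$. The function $u^A$ is Lipschitz continuous. A path $\gamma\in H^1(0,t)$ with $\gamma(t)=x$ is optimal for $u^A(x,t)$ if $J^A(\gamma)=u^A(x,t)$. Extremal optimal trajectories. Let $(x,t)$ be a point of differentiability of $u^{\bar A}$ with $x\ne0$, $t\in(0,T)$ (this is a.e.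 point). There are $t_2\ge0$ and $y\in\mathbb R\setminus\{0\}$, independent of the choice of the optimal trajectory, such that any optimal trajectory $\hat\gamma_{x,t}$ for $u^{\bar A}(x,t)$ is affine on $[t_2,t]$ with either $\hat\gamma_{x,t}(t_2)=0$, or $t_2=0$ and $\hat\gamma_{x,t}(0)=y$. If $\hat\gamma_{x,t}(t_2)=0$, there is $t_1\in[0,t_2]$, possibly depending on the optimal trajectory, such that $\hat\gamma_{x,t}$ vanishes on $(t_1,t_2)$ and is affine and does not vanish on $(0,t_1)$. Then $\hat\gamma^+_{x,t}$ denotes the optimal trajectory for which $t_1$ is the smallest, and $\hat\gamma^-_{x,t}$ the one for which $t_1$ is the largest (if the optimal trajectory does not vanish, both denote the unique one).
   Formalization: The context's claim that t2 is independent of the optimal trajectory fails when A=0 a.e. on a time interval (waiting is free, leaving later costs the same); there the extremal trajectories are taken to have also the smallest t2, a condition that is void wherever t2 is unique. *)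

(* Defs.v *)
From HB Require Import structures.
From mathcomp Require Import all_boot all_order all_algebra.
From mathcomp Require Import all_classical all_reals all_analysis.
Set Implicit Arguments.
Unset Strict Implicit.
Unset Printing Implicit Defensive.
Import Order.TTheory GRing.Theory Num.Theory.
Import numFieldNormedType.Exports.
Local Open Scope classical_set_scope.
Local Open Scope ring_scope.

Definition C2 (R : realType) (H : R -> R) :=
  [/\ forall p, derivable H p 1,
      forall p, derivable (derive1 H) p 1 &
      continuous (derive1n 2 H)].

Definition uniformly_convex (R : realType) (H : R -> R) :=
  exists2 c : R, 0 < c & forall p, c <= derive1n 2 H p.

(* Derivative relative to D, hence one-sided at the end points of an
   interval. *)
Definition derive_within (R : realType) (D : set R) (f : R -> R) (a : R) : R :=
  lim ((fun b => (f b - f a) / (b - a)) @ within D a^').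

Definition C1_on (R : realType) (D : set R) (f : R -> R) :=
  (forall a, D a ->
     cvg ((fun b => (f b - f a) / (b - a)) @ within D a^')) /\
  {within D, continuous (derive_within D f)}.

(* The Sobolev space H^1(0, t), its elements being identified with their
   continuous representatives on [0, t], that is, with the primitives of
   square-integrable functions.  By Lebesgue differentiation the weak
   derivative g is the pointwise derivative derive1 gamma almost everywhere. *)
Definition H1 (R : realType) (t : R) (gamma : R -> R) :=
  exists g : R -> R,
    [/\ measurable_fun `]0, t[ g,
        (@lebesgue_measure R).-integrable `]0, t[ (fun s => (g s ^+ 2)%:E) &
        forall s, s \in `[0, t] ->
          gamma s = gamma 0 + \int[lebesgue_measure]_(r in `]0, s[) g r].

Definition affine_on (R : realType) (D : set R) (gamma : R -> R) :=
  exists a b : R, forall s, D s -> gamma s = a * s + b.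

Record junction (R : realType) := Junction {
  horizon : R;
  HL : R -> R;
  HR : R -> R;
  RL : R;
  RR : R;
  u0 : R -> R }.

Definition A0 (R : realType) (P : junction R) : R :=
  Num.max (inf (range (HL P))) (inf (range (HR P))).

Record standing_assumptions (R : realType) (P : junction R) : Prop := {
  horizon_gt0 : 0 < horizon P;
  HL_C2 : C2 (HL P);
  HR_C2 : C2 (HR P);
  HL_convex : uniformly_convex (HL P);
  HR_convex : uniformly_convex (HR P);
  RL_gt0 : 0 < RL P;
  RR_gt0 : 0 < RR P;
  HL_zeros : HL P (- RL P) = 0 /\ HL P 0 = 0;
  HR_zeros : HR P (- RR P) = 0 /\ HR P 0 = 0;
  u0_lipschitz : lipschitz (u0 P);
  u0_slopeL : {ae @lebesgue_measure R, forall x, x < 0 ->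
    derivable (u0 P) x 1 /\ - RL P < derive1 (u0 P) x < 0};
  u0_slopeR : {ae @lebesgue_measure R, forall x, 0 < x ->
    derivable (u0 P) x 1 /\ - RR P < derive1 (u0 P) x < 0} }.

Definition lagrangian (R : realType) (H : R -> R) (r alpha : R) : R :=
  sup [set alpha * p - H p | p in `[- r, 0]].

Definition LL (R : realType) (P : junction R) : R -> R :=
  lagrangian (HL P) (RL P).

Definition LR (R : realType) (P : junction R) : R -> R :=
  lagrangian (HR P) (RR P).

Definition control (R : realType) (P : junction R) (A : R -> R) :=
  measurable_fun `]0, horizon P[ A /\
  forall s, s \in `]0, horizon P[ -> A0 P <= A s <= 0.

Definition path_cost (R : realType) (P : junction R) (A : R -> R) (t : R)
    (gamma : R -> R) : R :=
  \int[lebesgue_measure]_(s in `]0, t[)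
     (LR P (derive1 gamma s) * \1_[set r | 0 < gamma r] s
      + LL P (derive1 gamma s) * \1_[set r | gamma r < 0] s
      - A s * \1_[set r | gamma r = 0] s)
  + u0 P (gamma 0).

Definition value (R : realType) (P : junction R) (A : R -> R) (x t : R) : R :=
  if t == 0 then u0 P x
  else inf [set path_cost P A t gamma | gamma in
              [set gamma | H1 t gamma /\ gamma t = x]].

Definition optimal_path (R : realType) (P : junction R) (A : R -> R) (x t : R)
    (gamma : R -> R) :=
  [/\ H1 t gamma, gamma t = x & path_cost P A t gamma = value P A x t].

(* The shape on [0, t] of an optimal trajectory that meets the junction: t2 is
   its last contact time and t1 the time at which it reaches the junction. *)
Record junction_path (R : realType) (t t1 t2 : R) (gamma : R -> R) : Prop := {
  junction_path_times : [/\ 0 <= t1, t1 <= t2 & t2 < t];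
  junction_path_exit : gamma t2 = 0 /\ affine_on `[t2, t] gamma;
  junction_path_stay : forall s, s \in `]t1, t2[ -> gamma s = 0;
  junction_path_start :
    affine_on `]0, t1[ gamma /\ forall s, s \in `]0, t1[ -> gamma s != 0 }.

(* Extremality of t1 for the order le.  The condition on t2 is void whenever t2
   does not depend on the optimal trajectory.  Such a dependence does occur if
   A = 0 almost everywhere on a time interval: waiting at the junction is then
   free and the Lagrangians are affine for large speeds (p = 0 or p = - R), so
   one may leave later and travel faster at the same cost.  The characteristic
   through (x, t), with speed H'(0) or H'(- R), is the one with the smallest
   t2. *)
Definition extremal_path (R : realType) (le : rel R) (P : junction R)
    (A : R -> R) (x t : R) (gamma : R -> R) :=
  optimal_path P A x t gamma /\
  ((forall s, s \in `[0, t] -> gamma s != 0) \/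
   exists t1 t2, junction_path t t1 t2 gamma /\
     forall eta t1' t2', optimal_path P A x t eta ->
       junction_path t t1' t2' eta -> le t1 t1' /\ t2 <= t2').

Definition path_plus (R : realType) := @extremal_path R (fun a b => a <= b).

Definition path_minus (R : realType) := @extremal_path R (fun a b => b <= a).

(* A selection, at the points of differentiability of the value function off
   the junction, of trajectories satisfying E. *)
Definition path_selection (R : realType)
    (E : junction R -> (R -> R) -> R -> R -> (R -> R) -> Prop)
    (P : junction R) (A : R -> R) (G : R -> R -> R -> R) :=
  forall x t, x != 0 -> t \in `]0, horizon P[ ->
    differentiable (fun z : R * R => value P A z.1 z.2) (x, t) ->
    E P A x t (G x t).

Definition continuous_compact_support (R : realType) (P : junction R)
    (phi : R -> R -> R) :=
  let strip := [set z : R * R | z.2 \in `[0, horizon P]] in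
  {within strip, continuous (fun z => phi z.1 z.2)} /\
  compact (closure (strip `&` [set z | phi z.1 z.2 != 0])).

Definition total_cost (R : realType) (P : junction R) (phi : R -> R -> R)
    (f : R -> R) (A : R -> R) : R :=
  \int[lebesgue_measure]_(t in `]0, horizon P[)
     (\int[lebesgue_measure]_x (phi x t * value P A x t))
  + \int[lebesgue_measure]_(t in `]0, horizon P[) f (A t).

Definition minimizer (R : realType) (P : junction R) (phi : R -> R -> R)
    (f : R -> R) (A : R -> R) :=
  control P A /\
  forall B, control P B -> total_cost P phi f A <= total_cost P phi f B.

(* Main.v *)
(* By the dynamic programming of the Hamilton-Jacobi equation on each half-line,
   u^A is the minimum of a value reached without touching the junction and of
   the minimum over the pairs t1 <= t2 of
     arrival(t1) - int_{t1}^{t2} A + K(x, t - t2),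
   where arrival(t1) is the least cost of being at the junction at time t1 and
   K(x, tau) = sup_p (x p - tau H(p)) is the cost of leaving it.  For a fixed t,
   u^A fails to be differentiable at (x, t) for at most countably many x: two
   different maximising slopes make x a corner from above.  At a point of
   differentiability all the minimising pairs share the maximising slope, and
   this forces the departure times to differ only across intervals where A = 0.
   Perturbing A into A + th e 1_E therefore changes u^A at first order by
   - th e |E cap [t1, t2]|, where t1 is the earliest entrance time if e > 0 and
   E is contained in {A < 0}, the latest one if e < 0 and E is contained in
   {A > A0} (Danskin's theorem on the compact triangle of pairs).  Dominated
   convergence, Fubini's theorem and the tangent inequality for f turn the
   minimality of the control into an inequality integrated over E, and E is
   arbitrary. *)

Require Import Defs.
From HB Require Import structures.
From mathcomp Require Import all_boot all_order all_algebra.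
From mathcomp Require Import all_classical all_reals all_analysis.
From mathcomp Require Import measurable_realfun.
From mathcomp Require Import ring lra.
Set Implicit Arguments.
Unset Strict Implicit.
Unset Printing Implicit Defensive.
Import Order.TTheory GRing.Theory Num.Theory.
Import numFieldNormedType.Exports.
Local Open Scope classical_set_scope.
Local Open Scope ring_scope.

(** * Almost everywhere equality, corners and first-order expansions *)

(** Three obstacles shape the proof. The selections [gplus] and [gminus] are arbitrary functions, so
    the inner integrals of the conclusion may have non-measurable integrands. For each t they agree,
    outside countably many x, with conditions on the entrance and departure times minimising
    [jcost]; these times are measurable in the plane, and the integral ignores null sets even for
    non-measurable functions. Minimising pairs and optimal paths do not quite correspond. A pair may
    encode an initial rest beside the junction, which has not the shape of a [junction_path]; it is
    optimal only if A = A0 up to its entrance time. Hence the largest time T0 up to which A = A0: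
    past T0 it makes no difference whether the latest entrance is taken among pairs or among paths.
    The direct branch does not feel the perturbation, so a tie with the junction branch could spoil
    the first-order expansion. At a point of differentiability a tie forces the direct path to start
    at the origin; then (0, 0) is a minimising pair as well, and the largest rate over the
    minimising pairs is nonnegative. *)

Section ae_nonmeasurable.
Context d (T : measurableType d) (R : realType).
Variable mu : {measure set T -> \bar R}.
Import HBNNSimple.
Local Open Scope ereal_scope.

(** A simple function below f, cut off on N, lies below g and keeps its integral. Only the simple
    functions are measurable here, which suits the path selections of the theorem, about whose
    measurability nothing is known. *)
Lemma nnintegral_ae (N : set T) (f g : T -> \bar R) :
  measurable N -> mu N = 0 -> (forall x, 0 <= g x) ->
  (forall x, ~ N x -> f x = g x) ->
  ereal_sup [set sintegral mu h | h in
    [set h : {nnsfun T >-> R} | forall x, (h x)%:E <= f x]] <=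
  ereal_sup [set sintegral mu h | h in
    [set h : {nnsfun T >-> R} | forall x, (h x)%:E <= g x]].
Proof.
move=> mN N0 g0 fg; apply: ge_ereal_sup => _ [h /= hf <-].
pose h' := proj_nnsfun h (measurableC mN).
suff -> : sintegral mu h = sintegral mu h'.
  apply: ereal_sup_ubound; exists h' => //= x.
  rewrite /h' /= measurable_realfun.mindicE.
  have [xN|xN] := pselect (N x).
    by rewrite memNset ?mulr0//= => -[].
  by rewrite mem_set ?mulr1// -fg.
rewrite -!integralT_nnsfun; apply: ge0_ae_eq_integral => //.
- exact/measurable_EFinP.
- exact/measurable_EFinP.
- by move=> x _; rewrite lee_fin.
- by move=> x _; rewrite lee_fin.
exists N; split => // x /= /not_implyP[_].
apply: contra_notP => xN; by rewrite /h' /= measurable_realfun.mindicE mem_set ?mulr1.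
Qed.

Lemma ae_eq_integral_gen (D : set T) (f g : T -> \bar R) :
  ae_eq mu D f g -> \int[mu]_(x in D) f x = \int[mu]_(x in D) g x.
Proof.
move=> [N [mN N0 fg]].
have E (F G : T -> \bar R) : (forall x, ~ N x -> F x = G x) ->
    (forall x, 0 <= F x) -> (forall x, 0 <= G x) ->
    ereal_sup [set sintegral mu h | h in
      [set h : {nnsfun T >-> R} | forall x, (h x)%:E <= F x]] =
    ereal_sup [set sintegral mu h | h in
      [set h : {nnsfun T >-> R} | forall x, (h x)%:E <= G x]].
  move=> FG F0 G0; apply/eqP; rewrite eq_le.
  by apply/andP; split; apply: nnintegral_ae mN N0 _ _ => // x /FG.
have fgD x : ~ N x -> (f \_ D) x = (g \_ D) x.
  move=> Nx; rewrite !patchE; case: ifPn => // /set_mem Dx.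
  by apply: contra_notP Nx => nfg; apply: fg => /= /(_ Dx).
rewrite /integral; congr (_ - _); apply: E => // x Nx;
  by rewrite ?(funeposE, funenegE) fgD.
Qed.

Lemma ae_eq_Rintegral (D : set T) (f g : T -> R) :
  {ae mu, forall x, D x -> f x = g x} ->
  (\int[mu]_(x in D) f x = \int[mu]_(x in D) g x)%R.
Proof.
move=> fg; congr fine; apply: ae_eq_integral_gen.
by apply: filterS fg => x fg /fg ->.
Qed.

End ae_nonmeasurable.

Section strict_local_maxima.
Context (R : realType).

(** A rational chosen in (x, x + e) determines x, because distinct points of S are at least e
    apart. *)
Lemma countable_isolated (S : set R) (e : R) : 0 < e ->
  (forall x y, S x -> S y -> x != y -> e <= `|x - y|) -> countable S.
Proof.
move=> e0 Se.
have ex (x : R) : exists q : rat, x < ratr q < x + e.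
  have /rat_in_itvoo[q] : x < x + e by rewrite ltrDl.
  by rewrite in_itv/= => qx; exists q.
pose q x := projT1 (cid (ex x)).
have qP x : x < ratr (q x) < x + e by rewrite /q; case: cid.
apply/countable_injP; exists (pickle \o q) => x y /set_mem Sx /set_mem Sy /= /(pcan_inj pickleK) qxy.
apply: contrapT => /eqP xy; have := Se _ _ Sx Sy xy.
have := qP x; have := qP y; rewrite qxy => /andP[y1 y2] /andP[x1 x2].
by apply/negP; rewrite -ltNge ltr_norml; lra.
Qed.

(* If the upper right slope at x is smaller than the lower left slope, then x
   is a strict local maximum of w tilted by a rational slope between them. *)
Lemma countable_kinks (w : R -> R) (S : set R) :
  (forall x, S x -> exists p1 p2, [/\ p1 < p2,
    forall rho, p1 < rho -> exists2 e : R, 0 < e & forall h : R, 0 < h < e ->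
      w (x + h) < w x + rho * h &
    forall rho, rho < p2 -> exists2 e : R, 0 < e & forall h : R, 0 < h < e ->
      w (x - h) < w x - rho * h]) -> countable S.
Proof.
move=> HS.
(* [M (rho, n)] collects the strict maxima, within radius 1/(n+1), of w tilted by rho. Two of them
   closer than that radius would each exceed the other, so the set is isolated. *)
pose M (z : rat * nat) := [set x | forall y, y != x -> `|y - x| < z.2.+1%:R^-1 ->
  w y - ratr z.1 * y < w x - ratr z.1 * x].
have : countable (\bigcup_z M z).
  apply: bigcup_countable => [|[rho n] _]; first exact: countableP.
  apply: (@countable_isolated _ n.+1%:R^-1) => [|x y Mx My xy].
    by rewrite invr_gt0.
  rewrite leNgt; apply/negP => xyn.
  have := My _ xy xyn; have := Mx y; rewrite eq_sym distrC => /(_ xy xyn) /=.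
  lra.
apply: sub_countable; apply: subset_card_le => x /HS[p1 [p2 [p12 Hr Hl]]].
have [rho] := rat_in_itvoo p12; rewrite in_itv/= => /andP[r1 r2].
have [e1 e10 {}Hr] := Hr _ r1; have [e2 e20 {}Hl] := Hl _ r2.
have e0 : 0 < Num.min e1 e2 by rewrite lt_min e10.
have [n ne] : exists n, n.+1%:R^-1 < Num.min e1 e2.
  have [n _ Hn] := near_infty_natSinv_lt (PosNum e0).
  by exists n; exact: Hn n (leqnn n).
exists (rho, n) => //= y yx /lt_trans/(_ ne); rewrite lt_min => /andP[h1 h2].
have [xy|yx'|E] := ltgtP x y; last by rewrite E eqxx in yx.
  have := Hr (y - x); rewrite subr_gt0 xy -[y - x]gtr0_norm ?subr_gt0// h1.
  rewrite gtr0_norm ?subr_gt0// addrC subrK => /(_ isT); lra.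
have := Hl (x - y); rewrite subr_gt0 yx' -[x - y]gtr0_norm ?subr_gt0// distrC h2.
rewrite distrC gtr0_norm ?subr_gt0// opprB addrC subrK => /(_ isT); lra.
Qed.

End strict_local_maxima.

Section first_order.
Context (R : realType).

Lemma derive1_expand (f : R -> R) (c e : R) : derivable f c 1 -> 0 < e ->
  exists2 d : R, 0 < d & forall h : R, `|h| < d ->
    `|f (c + h) - f c - h * derive1 f c| <= e * `|h|.
Proof.
move=> df e0.
have : h^-1 *: (f (h *: 1 + c) - f c) @[h --> 0^'] --> derive1 f c.
  by rewrite derive1E; exact: df.
move=> /cvgrPdist_le/(_ e e0); rewrite near_withinE => /nbhs_ballP[d /= d0 Hd].
exists d => // h hd; have [->|h0] := eqVneq h 0.
  by rewrite addr0 subrr mul0r subrr normr0 mulr0.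
have := Hd h; rewrite -ball_normE /= sub0r normrN => /(_ hd h0); rewrite [h%:A]mulr1.
have -> : f (c + h) - f c - h * derive1 f c =
    - h * (derive1 f c - h^-1 *: (f (h + c) - f c)).
  by rewrite /GRing.scale/= (addrC h); field.
by move=> ?; rewrite normrM normrN mulrC ler_wpM2r.
Qed.

Local Notation mu := (@lebesgue_measure R).

Lemma mem_open_near (O : set R) (x : R) : open O -> O x ->
  exists2 d : R, 0 < d & forall y, `|y - x| < d -> O y.
Proof.
move=> oO Ox; have := open_nbhs_nbhs (conj oO Ox) => /nbhs_ballP[d d0 H].
by exists d => // y yx; apply: H; rewrite -ball_normE /= distrC.
Qed.

Lemma mu_le (A B : set R) : measurable A -> measurable B -> A `<=` B ->
  (mu A <= mu B)%E.
Proof. by move=> mA mB AB; apply: le_measure; rewrite ?inE. Qed.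

Lemma ae_null_cover (P : R -> Prop) : {ae mu, forall x, P x} ->
  exists N : set R, [/\ measurable N, mu N = 0%E & forall x, ~ N x -> P x].
Proof.
move=> [N [mN N0 HN]]; exists N; split => // x Nx.
by apply: contrapT => Px; apply: Nx; exact: HN.
Qed.

Lemma ae_sub (P Q : R -> Prop) : (forall x, P x -> Q x) ->
  {ae mu, forall x, P x} -> {ae mu, forall x, Q x}.
Proof.
move=> PQ [N [mN N0 HN]]; exists N; split => // x /= nQ.
by apply: HN => /= /PQ.
Qed.

(* The exceptional null set is covered by an open set O of small measure, on
   which the growth of measure (O `&` [a, x]) compensates the Lipschitz
   constant. *)
Lemma lipschitz_ae_nondecreasing (f : R -> R) (L a b : R) : a <= b -> 0 <= L ->
  (forall x y, a <= x <= b -> a <= y <= b -> `|f x - f y| <= L * `|x - y|) ->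
  {ae mu, forall x, a < x < b -> derivable f x 1 /\ 0 <= derive1 f x} ->
  f a <= f b.
Proof.
move=> ab L0 Lf /ae_null_cover[N [mN N0 HN]].
rewrite leNgt; apply/negP => fba.
pose e := (f a - f b) / (b - a + L + 1) / 2.
have den : 0 < b - a + L + 1 by lra.
have e0 : 0 < e by rewrite !divr_gt0 ?subr_gt0.
have eE : e * (b - a + L + 1) * 2 = f a - f b by rewrite /e; field; rewrite gt_eqF.
(* The left end a joins the null set because the derivative is controlled only inside the
   interval. *)
have mNa : measurable (N `|` [set a]) by apply: measurableU => //; exact: measurable_set1.
have Na0 : mu (N `|` [set a]) = 0%E.
  by rewrite measureU0//; exact: lebesgue_measure_set1.
have [] := @lebesgue_regularity_outer _ (N `|` [set a]) e mNa _ e0.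
  exact: (eq_ind_r (fun z => (z < +oo)%E) (ltry 0) Na0).
move=> O [oO NO mO]; have {}mO : (mu (O `\` (N `|` [set a])) < e%:E)%E by exact: mO.
have mO' : (mu O < e%:E)%E.
  rewrite -(setDKU NO) measureU0//.
  by apply: measurableD => //; exact: open_measurable.
have mOI x y : measurable (O `&` `[x, y]).
  by apply: measurableI; [exact: open_measurable | exact: measurable_itv].
have fOI x y : (mu (O `&` `[x, y]) < e%:E)%E.
  apply: le_lt_trans mO'; apply: mu_le => //; exact: open_measurable.
have fin x y : mu (O `&` `[x, y]) \is a fin_num.
  by rewrite ge0_fin_numE//; apply: lt_trans (fOI x y) _; rewrite ltry.
pose m x := fine (mu (O `&` `[a, x])).
have m0 x : 0 <= m x by rewrite fine_ge0.
have me x : m x <= e.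
  by rewrite -lee_fin fineK//; exact/ltW.
have m_mono x y : x <= y -> m x <= m y.
  move=> xy; rewrite /m fine_le//; apply: mu_le => //.
  apply: setIS; exact: subset_itvl.
(* The term e * (x - a) absorbs the first-order error where the derivative exists, and L * m x the
   Lipschitz loss inside O. Together they consume at most half of f a - f b, by the choice of e. *)
pose g x := f x + e * (x - a) + L * m x.
have gab : g b < g a.
  rewrite /g subrr mulr0; have := m0 a; have := me b => h1 h2.
  have : L * m b <= L * e by rewrite ler_wpM2l.
  have : 0 <= L * m a by rewrite mulr_ge0.
  nra.
pose S := [set x | a <= x <= b /\ g a <= g x].
have Sa : S a by rewrite /S/= lexx ab.
have Sub : ubound S b by move=> x [/andP[]].
have supS : has_sup S by split; [exists a | exists b].
(* Continuous induction: c lies in S, and S reaches beyond c, thanks to the growth of m if c is in O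
   and to the derivative at c otherwise. *)
pose c := sup S.
have ac : a <= c by apply: ub_le_sup supS.2 _ _.
have cb : c <= b by apply: ge_sup => //; exists a.
have Sc : S c.
  split; first by rewrite ac.
  apply/ler_addgt0Pr => d d0.
  have d0' : 0 < d / (L + e + 1) by rewrite divr_gt0//; lra.
  have [x Sx xc] := sup_adherent d0' supS.
  have xc' : x <= c by apply: ub_le_sup supS.2 _ _.
  case: Sx => /andP[ax xb] /le_trans; apply.
  have := m_mono _ _ xc' => mm.
  have := Lf x c; rewrite ax xb ac cb => /(_ isT isT).
  rewrite (distrC x) (ger0_norm (_ : 0 <= c - x)) ?subr_ge0// => /(le_trans (ler_norm _)) Lfx.
  have h : (c - x) * (L + e + 1) <= d.
    by rewrite -ler_pdivlMr; [rewrite -/c in xc; lra|lra].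
  have : L * m x <= L * m c by rewrite ler_wpM2l.
  rewrite /g; nra.
have {}cb : c < b.
  rewrite lt_neqAle cb andbT; apply/eqP => cb'; case: Sc => _.
  by rewrite cb' leNgt gab.
suff [x cx Sx] : exists2 x, c < x & S x.
  by have := ub_le_sup supS.2 Sx; rewrite leNgt cx.
have [Oc|Oc] := pselect (O c).
  have [d d0 Hd] := mem_open_near oO Oc.
  pose x := Num.min b (c + d / 2).
  have cx : c < x by rewrite /x lt_min cb ltrDl divr_gt0.
  have xb : x <= b by rewrite /x ge_min lexx.
  have xd : x <= c + d / 2 by rewrite /x ge_min lexx orbT.
  exists x => //; split; first by rewrite (le_trans ac (ltW cx)) xb.
  apply: le_trans Sc.2 _.
  have mx : m c + (x - c) <= m x.
    rewrite -lee_fin EFinD !fineK// -(_ : mu `]c, x] = (x - c)%:E); last first.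
      by rewrite lebesgue_measure_itv/= lte_fin cx.
    rewrite -measureU//; [|exact: mOI|]; last first.
      apply/seteqP; split => // y [[_ /=]]; rewrite !in_itv/= => /andP[_ yc] /andP[cy _].
      by move: cy; rewrite ltNge yc.
    apply: mu_le => //; first exact: measurableU.
    move=> y [[Oy]|]; rewrite /= !in_itv/= => /andP[y1 y2].
      by rewrite y1 (le_trans y2 (ltW cx)).
    rewrite (le_trans ac (ltW y1)) y2; split => //.
    apply: Hd; rewrite gtr0_norm ?subr_gt0//; lra.
  have := Lf c x; rewrite ac (ltW cb) (le_trans ac (ltW cx)) xb => /(_ isT isT).
  rewrite (distrC c x) (gtr0_norm (_ : 0 < x - c)) ?subr_gt0// => /(le_trans (ler_norm _)) Lfx.
  have : L * (m c + (x - c)) <= L * m x by rewrite ler_wpM2l.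
  have : 0 <= e * (x - c) by rewrite mulr_ge0 ?subr_ge0 ?ltW.
  rewrite /g; nra.
have [ac' Nc] : a < c /\ ~ N c.
  split; last by move=> Nc; apply: Oc; apply: NO; left.
  by rewrite lt_neqAle ac andbT; apply/eqP => ac'; apply: Oc; apply: NO; right.
have [dfc fc0] : derivable f c 1 /\ 0 <= derive1 f c.
  by apply: HN => //; rewrite ac'.
have [d d0 Hd] := derive1_expand dfc e0.
pose x := Num.min b (c + d / 2).
have cx : c < x by rewrite /x lt_min cb ltrDl divr_gt0.
have xb : x <= b by rewrite /x ge_min lexx.
have xd : x <= c + d / 2 by rewrite /x ge_min lexx orbT.
exists x => //; split; first by rewrite (le_trans ac (ltW cx)) xb.
apply: le_trans Sc.2 _.
have := Hd (x - c); rewrite gtr0_norm ?subr_gt0// (addrC c) subrK.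
rewrite ler_norml => /(_ _)/andP[|]; first lra.
move=> h1 _; have : L * m c <= L * m x by rewrite ler_wpM2l// m_mono// ltW.
have : 0 <= (x - c) * derive1 f c by rewrite mulr_ge0// subr_ge0 ltW.
rewrite /g; nra.
Qed.

End first_order.

Lemma compact_strict_gap (T : topologicalType) (R : realType) (A : set T)
    (f : T -> R) (c : R) : compact A -> {within A, continuous f} ->
  (forall x, A x -> c < f x) ->
  exists2 d : R, 0 < d & forall x, A x -> c + d <= f x.
Proof.
move=> cA cf fc; have [->|A0] := eqVneq A set0; first by exists 1.
have [x xA xmin] := compact_EVT_min ((set0P A).1 A0) cA cf.
exists (f x - c); first by rewrite subr_gt0 fc//; exact: set_mem.
by move=> y Ay; rewrite addrC subrK; apply: xmin; exact: mem_set.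
Qed.

(** * The kernel of a convex Hamiltonian *)

(** The features shared by both half-lines. Uniform convexity is kept in the first-order form
    [ham_sc], so that second derivatives disappear after [uniformly_convex_quadratic]. *)
Record hamiltonian (R : realType) (H : R -> R) (r : R) : Prop := {
  ham_r : 0 < r;
  ham_der : forall p, derivable H p 1;
  ham_sc : exists2 c : R, 0 < c &
    forall p q, H p + derive1 H p * (q - p) + c * (q - p) ^+ 2 <= H q;
  ham_l : H (- r) = 0;
  ham_0 : H 0 = 0 }.

(** Subtracting from H its tangent at p and the quadratic term leaves a function whose derivative
    has the sign of z - p, hence with a minimum at p. *)
Lemma uniformly_convex_quadratic (R : realType) (H : R -> R) (c : R) :
  C2 H -> (forall p, c <= derive1n 2 H p) ->
  forall p q, H p + derive1 H p * (q - p) + c / 2 * (q - p) ^+ 2 <= H q.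
Proof.
move=> [dH ddH _] Hc p q.
have dHp (z : R) : is_derive z (1 : R) H (derive1 H z).
  by rewrite derive1E; exact: DeriveDef (dH z) _.
have ddHp (z : R) : is_derive z (1 : R) (derive1 H) (derive1n 2 H z).
  by rewrite derive1nS derive1n1 [X in is_derive _ _ _ X]derive1E; exact: DeriveDef (ddH z) _.
pose G z := derive1 H z - derive1 H p - c * (z - p).
have mono a b : a <= b -> c * (b - a) <= derive1 H b - derive1 H a.
  move=> ab; have [|z _ ->] := @MVT_segment _ (derive1 H) (derive1n 2 H) a b ab.
    by apply: derivable_within_continuous => z _; exact: ddH.
  by rewrite ler_wpM2r// subr_ge0.
pose F z := H z - derive1 H p * (z - p) - c / 2 * (z - p) ^+ 2.
have dF (z : R) : is_derive z (1 : R) F (G z).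
  rewrite /F /G; apply: is_derive_eq.
  by rewrite /GRing.scale/=; field.
have cF a b : {within `[a, b], continuous F}.
  by apply: derivable_within_continuous => z _; case: (dF z).
suff : F p <= F q by rewrite /F subrr expr0n/= !mulr0 !subr0; lra.
have [pq|/ltW qp] := leP p q.
  have [|z] := @MVT_segment _ F G p q pq (fun z _ => dF z); first exact: cF.
  rewrite in_itv/= => /andP[pz _] E; have := mono _ _ pz; rewrite /G in E.
  nra.
have [|z] := @MVT_segment _ F G q p qp (fun z _ => dF z); first exact: cF.
rewrite in_itv/= => /andP[_ zp] E; have := mono _ _ zp; rewrite /G in E.
nra.
Qed.

Lemma C2_hamiltonian (R : realType) (H : R -> R) (r : R) :
  C2 H -> uniformly_convex H -> 0 < r -> H (- r) = 0 -> H 0 = 0 ->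
  hamiltonian H r.
Proof.
move=> HC2 [c c0 Hc] r0 Hr H0; split => //; first by case: HC2.
exists (c / 2); first by rewrite divr_gt0.
exact: uniformly_convex_quadratic.
Qed.

(** The support function of the curve (p, - H p). For tau > 0 it is the Hopf-Lax kernel tau L(x /
    tau); it stays finite and Lipschitz for tau <= 0, which spares any division by a duration. *)
Definition kern (R : realType) (H : R -> R) (r x tau : R) : R :=
  sup [set x * p - tau * H p | p in `[- r, 0]].

(** The maximum of |H'| over [- r, 0], attained at an end by convexity: no characteristic is
    faster. *)
Definition speed (R : realType) (H : R -> R) (r : R) : R :=
  Num.max (derive1 H 0) (- derive1 H (- r)).

Definition kargmax (R : realType) (H : R -> R) (r x tau p : R) :=
  [/\ - r <= p, p <= 0 & x * p - tau * H p = kern H r x tau].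

Section hamiltonian.
Context (R : realType) (H : R -> R) (r : R) (hH : hamiltonian H r).
Local Notation K := (kern H r).
Local Notation M := (speed H r).
Local Notation argK := (kargmax H r).
Let r0 : 0 < r := ham_r hH.
Let dH := ham_der hH.

Lemma ham_cont : continuous H.
Proof. by move=> x; apply/differentiable_continuous/derivable1_diffP. Qed.

Lemma ham_tangent p q : H p + derive1 H p * (q - p) <= H q.
Proof.
have [c c0 /(_ p q)] := ham_sc hH; apply: le_trans.
by rewrite lerDl mulr_ge0 ?sqr_ge0// ltW.
Qed.

Lemma ham_tangent_lt p q : p != q -> H p + derive1 H p * (q - p) < H q.
Proof.
move=> pq; have [c c0 /(_ p q)] := ham_sc hH; apply: lt_le_trans.
by rewrite ltrDl mulr_gt0// exprn_even_gt0//= subr_eq0 eq_sym.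
Qed.

Lemma ham_le0 p : - r <= p -> p <= 0 -> H p <= 0.
Proof.
move=> rp p0; have := ham_tangent p 0; have := ham_tangent p (- r).
rewrite (ham_l hH) (ham_0 hH); have := r0; nra.
Qed.

Lemma dham0_gt0 : 0 < derive1 H 0.
Proof.
have /ham_tangent_lt : (0 : R) != - r by rewrite eq_sym oppr_eq0 gt_eqF.
rewrite (ham_l hH) (ham_0 hH); have := r0; nra.
Qed.

Lemma dhaml_lt0 : derive1 H (- r) < 0.
Proof.
have /ham_tangent_lt : - r != 0 by rewrite oppr_eq0 gt_eqF.
rewrite (ham_l hH) (ham_0 hH); have := r0; nra.
Qed.

Lemma speed_gt0 : 0 < M.
Proof. by rewrite lt_max dham0_gt0. Qed.

Lemma ham_ge0_out p : p <= - r \/ 0 <= p -> 0 <= H p.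
Proof.
move=> [pr|p0].
  have := ham_tangent (- r) p; rewrite (ham_l hH); have := dhaml_lt0; nra.
have := ham_tangent 0 p; rewrite (ham_0 hH); have := dham0_gt0; nra.
Qed.

(** H is nonnegative outside (- r, 0) and negative at the midpoint, so the infimum over the line,
    which enters [A0], is a minimum over [- r, 0]. *)
Lemma ham_min : exists p, [/\ - r <= p, p <= 0, H p < 0 & H p = inf (range H)].
Proof.
have rr : - r <= 0 by rewrite oppr_le0 ltW.
have [p] := @EVT_min _ H (- r) 0 rr (continuous_subspaceT ham_cont).
rewrite in_itv/= => /andP[rp p0] pmin.
have Hneg : H (- r / 2) < 0.
  have /ham_tangent_lt : - r / 2 != 0.
    by rewrite mulf_neq0 ?oppr_eq0 ?invr_neq0// gt_eqF.
  have := ham_tangent (- r / 2) (- r); rewrite (ham_l hH) (ham_0 hH).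
  have := r0; nra.
have Hp : H p < 0.
  by apply: le_lt_trans Hneg; apply: pmin; rewrite in_itv/=; have := r0; lra.
have pm q : H p <= H q.
  have [q0|q0] := leP q 0; last first.
    by apply: le_trans (ltW Hp) _; apply: ham_ge0_out; right; exact: ltW.
  have [rq|rq] := leP (- r) q; first by apply: pmin; rewrite in_itv/= rq.
  by apply: le_trans (ltW Hp) _; apply: ham_ge0_out; left; exact: ltW.
exists p; split => //; apply/eqP; rewrite eq_le; apply/andP; split.
  by apply: lb_le_inf; [exists (H p); exists p|move=> _ [q _ <-]].
by apply: ge_inf; [exists (H p) => _ [q _ <-]|exists p].
Qed.

Lemma kern_max x tau : exists p, argK x tau p.
Proof.
have rr : - r <= 0 by rewrite oppr_le0 ltW.
have cf : continuous (fun p => x * p - tau * H p).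
  move=> p; apply: cvgB; apply: cvgM; [exact: cvg_cst|exact: cvg_id|
    exact: cvg_cst|exact: ham_cont].
have [p] := EVT_max rr (continuous_subspaceT cf).
rewrite in_itv/= => /andP[rp p0] pmax; exists p; split => //.
apply/eqP; rewrite eq_le; apply/andP; split.
  apply: ub_le_sup; last by exists p => //=; rewrite in_itv/= rp.
  by exists (x * p - tau * H p) => _ [q /= qr <-]; exact: pmax.
apply: ge_sup; last by move=> _ [q /= qr <-]; exact: pmax.
by exists (x * p - tau * H p), p => //=; rewrite in_itv/= rp.
Qed.

Lemma kern_ge x tau p : - r <= p -> p <= 0 -> x * p - tau * H p <= K x tau.
Proof.
move=> rp p0; apply: ub_le_sup; last by exists p => //=; rewrite in_itv/= rp.
have rr : - r <= 0 by rewrite oppr_le0 ltW.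
have cf : continuous (fun p => x * p - tau * H p).
  move=> q; apply: cvgB; apply: cvgM; [exact: cvg_cst|exact: cvg_id|
    exact: cvg_cst|exact: ham_cont].
have [q _ qmax] := EVT_max rr (continuous_subspaceT cf).
by exists (x * q - tau * H q) => _ [z /= zr <-]; exact: qmax.
Qed.

Lemma kern_le x tau c :
  (forall p, - r <= p -> p <= 0 -> x * p - tau * H p <= c) -> K x tau <= c.
Proof. by move=> h; have [p [rp p0 <-]] := kern_max x tau; exact: h. Qed.

Lemma kern_ge0 x tau : 0 <= K x tau.
Proof.
have := @kern_ge x tau 0; rewrite (ham_0 hH) !mulr0 subrr oppr_le0.
by apply => //; exact: ltW.
Qed.

Lemma kern_geN x tau : - r * x <= K x tau.
Proof.
have := @kern_ge x tau (- r); rewrite (ham_l hH) mulr0 subr0 oppr_le0 mulrC.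
by apply => //; exact: ltW.
Qed.

(** Since H <= 0 on [- r, 0], this is the maximum of |H| there, hence the Lipschitz constant of the
    kernel in time. By [kern0] it is also the cost per unit time of standing still on the
    half-line. *)
Definition kern_lip : R := - inf (range H).

Lemma kern_lip_gt0 : 0 < kern_lip.
Proof. by rewrite /kern_lip; have [p [_ _ p0 <-]] := ham_min; rewrite oppr_gt0. Qed.

Lemma ham_norm p : - r <= p -> p <= 0 -> `|H p| <= kern_lip.
Proof.
move=> rp p0; rewrite ler0_norm ?ham_le0// lerN2.
apply: ge_inf; last by exists p.
have [q [_ _ q0 _]] := ham_min; have rr : - r <= 0 by rewrite oppr_le0 ltW.
have [z _ zmin] := @EVT_min _ H (- r) 0 rr (continuous_subspaceT ham_cont).
exists (Num.min (H z) 0) => _ [x _ <-]; rewrite ge_min.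
have [x0|x0] := leP x 0; last by rewrite (ham_ge0_out (or_intror (ltW x0))) orbT.
have [rx|rx] := leP (- r) x; first by rewrite zmin ?in_itv/= ?rx.
by rewrite (ham_ge0_out (or_introl (ltW rx))) orbT.
Qed.

Lemma kern_lipschitz x tau x' tau' :
  `|K x tau - K x' tau'| <= r * `|x - x'| + kern_lip * `|tau - tau'|.
Proof.
suff main y s y' s' : K y s - K y' s' <= r * `|y - y'| + kern_lip * `|s - s'|.
  by rewrite ler_norml main lerNl opprB (distrC x) (distrC tau) main.
have [p [rp p0 <-]] := kern_max y s.
have := kern_ge y' s' rp p0.
have h1 : (y - y') * p <= r * `|y - y'|.
  apply: le_trans (ler_norm _) _; rewrite normrM mulrC ler_wpM2r//.
  by rewrite ler0_norm// lerNl.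
have h2 : (s' - s) * H p <= kern_lip * `|s - s'|.
  apply: le_trans (ler_norm _) _; rewrite normrM mulrC distrC ler_wpM2r//.
  exact: ham_norm.
lra.
Qed.

Lemma kern_homog l x tau : 0 <= l -> K (l * x) (l * tau) = l * K x tau.
Proof.
move=> l0; apply/eqP; rewrite eq_le; apply/andP; split.
  apply: kern_le => p rp p0; have := kern_ge x tau rp p0; nra.
have [p [rp p0 <-]] := kern_max x tau.
by have := kern_ge (l * x) (l * tau) rp p0; lra.
Qed.

(** For tau > 0 the objective is monotone in p at such distances, so an end of [- r, 0] is a
    maximiser, and H vanishes at both ends. The tangents to H at the ends express this. *)
Lemma kern_far x tau : M * tau <= `|x| -> K x tau = Num.max 0 (- r * x).
Proof.
move=> Mx; apply/eqP; rewrite eq_le; apply/andP; split; last first.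
  by rewrite ge_max kern_ge0 kern_geN.
have M1 : derive1 H 0 <= M by rewrite le_max lexx.
have M2 : - derive1 H (- r) <= M by rewrite le_max lexx orbT.
apply: kern_le => p rp p0; have Hp := ham_le0 rp p0.
rewrite le_max; have [x0|x0] := leP 0 x.
  apply/orP; left; rewrite ger0_norm// in Mx.
  have [t0|t0] := leP tau 0; first by nra.
  have := ham_tangent 0 p; rewrite (ham_0 hH) => T0.
  have : tau * (derive1 H 0 * p) <= tau * H p by rewrite ler_pM2l//; lra.
  have : (x - derive1 H 0 * tau) * p <= 0 by rewrite mulr_ge0_le0// subr_ge0; nra.
  lra.
apply/orP; right; rewrite ltr0_norm// in Mx.
have [t0|t0] := leP tau 0; first by nra.
have := ham_tangent (- r) p; rewrite (ham_l hH) => T0.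
have : tau * (derive1 H (- r) * (p + r)) <= tau * H p by rewrite ler_pM2l//; lra.
have : (x - derive1 H (- r) * tau) * (p + r) <= 0.
  by rewrite mulr_le0_ge0//; [rewrite subr_le0; nra|lra].
lra.
Qed.

Lemma kern0 tau : 0 <= tau -> K 0 tau = tau * kern_lip.
Proof.
move=> t0; have [q [rq q0 Hq0 Hq]] := ham_min.
apply/eqP; rewrite eq_le; apply/andP; split.
  apply: kern_le => p rp p0; have := ham_norm rp p0; rewrite ler_norml; nra.
by have := kern_ge 0 tau rq q0; rewrite /kern_lip -Hq; nra.
Qed.

Lemma kern_lagrangian x tau : 0 < tau -> K x tau = tau * lagrangian H r (x / tau).
Proof.
move=> t0; have -> : lagrangian H r (x / tau) = K (x / tau) 1.
  rewrite /lagrangian /kern; congr sup; apply/seteqP.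
  by split => _ [p ? <-]; exists p => //; rewrite mul1r.
by rewrite -kern_homog ?ltW// mulr1 mulrC divfK// gt_eqF.
Qed.

Lemma lagrangian_ge a p : - r <= p -> p <= 0 -> a * p - H p <= lagrangian H r a.
Proof.
move=> rp p0; have := kern_ge a 1 rp p0; rewrite mul1r.
by rewrite (@kern_lagrangian a 1)// divr1 mul1r.
Qed.

Lemma lagrangian_lipschitz a b :
  `|lagrangian H r a - lagrangian H r b| <= r * `|a - b|.
Proof.
have := kern_lipschitz a 1 b 1; rewrite subrr normr0 mulr0 addr0.
by rewrite !kern_lagrangian// !divr1 !mul1r.
Qed.

Lemma lagrangian_ge0 a : 0 <= lagrangian H r a.
Proof. by have := kern_ge0 a 1; rewrite kern_lagrangian// divr1 mul1r. Qed.

Lemma kargmax_affine x tau p x' tau' : argK x tau p ->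
  K x tau + p * (x' - x) - H p * (tau' - tau) <= K x' tau'.
Proof. by move=> [rp p0 <-]; have := kern_ge x' tau' rp p0; lra. Qed.

(* Biconjugation: the inequality is tested at infinity for the range of q and
   at x' = tau H'(q), where q is the maximiser. *)
Lemma kargmax_subgradient x tau q : 0 <= tau ->
  (forall x', K x tau + q * (x' - x) <= K x' tau) -> argK x tau q.
Proof.
move=> t0 Hq.
have k0 := kern_ge0 x tau; have M0 := speed_gt0.
have q0 : q <= 0.
  rewrite leNgt; apply/negP => q0.
  pose x' := `|x| + M * tau + 1.
  have xx : x <= `|x| by exact: ler_norm.
  have Mt : 0 <= M * tau by rewrite mulr_ge0// ltW.
  have x'0 : 0 < x' by rewrite /x'; have := normr_ge0 x; lra.
  have := Hq x'; rewrite (@kern_far x'); last first.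
    by rewrite (gtr0_norm x'0) /x'; have := normr_ge0 x; lra.
  rewrite max_l; last by have := r0; nra.
  have : 0 < q * (x' - x) by rewrite mulr_gt0// /x'; lra.
  lra.
have rq : - r <= q.
  rewrite leNgt; apply/negP => rq.
  pose z := `|x| + M * tau + 1.
  have xx : - x <= `|x| by rewrite ler_normr lexx orbT.
  have Mt : 0 <= M * tau by rewrite mulr_ge0// ltW.
  have z0 : 0 < z by rewrite /z; have := normr_ge0 x; lra.
  have := Hq (- z); rewrite (@kern_far (- z)); last first.
    by rewrite normrN (gtr0_norm z0) /z; have := normr_ge0 x; lra.
  rewrite max_r; last by have := r0; nra.
  have := kern_geN x tau.
  have : 0 < (q + r) * (- z - x).
    by rewrite nmulr_rgt0; [rewrite /z; lra|lra].
  lra.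
split => //; apply/eqP; rewrite eq_le kern_ge//=.
have := Hq (tau * derive1 H q).
have : K (tau * derive1 H q) tau <= tau * derive1 H q * q - tau * H q.
  apply: kern_le => p _ _; have := ham_tangent q p; nra.
lra.
Qed.

(** For tau > 0 the midpoint of two maximisers would do better, by strict convexity. For tau <= 0
    the term - tau H p is nonpositive, and x p alone is largest at a single end of [- r, 0]. *)
Lemma kargmax_uniq x tau p q : x != 0 \/ 0 < tau ->
  argK x tau p -> argK x tau q -> p = q.
Proof.
move=> hx [rp p0 Ep] [rq q0 Eq]; apply/eqP; apply/negP => /negP pq.
have [t0|t0] := ltP 0 tau.
  pose m := (p + q) / 2.
  have mp : m != p by apply/eqP => E; move/eqP: pq; apply; rewrite /m in E; lra.
  have mq : m != q by apply/eqP => E; move/eqP: pq; apply; rewrite /m in E; lra.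
  have := ham_tangent_lt mp; have := ham_tangent_lt mq.
  have : x * m - tau * H m <= K x tau by apply: kern_ge; rewrite /m; lra.
  move=> h1 h2 h3.
  have : tau * (2 * H m) < tau * (H p + H q).
    rewrite ltr_pM2l//; have : derive1 H m * (q - m) + derive1 H m * (p - m) = 0.
      by rewrite /m; field.
    lra.
  rewrite /m in h1 *; lra.
have x0 : x != 0 by case: hx => // /(le_lt_trans t0); rewrite ltxx.
have Hp := ham_le0 rp p0; have Hq := ham_le0 rq q0.
have xM : M * tau <= `|x|.
  by rewrite (le_trans _ (normr_ge0 x))// mulr_ge0_le0// ltW ?speed_gt0.
have := kern_far xM; rewrite -Ep; have := kern_far xM; rewrite -Eq.
have [{}x0|{}x0|E] := ltgtP x 0; last by rewrite E eqxx in x0.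
  rewrite max_r; last by have := r0; nra.
  move=> E2 E1; move/eqP: pq; apply.
  have -> : p = - r by nra.
  by have -> : q = - r by nra.
rewrite max_l; last by have := r0; nra.
move=> E2 E1; move/eqP: pq; apply.
have -> : p = 0 by nra.
by have -> : q = 0 by nra.
Qed.

Lemma kargmax_interior x tau q : argK x tau q -> - r < q -> q < 0 ->
  x = tau * derive1 H q.
Proof.
move=> [_ _ Eq] rq q0.
pose F p := x * p - tau * H p.
have dF (p : R) : is_derive p (1 : R) F (x - tau * derive1 H p).
  have dHp : is_derive p (1 : R) H (derive1 H p) by rewrite derive1E; exact: DeriveDef.
  by rewrite /F; apply: is_derive_eq; rewrite /GRing.scale/=; ring.
have qin : q \in `]- r, 0[ by rewrite in_itv/= rq.
have := @derive1_at_max _ F (- r) 0 q _ _ qin _.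
rewrite oppr_le0 (ltW r0) => /(_ isT) [].
- by move=> p _; case: (dF p).
- move=> p; rewrite in_itv/= => /andP[rp p0]; rewrite /F Eq.
  by apply: kern_ge; exact: ltW.
by move=> _; have [_ ->] := dF q; lra.
Qed.

Lemma ham_eq0 q : - r <= q -> q <= 0 -> ~~ ((- r < q) && (q < 0)) -> H q = 0.
Proof.
move=> rq q0; rewrite negb_and -!leNgt => /orP[h|h].
  by rewrite (_ : q = - r) ?(ham_l hH)//; apply/eqP; rewrite eq_le h.
by rewrite (_ : q = 0) ?(ham_0 hH)//; apply/eqP; rewrite eq_le q0.
Qed.

(** Uniqueness of q leaves a gap outside each neighbourhood of q. For small h and k the maximiser at
    the shifted point falls into that neighbourhood, where H is close to H q. The matching lower
    bound is [kargmax_affine]. *)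
Lemma kern_expand x tau q e : argK x tau q -> x != 0 \/ 0 < tau -> 0 < e ->
  exists2 d : R, 0 < d & forall h k : R, `|h| < d -> `|k| < d ->
    K (x + h) (tau + k) <= K x tau + q * h - H q * k + e * (`|h| + `|k|).
Proof.
move=> hq hx e0; have [rq q0 Eq] := hq.
have /cvgrPdist_le/(_ e e0)/nbhs_ballP[eta0 /= eta00 Heta] : H z @[z --> q] --> H q.
  exact: ham_cont.
pose eta := Num.min (eta0 / 2) e.
have eta_gt0 : 0 < eta by rewrite lt_min e0 divr_gt0.
pose B := `[- r, 0]%classic `\` ball q eta.
have cB : compact B.
  rewrite /B setDE; apply: compact_closedI; first exact: segment_compact.
  exact/open_closedC/ball_open.
pose F p := - (x * p - tau * H p).
have cF : continuous F.
  move=> p; apply: cvgN; apply: cvgB; apply: cvgM; [exact: cvg_cst|exact: cvg_id|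
    exact: cvg_cst|exact: ham_cont].
have [|d1 d10 Hd1] := compact_strict_gap (c := - K x tau) cB (continuous_subspaceT cF).
  move=> p [/=]; rewrite in_itv/= => /andP[rp p0] pb.
  rewrite /F ltrN2 lt_neqAle kern_ge// andbT; apply/eqP => Ep.
  by apply: pb; rewrite (kargmax_uniq hx (And3 rp p0 Ep) hq); exact: ballxx.
have c0 : 0 < r + kern_lip by rewrite addr_gt0// kern_lip_gt0.
exists (d1 / (r + kern_lip) / 4); first by rewrite !divr_gt0.
move=> h k hd kd; have [p [rp p0 Ep]] := kern_max (x + h) (tau + k).
have hk : (r + kern_lip) * (`|h| + `|k|) < d1 / 2.
  have : `|h| + `|k| < d1 / 2 / (r + kern_lip).
    rewrite (mulrAC d1); lra.
  by rewrite ltr_pdivlMr// mulrC.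
have pb : ball q eta p.
  apply: contrapT => pb; have := Hd1 p; rewrite /F.
  move=> /(_ (conj _ pb)); rewrite /= in_itv/= rp p0 => /(_ isT) Fp.
  have := kern_lipschitz x tau (x + h) (tau + k).
  have -> : x - (x + h) = - h by ring.
  have -> : tau - (tau + k) = - k by ring.
  rewrite !normrN ler_norml => /andP[_ hK].
  have hh : h * p <= r * `|h|.
    apply: le_trans (ler_norm _) _; rewrite normrM mulrC ler_wpM2r//.
    by rewrite ler0_norm// lerNl.
  have kk : - k * H p <= kern_lip * `|k|.
    apply: le_trans (ler_norm _) _; rewrite normrM mulrC normrN ler_wpM2r//.
    exact: ham_norm.
  have rk : 0 <= r * `|k| by rewrite mulr_ge0// ltW.
  have lh : 0 <= kern_lip * `|h| by rewrite mulr_ge0// ltW// kern_lip_gt0.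
  lra.
have pq : `|p - q| <= e.
  move: pb; rewrite -ball_normE /= distrC => /ltW/le_trans; apply.
  by rewrite /eta ge_min lexx orbT.
have Hpq : `|H q - H p| <= e.
  apply: Heta; move: pb; rewrite -!ball_normE /= => /lt_le_trans; apply.
  by rewrite ge_min ler_pdivrMr// ler_peMr// ?ler1n// ltW.
have := kern_ge x tau rp p0; rewrite -Ep.
have h1 : h * (p - q) <= `|h| * e.
  by apply: le_trans (ler_norm _) _; rewrite normrM ler_wpM2l.
have h2 : k * (H q - H p) <= `|k| * e.
  by apply: le_trans (ler_norm _) _; rewrite normrM ler_wpM2l.
lra.
Qed.

End hamiltonian.

(** * First arrival at the junction *)

Section inf_real.
Context (R : realType).

Lemma inf_image_le (I : Type) (A : set I) (f : I -> R) (c : R) i :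
  (forall j, A j -> c <= f j) -> A i -> inf [set f j | j in A] <= f i.
Proof.
move=> cf Ai; apply: ge_inf; last by exists i.
by exists c => _ [j Aj <-]; exact: cf.
Qed.

Lemma inf_image_eq (I : Type) (A : set I) (f : I -> R) i :
  A i -> (forall j, A j -> f i <= f j) -> inf [set f j | j in A] = f i.
Proof.
move=> Ai fi; apply/eqP; rewrite eq_le (inf_image_le fi)//=.
by apply: lb_le_inf => [|_ [j Aj <-]]; [exists (f i), i|exact: fi].
Qed.

End inf_real.

Section slopes.
Context (R : realType).
Local Notation mu := (@lebesgue_measure R).

(** By [lipschitz_ae_nondecreasing], f - s x is nondecreasing. Equal end values would make it
    constant, against its positive derivative at some inner point. *)
Lemma lipschitz_ae_slope_lt (f : R -> R) (L a b s : R) : a < b -> 0 <= L ->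
  (forall x y, `|f x - f y| <= L * `|x - y|) ->
  {ae mu, forall x, a < x < b -> derivable f x 1 /\ s < derive1 f x} ->
  s * (b - a) < f b - f a.
Proof.
move=> ab L0 Lf df.
pose g x := f x - s * x.
have gE x : derivable f x 1 -> derivable g x 1 /\ derive1 g x = derive1 f x - s.
  move=> dfx; have dg : is_derive x (1 : R) g (derive1 f x - s).
    have dfx' : is_derive x (1 : R) f (derive1 f x) by rewrite derive1E; exact: DeriveDef.
    by rewrite /g; apply: is_derive_eq; rewrite /GRing.scale/=; ring.
  by split; [case: dg|rewrite derive1E; case: dg].
have Lg x y : `|g x - g y| <= (L + `|s|) * `|x - y|.
  have -> : g x - g y = (f x - f y) - s * (x - y) by rewrite /g; ring.
  by rewrite (le_trans (ler_normB _ _))// normrM mulrDl lerD2r.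
have mono x y : a <= x -> x <= y -> y <= b -> g x <= g y.
  move=> ax xy yb; apply: (@lipschitz_ae_nondecreasing _ g (L + `|s|)) => //.
    by rewrite addr_ge0.
  apply: ae_sub df => z H /andP[xz zy].
  have [|dz sz] := H; first by rewrite (le_lt_trans ax xz) (lt_le_trans zy yb).
  by have [dg ->] := gE _ dz; split => //; rewrite subr_ge0 ltW.
suff : g a < g b by rewrite /g; lra.
rewrite lt_neqAle; apply/andP; split; last by apply: mono => //; exact: ltW.
apply/eqP => gab.
have gc x : a <= x <= b -> g x = g a.
  move=> /andP[ax xb]; apply/eqP; rewrite eq_le; apply/andP; split.
    by rewrite gab; exact: mono.
  exact: mono.
have [N [mN N0 HN]] := ae_null_cover df.
have [x xab Nx] : exists2 x, a < x < b & ~ N x.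
  apply: contrapT => H; have : (mu `]a, b[ <= mu N)%E.
    apply: mu_le => // x /=; rewrite in_itv/= => xab.
    by apply: contrapT => Nx; apply: H; exists x.
  by rewrite N0 lebesgue_measure_itv/= lte_fin ab -EFinB lee_fin leNgt subr_gt0 ab.
have [dx sx] := HN _ Nx xab; have [dg dgE] := gE _ dx.
suff : derive1 g x = 0 by rewrite dgE => /eqP; rewrite subr_eq0 gt_eqF.
move: xab => /andP[ax xb].
have := @near_eq_derive _ _ _ g (cst (g a)) x 1 _.
rewrite derive_cst -derive1E => -> //.
near=> z; apply: gc; apply/andP; split; apply: ltW; near: z.
  exact: lt_nbhsr.
exact: lt_nbhsl.
Unshelve. all: by end_near. Qed.

End slopes.

Definition halfline (R : realType) (s : bool) : set R :=
  [set y | if s then 0 <= y else y <= 0].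

(** Integrated form of the slope conditions on the initial datum. The strictness of both bounds is
    what makes [scale_start] and [direct_excludes_junction] work. *)
Definition sloped (R : realType) (u : R -> R) (s : bool) (r : R) :=
  forall y y', halfline s y -> halfline s y' -> y < y' ->
    0 < u y - u y' < r * (y' - y).

(** The Hopf-Lax formula with starting points confined to one closed half-line. *)
Definition direct (R : realType) (H : R -> R) (r : R) (u : R -> R) (s : bool)
    (x t : R) : R :=
  inf [set u y + kern H r (x - y) t | y in halfline s].

Section direct.
Context (R : realType) (H : R -> R) (r : R) (hH : hamiltonian H r).
Context (u : R -> R) (s : bool) (hu : sloped u s r) (cu : continuous u).
Local Notation K := (kern H r).
Local Notation M := (speed H r).
Local Notation D := (@halfline R s).
Local Notation d := (direct H r u s).
Let r0 : 0 < r := ham_r hH.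

Lemma halfline_between y y' z : D y -> D y' -> y <= z <= y' -> D z.
Proof.
rewrite /halfline/=; case: s => Dy Dy' /andP[yz zy'].
  exact: le_trans yz.
exact: le_trans Dy'.
Qed.

Lemma sloped_le y y' : D y -> D y' -> y <= y' -> 0 <= u y - u y' <= r * (y' - y).
Proof.
move=> Dy Dy'; rewrite le_eqVlt => /predU1P[->|yy']; first by rewrite !subrr mulr0 lexx.
by have /andP[h1 h2] := hu Dy Dy' yy'; rewrite !ltW.
Qed.

(* Beyond distance M t the kernel is affine with slope 0 or - r, so moving the
   starting point towards x does not increase the cost. *)
Lemma direct_truncate x t y : D x -> D y -> 0 <= t -> exists y',
  [/\ D y', `|x - y'| <= M * t & u y' + K (x - y') t <= u y + K (x - y) t].
Proof.
move=> Dx Dy t0; have M0 := speed_gt0 hH.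
have Mt : 0 <= M * t by rewrite mulr_ge0// ltW.
have [xy|xy] := leP `|x - y| (M * t); first by exists y.
have far z : M * t <= z -> `|z| = z.
  by move=> h; rewrite ger0_norm// (le_trans Mt).
have [yx|yx] := leP y x.
  rewrite ger0_norm ?subr_ge0// in xy.
  exists (x - M * t); have Dy' : D (x - M * t) by apply: halfline_between Dy Dx _; lra.
  split => //; first by rewrite opprB addrC subrK ger0_norm.
  have /andP[h _] := sloped_le Dy Dy' ltac:(lra).
  rewrite !(kern_far hH); last 2 first.
  - by rewrite far// ltW.
  - by rewrite opprB addrC subrK far.
  rewrite !max_l; [lra|have := r0; nra|have := r0; nra].
rewrite ltr0_norm ?subr_lt0// opprB in xy.
exists (x + M * t); have Dy' : D (x + M * t) by apply: halfline_between Dx Dy _; lra.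
split => //; first by rewrite opprD addrA subrr sub0r normrN ger0_norm.
have /andP[_ h] := sloped_le Dy' Dy ltac:(lra).
rewrite !(kern_far hH); last 2 first.
- by rewrite distrC far// ltW.
- by rewrite opprD addrA subrr sub0r normrN far.
rewrite !max_r; [lra|have := r0; nra|have := r0; nra].
Qed.

Lemma direct_min x t : D x -> 0 <= t -> exists y,
  [/\ D y, `|x - y| <= M * t, d x t = u y + K (x - y) t &
      forall z, D z -> d x t <= u z + K (x - z) t].
Proof.
move=> Dx t0; have M0 := speed_gt0 hH.
have Mt : 0 <= M * t by rewrite mulr_ge0// ltW.
pose A := `[x - M * t, x + M * t]%classic `&` D.
have cA : compact A.
  apply: compact_closedI; first exact: segment_compact.
  rewrite /halfline; case: s; last exact: closed_le.
  exact: closed_ge.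
pose F y := u y + K (x - y) t.
have cF : continuous F.
  move=> y; apply: cvgD; first exact: cu.
  apply/cvgrPdist_le => e e0; near=> z.
  have := kern_lipschitz hH (x - y) t (x - z) t.
  rewrite subrr normr0 mulr0 addr0 => /le_trans; apply.
  have -> : x - y - (x - z) = z - y by ring.
  rewrite mulrC -ler_pdivlMr// distrC; near: z.
  by apply: cvgr_dist_le; rewrite ?divr_gt0//; exact: cvg_id.
have A0 : A !=set0 by exists x; split => //=; rewrite in_itv/=; lra.
have [y /set_mem[yx Dy] ymin] := compact_EVT_min A0 cA (continuous_subspaceT cF).
have yle z : D z -> F y <= u z + K (x - z) t.
  move=> Dz; have [z' [Dz' xz' zz']] := direct_truncate Dx Dz t0.
  apply: le_trans zz'; apply: ymin; apply/mem_set; split => //=.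
  by move: xz'; rewrite in_itv/= ler_norml; lra.
have dE : d x t = F y by exact: inf_image_eq.
exists y; split => //.
  by move: yx; rewrite /= in_itv/= ler_norml; lra.
by move=> z /yle; rewrite dE.
Unshelve. all: by end_near. Qed.

Lemma direct_le x t y : D x -> 0 <= t -> D y -> d x t <= u y + K (x - y) t.
Proof. by move=> Dx t0; have [z [_ _ _]] := direct_min Dx t0; apply. Qed.

Lemma direct_lipschitz x t x' t' : D x -> D x' -> 0 <= t -> 0 <= t' ->
  `|d x t - d x' t'| <= r * `|x - x'| + kern_lip H * `|t - t'|.
Proof.
suff main y b y' b' : D y -> D y' -> 0 <= b -> 0 <= b' ->
    d y b - d y' b' <= r * `|y - y'| + kern_lip H * `|b - b'|.
  move=> Dx Dx' t0 t'0.
  by rewrite ler_norml main// lerNl opprB (distrC x) (distrC t) main.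
move=> Dy Dy' b0 b'0; have [z [Dz _ -> _]] := direct_min Dy' b'0.
have := direct_le Dy b0 Dz; have := kern_lipschitz hH (y - z) b (y' - z) b'.
have -> : y - z - (y' - z) = y - y' by ring.
by rewrite ler_norml => /andP[_]; lra.
Qed.

Lemma direct0 : d 0 0 = u 0.
Proof.
have D0 : D 0 by rewrite /halfline/=; case: s.
have [y [_ ]] := direct_min D0 (lexx 0).
rewrite mulr0 normr_le0 subr_eq0 => /eqP <- -> _.
by rewrite subrr kern0// mul0r addr0.
Qed.

(** A path to the origin is shrunk by the factor l in space and time. By homogeneity the kernel is
    multiplied by l, and since K (- y) t is at least 0 and at least r y, its decrease outweighs any
    increase of u. This makes first arrival strictly costlier at later times. *)
Lemma scale_start y t l : D y -> 0 < t -> 0 <= l -> l < 1 ->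
  u (l * y) + K (- (l * y)) (l * t) < u y + K (- y) t.
Proof.
move=> Dy t0 l0 l1; rewrite -mulrN kern_homog//.
have Dly : D (l * y).
  by move: Dy; rewrite /halfline/=; case: s => ?; [exact: mulr_ge0|exact: mulr_ge0_le0].
have k0 := kern_ge0 hH (- y) t; have kN := kern_geN hH (- y) t.
have [y0|y0|y0] := ltgtP y 0.
- have /(hu Dy Dly)/andP[h1 h2] : y < l * y by nra.
  nra.
- have /(hu Dly Dy)/andP[h1 h2] : l * y < y by nra.
  nra.
- rewrite y0 mulr0 oppr0 ltrD2l gtr_pMl// kern0 ?ltW// mulr_gt0//.
  exact: (kern_lip_gt0 hH).
Qed.

Lemma direct0_lt t t' : 0 <= t -> t < t' -> d 0 t < d 0 t'.
Proof.
move=> t0 tt'; have t'0 := le_lt_trans t0 tt'.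
have D0 : D 0 by rewrite /halfline/=; case: s.
have [y [Dy _ -> _]] := direct_min D0 (ltW t'0).
have l0 : 0 <= t / t' by rewrite divr_ge0// ltW.
have l1 : t / t' < 1 by rewrite ltr_pdivrMr// mul1r.
have Dly : D (t / t' * y).
  by move: Dy; rewrite /halfline/=; case: s => ?; [exact: mulr_ge0|exact: mulr_ge0_le0].
rewrite sub0r; apply: le_lt_trans (scale_start Dy t'0 l0 l1).
by rewrite divfK ?gt_eqF//; have := direct_le D0 t0 Dly; rewrite sub0r.
Qed.

End direct.

Section first_arrival.
Context (R : realType) (P : junction R) (hP : standing_assumptions P).
Local Notation mu := (@lebesgue_measure R).

Definition sideH (s : bool) := if s then HR P else HL P.
Definition sideR (s : bool) := if s then RR P else RL P.

Lemma side_ham s : hamiltonian (sideH s) (sideR s).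
Proof.
by case: hP => *; case: s => /=; apply: C2_hamiltonian => //; intuition.
Qed.

Lemma u0_lip : exists2 L : R, 0 < L & forall x y, `|u0 P x - u0 P y| <= L * `|x - y|.
Proof.
have [L0 [_ HL0]] := u0_lipschitz hP.
exists (`|L0| + 1); first by rewrite ltr_wpDl.
move=> x y; have := HL0 (`|L0| + 1) _ (x, y) => /=; apply => //.
by rewrite (le_lt_trans (ler_norm _))// ltrDl.
Qed.

Lemma u0_continuous : continuous (u0 P).
Proof.
have [L L0 HL'] := u0_lip => x; apply/cvgrPdist_le => e e0; near=> z.
apply: le_trans (HL' _ _) _; rewrite mulrC -ler_pdivlMr//; near: z.
by apply: cvgr_dist_le; rewrite ?divr_gt0//; exact: cvg_id.
Unshelve. all: by end_near. Qed.

Lemma u0_sloped s : sloped (u0 P) s (sideR s).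
Proof.
have [L L0 Lu] := u0_lip; move=> y y' Dy Dy' yy'.
have LN x z : `|- u0 P x - - u0 P z| <= L * `|x - z|.
  by rewrite -opprD normrN.
have slope : {ae mu, forall x, y < x < y' ->
    derivable (u0 P) x 1 /\ - sideR s < derive1 (u0 P) x < 0}.
  move: Dy Dy'; rewrite /halfline/=; case: s => Dy Dy'.
    apply: ae_sub (u0_slopeR hP) => x h /andP[yx xy']; apply: h.
    exact: le_lt_trans yx.
  apply: ae_sub (u0_slopeL hP) => x h /andP[yx xy']; apply: h.
  exact: lt_le_trans Dy'.
have h1 := @lipschitz_ae_slope_lt _ (u0 P) L y y' (- sideR s) yy' (ltW L0) Lu.
have h2 := @lipschitz_ae_slope_lt _ (fun x => - u0 P x) L y y' 0 yy' (ltW L0) LN.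
apply/andP; split; last first.
  have := h1 _; rewrite mulNr => /(_ _); rewrite ltrNl opprB; apply.
  by apply: ae_sub slope => x h /h[? /andP[]].
have := h2 _; rewrite mul0r opprK addrC; apply.
apply: ae_sub slope => x h /h[dx /andP[_ dx0]]; split; first exact: derivableN.
by rewrite derive1E deriveN// oppr_gt0 -derive1E.
Qed.

Definition arrival (t : R) : R :=
  Num.min (direct (HR P) (RR P) (u0 P) true 0 t)
          (direct (HL P) (RL P) (u0 P) false 0 t).

Lemma halfline0 s : @halfline R s 0.
Proof. by rewrite /halfline/=; case: s. Qed.

Lemma arrival_le s t y : 0 <= t -> halfline s y ->
  arrival t <= u0 P y + kern (sideH s) (sideR s) (- y) t.
Proof.
move=> t0 Dy; have := direct_le (side_ham s) (@u0_sloped s) u0_continuous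
  (halfline0 s) t0 Dy; rewrite sub0r; apply: le_trans.
by rewrite /arrival; case: s Dy => _; rewrite ge_min lexx ?orbT.
Qed.

Lemma arrival_min t : 0 <= t -> exists s y, halfline s y /\
  arrival t = u0 P y + kern (sideH s) (sideR s) (- y) t.
Proof.
move=> t0; have [s ->] : exists s,
    arrival t = direct (sideH s) (sideR s) (u0 P) s 0 t.
  by rewrite /arrival minEle; case: ifP => _; [exists true|exists false].
have [y [Dy _ -> _]] := direct_min (side_ham s) (@u0_sloped s) u0_continuous
  (halfline0 s) t0.
by exists s, y; rewrite sub0r.
Qed.

Lemma arrival0 : arrival 0 = u0 P 0.
Proof.
rewrite /arrival.
have := direct0 (side_ham true) (@u0_sloped true) u0_continuous.
have := direct0 (side_ham false) (@u0_sloped false) u0_continuous.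
by move=> /= -> ->; rewrite minxx.
Qed.

Lemma arrival_lt t t' : 0 <= t -> t < t' -> arrival t < arrival t'.
Proof.
move=> t0 tt'; rewrite /arrival lt_min !gt_min.
have := direct0_lt (side_ham true) (@u0_sloped true) u0_continuous t0 tt'.
have := direct0_lt (side_ham false) (@u0_sloped false) u0_continuous t0 tt'.
by move=> /= -> ->; rewrite orbT.
Qed.

Lemma arrival_lipschitz : exists2 L : R, 0 < L & forall t t', 0 <= t -> 0 <= t' ->
  `|arrival t - arrival t'| <= L * `|t - t'|.
Proof.
exists (kern_lip (HR P) + kern_lip (HL P)).
  by rewrite addr_gt0// (kern_lip_gt0 (side_ham true), kern_lip_gt0 (side_ham false)).
suff main t t' : 0 <= t -> 0 <= t' ->
    arrival t - arrival t' <= (kern_lip (HR P) + kern_lip (HL P)) * `|t - t'|.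
  move=> t t' t0 t'0; rewrite ler_norml; apply/andP; split; last exact: main.
  by rewrite lerNl opprB distrC; exact: main.
move=> t0 t'0.
have lR := kern_lip_gt0 (side_ham true); have lL := kern_lip_gt0 (side_ham false).
have := direct_lipschitz (side_ham true) (@u0_sloped true) u0_continuous
  (halfline0 true) (halfline0 true) t0 t'0.
have := direct_lipschitz (side_ham false) (@u0_sloped false) u0_continuous
  (halfline0 false) (halfline0 false) t0 t'0.
rewrite /= in lR lL *.
rewrite subrr normr0 !mulr0 !add0r !ler_norml /arrival => /andP[_ h1] /andP[_ h2].
have h3 : 0 <= kern_lip (HR P) * `|t - t'| by rewrite mulr_ge0// ltW.
have h4 : 0 <= kern_lip (HL P) * `|t - t'| by rewrite mulr_ge0// ltW.
rewrite lerBlDr addrC -lerBlDr le_min; apply/andP; split.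
  rewrite lerBlDr (le_trans (_ : _ <= direct (HR P) (RR P) (u0 P) true 0 t))//.
    by rewrite ge_min lexx.
  lra.
rewrite lerBlDr (le_trans (_ : _ <= direct (HL P) (RL P) (u0 P) false 0 t))//.
  by rewrite ge_min lexx orbT.
lra.
Qed.

Lemma A0_lt0 : A0 P < 0.
Proof.
rewrite /A0 gt_max.
have := kern_lip_gt0 (side_ham true); have := kern_lip_gt0 (side_ham false).
by rewrite /kern_lip /= !oppr_gt0 => -> ->.
Qed.

(** Standing still beside the junction costs at least the maximal waiting rate - A0 at the
    junction. *)
Lemma A0_ge s : - kern_lip (sideH s) <= A0 P.
Proof. by rewrite /kern_lip opprK /A0 le_max; case: s; rewrite lexx ?orbT. Qed.

End first_arrival.

(** * Lower bounds for the cost of a path *)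

Section primitives.
Context (R : realType).
Local Notation mu := (@lebesgue_measure R).

Lemma integrable_ooS (f : R -> R) (a b c d : R) :
  mu.-integrable `]a, b[ (EFin \o f) -> a <= c -> d <= b ->
  mu.-integrable `]c, d[ (EFin \o f).
Proof.
move=> fi ac db; apply: integrableS fi => //.
move=> x /=; rewrite !in_itv/= => /andP[cx xd].
by rewrite (le_lt_trans ac cx) (lt_le_trans xd db).
Qed.

Lemma Rintegral_split (f : R -> R) (a b c : R) :
  mu.-integrable `]a, b[ (EFin \o f) -> a <= c <= b ->
  \int[mu]_(x in `]a, b[) f x =
  \int[mu]_(x in `]a, c[) f x + \int[mu]_(x in `]c, b[) f x.
Proof.
move=> fi /andP[ac cb].
move: (cb); rewrite le_eqVlt => /predU1P[E|cb'].
  by rewrite -E [in X in _ + X]set_itv_ge ?bnd_simp// Rintegral_set0 addr0.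
have := @Rintegral_itvB _ f (BRight a) (BLeft b) c fi.
rewrite !bnd_simp => /(_ ac cb') <-.
have <- := Rintegral_itv_bndo_bndc (integrable_ooS fi (lexx a) cb).
by rewrite addrC subrK.
Qed.

Definition clamp (a b x : R) : R := Num.max a (Num.min x b).

Lemma clamp_in a b x : a <= b -> a <= clamp a b x <= b.
Proof. by move=> ab; rewrite /clamp le_max lexx ge_max ab ge_min lexx orbT. Qed.

Lemma clamp_id a b x : a <= x <= b -> clamp a b x = x.
Proof. by move=> /andP[ax xb]; rewrite /clamp min_l// max_r. Qed.

Lemma clamp_continuous (f : R -> R) a b : a <= b ->
  {within `[a, b], continuous f} -> continuous (f \o clamp a b).
Proof.
move=> ab /subspace_continuousP cf x.
have cx : `[a, b]%classic (clamp a b x) by rewrite /= in_itv/= clamp_in.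
apply: cvg_comp (cf _ cx).
have cc : clamp a b z @[z --> x] --> clamp a b x.
  have : continuous (cst a \max (id \min cst b)).
    apply: max_fun_continuous; first exact: cst_continuous.
    by apply: min_fun_continuous; [move=> ?; exact: cvg_id|exact: cst_continuous].
  exact.
move=> B HB; have := cc _ HB; apply: (@filterS _ (nbhs x) _) => y; apply.
by rewrite /= in_itv/= clamp_in.
Qed.

Definition primitive_of (t : R) (c g : R -> R) :=
  [/\ continuous c, mu.-integrable `]0, t[ (EFin \o g) &
    forall a b, 0 <= a -> a <= b -> b <= t ->
      \int[mu]_(s in `]a, b[) g s = c b - c a].

Lemma integrable_oo_cst (a b k : R) : mu.-integrable `]a, b[ (EFin \o cst k).
Proof.
apply/integrableP; split; first exact/measurable_EFinP.
rewrite [ltLHS](_ : _ = \int[mu]_(x in `]a, b[) (cst `|k|%:E x))%E//.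
rewrite integral_cst//= lebesgue_measure_itv/=.
by case: ifP => _; rewrite -?EFinB -?EFinM ltry.
Qed.

Lemma square_integrable (t : R) (g : R -> R) :
  measurable_fun `]0, t[ g ->
  mu.-integrable `]0, t[ (fun s => (g s ^+ 2)%:E) ->
  mu.-integrable `]0, t[ (EFin \o g).
Proof.
move=> mg g2.
have i1 : mu.-integrable `]0, t[ (fun s => (1 + g s ^+ 2)%:E).
  rewrite (_ : (fun s => _) = (EFin \o cst 1) \+ (fun s => (g s ^+ 2)%:E))//.
  apply: integrableD => //; exact: integrable_oo_cst.
apply: le_integrable i1 => //.
  exact/measurable_EFinP.
move=> s _; rewrite /= lee_fin (ger0_norm (_ : 0 <= 1 + _)) ?addr_ge0 ?sqr_ge0//.
by rewrite ler_norml; have := sqr_ge0 (g s - 1); have := sqr_ge0 (g s + 1); nra.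
Qed.

(** The values of gamma outside [0, t] are arbitrary. Freezing the path there gives c continuous on
    the whole line, whose sign sets are open, and g is a measurable representative of the
    derivative. *)
Lemma H1_primitive (t : R) (gamma : R -> R) : 0 < t -> H1 t gamma ->
  exists c g, [/\ primitive_of t c g,
    forall s, 0 <= s <= t -> c s = gamma s &
    {ae mu, forall s, s \in `]0, t[ -> derive1 gamma s = g s}].
Proof.
move=> t0 [g [mg g2 gE]]; have gi := square_integrable mg g2.
(* Extension by zero, because the differentiation theorem applied below concerns primitives from
   minus infinity. *)
pose G := g \_ `]0, t[.
have Gi : mu.-integrable setT (EFin \o G).
  by rewrite /G -restrict_EFin; apply/integrable_restrict => //=; rewrite setTI.
have GiS (D : set R) : measurable D -> mu.-integrable D (EFin \o G).
  by move=> mD; exact: integrableS Gi.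
pose F x := \int[mu]_(s in `[0, x]) G s.
have FE x : 0 <= x <= t -> gamma x = gamma 0 + F x.
  move=> /andP[x0 xt]; rewrite gE ?in_itv/= ?x0//; congr +%R.
  rewrite /F /G -Rintegral_mkcondr.
  have [xt'|tx] := ltP x t.
    rewrite (_ : `[0, x] `&` `]0, t[ = `]0, x]%classic); last first.
      apply/seteqP; split => z /=; rewrite !in_itv/=.
        by move=> [/andP[_ ->] /andP[-> _]].
      move=> /andP[z0 zx]; rewrite z0 zx ltW//; split => //.
      exact: le_lt_trans xt'.
    rewrite Rintegral_itv_bndo_bndc//.
    exact: integrable_ooS gi _ _.
  have -> : x = t by apply/eqP; rewrite eq_le xt.
  congr Rintegral; apply/seteqP; split => z /=; rewrite !in_itv/=.
    by move=> /andP[z0 zt]; rewrite z0 zt !ltW.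
  by move=> [].
have cF : {within `[0, t], continuous gamma}.
  have := @parameterized_integral_continuous R 0 t G (ltW t0) (GiS _ _).
  rewrite /parameterized_integral => /(_ (measurable_itv _)) cF.
  apply: (@subspace_eq_continuous _ _ _ (fun x => gamma 0 + F x)) => [x|].
    by rewrite /= inE/= in_itv/= => /FE.
  by move=> x; apply: cvgD; [exact: cvg_cst|exact: cF].
exists (gamma \o clamp 0 t), g; split.
- split=> //; first exact: clamp_continuous (ltW t0) cF.
  move=> a b a0 ab bt; rewrite /= !clamp_id ?a0 ?(le_trans a0)// ?bt ?(le_trans ab)//.
  rewrite (gE a) ?(gE b) ?in_itv/= ?a0 ?bt ?(le_trans a0)// ?(le_trans ab)//.
  rewrite (@Rintegral_split g 0 b a) ?a0//; last exact: integrable_ooS gi _ _.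
  by ring.
- by move=> s sin; rewrite /= clamp_id.
have F2 : (fun x => \int[mu]_(s in `]-oo, x]) G s) = F.
  apply/funext => x; rewrite /F /G -!Rintegral_mkcondr.
  congr Rintegral; apply/seteqP; split => z /=; rewrite !in_itv/=.
    by move=> [zx /andP[z0 zt]]; rewrite zx z0 zt ltW.
  by move=> [/andP[_ zx] ?].
have := @FTC1Ny R G (fun y => GiS _ (measurable_itv _))
  (integrable_locally (measurable_itv _) gi).
rewrite F2; apply: ae_sub => s [dF FG]; rewrite in_itv/= => /andP[s0 st].
have near_s : \forall x \near s, gamma x = gamma 0 + F x.
  near=> x; apply: FE; apply/andP; split; apply: ltW; near: x.
    exact: lt_nbhsr.
  exact: lt_nbhsl.
rewrite derive1E (near_eq_derive (1 : R) near_s) deriveD// derive_cst add0r -derive1E FG.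
by rewrite /G patchE mem_set//= in_itv/= s0.
Unshelve. all: by end_near. Qed.

Lemma open_interval_itv (I : set R) (a b : R) : open I -> is_interval I ->
  I `<=` `]a, b[ -> I !=set0 ->
  exists c d, [/\ a <= c, c < d, d <= b & I = `]c, d[%classic].
Proof.
move=> oI iI Iab [x0 Ix0].
have lb : has_lbound I by exists a => x /Iab/=; rewrite in_itv/= => /andP[/ltW].
have ub : has_ubound I by exists b => x /Iab/=; rewrite in_itv/= => /andP[_ /ltW].
have I0 : I !=set0 by exists x0.
have step x : I x -> exists2 e : R, 0 < e & I (x - e) /\ I (x + e).
  move=> Ix; have [e e0 He] := mem_open_near oI Ix.
  exists (e / 2); first by rewrite divr_gt0.
  have e2 : `|e / 2| < e by rewrite gtr0_norm ?divr_gt0//; lra.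
  split; apply: He; first by rewrite addrAC subrr sub0r normrN.
  by rewrite addrAC subrr add0r.
have IE : I = `]inf I, sup I[%classic.
  apply/seteqP; split => x /=; rewrite in_itv/=.
    move=> Ix; have [e e0 [I1 I2]] := step x Ix.
    have := ge_inf lb I1; have := ub_le_sup ub I2; lra.
  move=> /andP[/(inf_lt I0)[y Iy yx] /(sup_gt I0)[z Iz xz]].
  by apply: (iI y z) => //; rewrite !ltW.
exists (inf I), (sup I); split => //.
- by apply: lb_le_inf => // x /Iab/=; rewrite in_itv/= => /andP[/ltW].
- have : `]inf I, sup I[%classic x0 by rewrite -IE.
  by rewrite /= in_itv/= => /andP[h1 h2]; exact: lt_trans h1 h2.
- by apply: ge_sup => // x /Iab/=; rewrite in_itv/= => /andP[_ /ltW].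
Qed.

(** The set where c > 0 inside (a, b) is a countable union of disjoint open intervals. At both ends
    of each one c vanishes, so g integrates to zero over it. *)
Lemma excursion_integral (t a b : R) (c g : R -> R) :
  primitive_of t c g -> 0 <= a -> a <= b -> b <= t -> c a = 0 -> c b = 0 ->
  \int[mu]_(s in `]a, b[) (g s * \1_[set r | 0 < c r] s) = 0.
Proof.
move=> [cc gi gE] a0 ab bt ca cb.
pose U := `]a, b[%classic `&` [set s | 0 < c s].
have oU : open U.
  apply: openI; first exact: itv_open.
  by have := open_comp (fun x _ => cc x) (@open_gt R 0).
have UE := open_disjoint_itv_bigcup oU.
set I := open_disjoint_itv oU in UE.
have oI n : open (I n) by exact: open_disjoint_itv_open.
have IU n : I n `<=` U by rewrite UE; exact: bigcup_sup.
have tI : trivIset setT I by exact: open_disjoint_itv_trivIset.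
have giU : mu.-integrable U (EFin \o g).
  apply: integrableS gi => //; first exact: open_measurable.
  move=> x [/=]; rewrite !in_itv/= => /andP[ax xb] _.
  by rewrite (le_lt_trans a0 ax) (lt_le_trans xb bt).
have -> : \int[mu]_(s in `]a, b[) (g s * \1_[set r | 0 < c r] s) =
    \int[mu]_(s in U) g s.
  rewrite /U Rintegral_mkcondr; apply: eq_Rintegral => s _.
  by rewrite patchE indicE; case: ifPn => _; rewrite ?mulr1 ?mulr0.
(* An adherent point of a component that is outside it cannot lie in U: it would belong to another
   component, open and therefore overlapping the first. *)
have disj n c' : I n !=set0 -> (forall e : R, 0 < e -> exists2 x, I n x & `|x - c'| < e) ->
    ~ I n c' -> ~ U c'.
  move=> _ near_c Ic' Uc'; move: (Uc'); rewrite UE => -[m _ Im].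
  have [e e0 He] := mem_open_near (oI m) Im.
  have [x Ix xc] := near_c _ e0.
  have mn : m = n by apply: tI => //; exists x; split => //; exact: He.
  by apply: Ic'; rewrite -mn.
have zero n : \int[mu]_(s in I n) g s = 0.
  have [In0|/set0P In0] := eqVneq (I n) set0; first by rewrite In0 Rintegral_set0.
  have Iab : I n `<=` `]a, b[ by move=> x /IU[].
  have [c1 [d1 [ac1 cd1 d1b IE]]] :=
    open_interval_itv (oI n) (@open_disjoint_itv_is_interval _ _ oU n) Iab In0.
  have endpoint z : a <= z <= b -> ~ U z -> (forall e : R, 0 < e -> exists2 x, I n x & `|x - z| < e) ->
      c z = 0.
    move=> /andP[az zb] Uz near_z; apply/eqP; rewrite eq_le; apply/andP; split.
      rewrite leNgt; apply/negP => cz; apply: Uz; split => //=.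
      rewrite in_itv/= !lt_neqAle az zb !andbT; apply/andP; split.
        by apply: contraTneq cz => <-; rewrite ca ltxx.
      by apply: contraTneq cz => ->; rewrite cb ltxx.
    rewrite leNgt; apply/negP => cz.
    have : open [set s | c s < 0] by exact: open_comp (fun x _ => cc x) (@open_lt R 0).
    move=> /mem_open_near/(_ cz)[e e0 He].
    have [x /IU[_ /= cx] xz] := near_z _ e0.
    by have := He _ xz; rewrite /= ltNge ltW.
  have nearc : forall e : R, 0 < e -> exists2 x, I n x & `|x - c1| < e.
    move=> e e0; exists (c1 + Num.min e (d1 - c1) / 2).
      rewrite IE/= in_itv/=; have : 0 < Num.min e (d1 - c1) by rewrite lt_min e0 subr_gt0.
      have : Num.min e (d1 - c1) <= d1 - c1 by rewrite ge_min lexx orbT.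
      lra.
    have h : 0 < Num.min e (d1 - c1) by rewrite lt_min e0 subr_gt0.
    have : Num.min e (d1 - c1) <= e by rewrite ge_min lexx.
    rewrite addrAC subrr add0r gtr0_norm ?divr_gt0//; lra.
  have neard : forall e : R, 0 < e -> exists2 x, I n x & `|x - d1| < e.
    move=> e e0; exists (d1 - Num.min e (d1 - c1) / 2).
      rewrite IE/= in_itv/=; have : 0 < Num.min e (d1 - c1) by rewrite lt_min e0 subr_gt0.
      have : Num.min e (d1 - c1) <= d1 - c1 by rewrite ge_min lexx orbT.
      lra.
    have h : 0 < Num.min e (d1 - c1) by rewrite lt_min e0 subr_gt0.
    have : Num.min e (d1 - c1) <= e by rewrite ge_min lexx.
    rewrite addrAC subrr add0r normrN gtr0_norm ?divr_gt0//; lra.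
  have nIc : ~ I n c1 by rewrite IE/= in_itv/= ltxx.
  have nId : ~ I n d1 by rewrite IE/= in_itv/= ltxx andbF.
  rewrite IE gE ?(le_trans a0 ac1) ?(ltW cd1) ?(le_trans d1b bt)//.
  rewrite (endpoint c1) ?(endpoint d1) ?subrr//.
  - by rewrite (le_trans ac1 (ltW cd1)).
  - exact: disj In0 neard nId.
  - by rewrite ac1 (le_trans (ltW cd1)).
  - exact: disj In0 nearc nIc.
rewrite /Rintegral UE integral_bigcup//; last 2 first.
- by move=> n; exact: open_measurable.
- by rewrite -UE.
rewrite eseries0// => n _ _.
have := zero n; rewrite /Rintegral => fz.
have fin : (\int[mu]_(s in I n) (g s)%:E)%E \is a fin_num.
  by apply: integrable_fin_num => //; [exact: open_measurable|
    apply: integrableS giU => //; exact: open_measurable].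
by rewrite -(fineK fin) fz.
Qed.

End primitives.

Definition wait (R : realType) (A : R -> R) (t : R) : R :=
  - \int[lebesgue_measure]_(s in `]0, t[) A s.

Definition density (R : realType) (P : junction R) (A c g : R -> R) (s : R) : R :=
  LR P (g s) * \1_[set r | 0 < c r] s + LL P (g s) * \1_[set r | c r < 0] s
  - A s * \1_[set r | c r = 0] s.

Definition strict_side (R : realType) (s : bool) (x : R) : bool :=
  if s then 0 < x else x < 0.

Lemma indic_bool (T : Type) (R : pzRingType) (S : set T) (x : T) (b : bool) :
  (S x <-> b) -> \1_S x = b%:R :> R.
Proof.
rewrite indicE; case: b => -[h1 h2]; first by rewrite mem_set//; exact: h2.
by rewrite memNset// => /h1.
Qed.

Lemma density_bool (R : realType) (P : junction R) (A c g : R -> R) (s : R) :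
  density P A c g s = LR P (g s) * (0 < c s)%R%:R + LL P (g s) * (c s < 0)%R%:R
                      - A s * (c s == 0)%R%:R.
Proof.
rewrite /density (@indic_bool _ _ [set r | 0 < c r] _ (0 < c s)) ?(@indic_bool _ _ [set r | c r < 0] _ (c s < 0))//.
by rewrite (@indic_bool _ _ [set r | c r = 0] _ (c s == 0))//=; split => /eqP.
Qed.

Lemma side_unique (R : realType) s (x : R) : strict_side s x -> s = (0 < x).
Proof. by rewrite /strict_side; case: s => [->//|x0]; rewrite ltNge ltW. Qed.

Section path_cost_bounds.
Context (R : realType) (P : junction R) (hP : standing_assumptions P).
Local Notation mu := (@lebesgue_measure R).
Local Notation T := (horizon P).
Local Notation KS s := (kern (sideH P s) (sideR P s)).

Section fixed_control.
Context (A : R -> R) (hA : control P A).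

Lemma control_bounds s : 0 < s -> s < T -> A0 P <= A s /\ A s <= 0.
Proof. by move=> s0 sT; apply/andP; apply: hA.2; rewrite in_itv/= s0. Qed.

Lemma control_integrable : mu.-integrable `]0, T[ (EFin \o A).
Proof.
apply: le_integrable (integrable_oo_cst 0 T (A0 P)) => //.
  by apply/measurable_EFinP; exact: hA.1.
move=> s; rewrite /= in_itv/= => /andP[s0 sT]; rewrite lee_fin.
by have [h1 h2] := control_bounds s0 sT; rewrite !ler0_norm// ?lerN2// (le_trans h1).
Qed.

Lemma control_integrable_oo a b : 0 <= a -> b <= T ->
  mu.-integrable `]a, b[ (EFin \o A).
Proof. exact: integrable_ooS control_integrable. Qed.

Lemma waitB a b : 0 <= a -> a <= b -> b <= T ->
  wait A b - wait A a = \int[mu]_(s in `]a, b[) (- A s).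
Proof.
move=> a0 ab bT; rewrite /wait (@Rintegral_split _ A 0 b a) ?a0//; last first.
  exact: control_integrable_oo.
rewrite opprD opprK addrAC addNr add0r.
under [RHS]eq_Rintegral do rewrite -mulN1r.
by rewrite RintegralZl ?mulN1r//; exact: control_integrable_oo.
Qed.

Lemma controlN_integrable a b : 0 <= a -> b <= T ->
  mu.-integrable `]a, b[ (EFin \o (fun s => - A s)).
Proof.
move=> a0 bT; rewrite (_ : _ \o _ = \- (EFin \o A))%E//.
by apply: integrableN; exact: control_integrable_oo.
Qed.

Lemma Rintegral_oo_cst a b k : a <= b -> \int[mu]_(s in `]a, b[) (cst k s) = k * (b - a).
Proof.
move=> ab; rewrite Rintegral_cst//= lebesgue_measure_itv/=.
case: ifP; rewrite lte_fin => ab'; first by rewrite -EFinB.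
have -> : a = b by apply/eqP; rewrite eq_le ab leNgt ab'.
by rewrite subrr mulr0.
Qed.

Lemma wait_bounds a b : 0 <= a -> a <= b -> b <= T ->
  0 <= wait A b - wait A a <= - A0 P * (b - a).
Proof.
move=> a0 ab bT; rewrite waitB//; apply/andP; split.
  have := Rintegral_oo_cst 0 ab; rewrite mul0r => <-.
  apply: le_Rintegral => //; [exact: integrable_oo_cst|exact: controlN_integrable|].
  move=> s; rewrite /= in_itv/= => /andP[as' sb]; rewrite oppr_ge0.
  by have [] := @control_bounds s (le_lt_trans a0 as') (lt_le_trans sb bT).
rewrite -Rintegral_oo_cst//.
apply: le_Rintegral => //; [exact: controlN_integrable|exact: integrable_oo_cst|].
move=> s; rewrite /= in_itv/= => /andP[as' sb]; rewrite lerN2.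
by have [] := @control_bounds s (le_lt_trans a0 as') (lt_le_trans sb bT).
Qed.

Lemma wait0 : wait A 0 = 0.
Proof. by rewrite /wait set_itv_ge ?bnd_simp ?ltxx// Rintegral_set0 oppr0. Qed.

Section primitive.
Context (t : R) (t0 : 0 < t) (tT : t <= T) (c g : R -> R).
Hypothesis hc : primitive_of t c g.

Lemma density_integrable : mu.-integrable `]0, t[ (EFin \o density P A c g).
Proof.
have [cc gi _] := hc.
have hR := side_ham hP true; have hL := side_ham hP false.
have lagc s : continuous (lagrangian (sideH P s) (sideR P s)).
  move=> x; apply/cvgrPdist_le => e e0; near=> z.
  have r0 := ham_r (side_ham hP s).
  apply: le_trans (lagrangian_lipschitz (side_ham hP s) _ _) _.
  rewrite mulrC -ler_pdivlMr//; near: z.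
  apply: cvgr_dist_le; first exact: cvg_id.
  exact: (divr_gt0 e0 (ham_r (side_ham hP s))).
have mg : measurable_fun `]0, t[ g by apply/measurable_EFinP; case/integrableP : gi.
have mgt : measurable [set r | 0 < c r].
  by apply: open_measurable; exact: open_comp (fun x _ => cc x) (@open_gt R 0).
have mlt : measurable [set r | c r < 0].
  by apply: open_measurable; exact: open_comp (fun x _ => cc x) (@open_lt R 0).
have meq : measurable [set r | c r = 0].
  rewrite (_ : [set r | _] = ~` ([set r | 0 < c r] `|` [set r | c r < 0])).
    by apply: measurableC; exact: measurableU.
  apply/seteqP; split => r /=; first by move=> -> [|]; rewrite ltxx.
  by move=> /not_orP[/negP h1 /negP h2]; apply/eqP; rewrite eq_le !leNgt h1 h2.
have mA : measurable_fun `]0, t[ A.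
  apply: measurable_funS hA.1 => //; move=> x /=; rewrite !in_itv/= => /andP[->] /=.
  by move=> /lt_le_trans; apply.
have mL s : measurable_fun `]0, t[ (lagrangian (sideH P s) (sideR P s) \o g).
  by apply: measurableT_comp mg; exact: continuous_measurable_fun.
have mdens : measurable_fun `]0, t[ (density P A c g).
  rewrite /density; apply: measurable_funB; [apply: measurable_funD|];
    apply: measurable_funM => //; try exact: measurable_indic.
  - exact: (mL true).
  - exact: (mL false).
pose k := RR P + RL P.
pose k0 := lagrangian (HR P) (RR P) 0 + lagrangian (HL P) (RL P) 0 + `|A0 P|.
have ib : mu.-integrable `]0, t[ (EFin \o (fun s => k * `|g s| + k0)).
  have i1 : mu.-integrable `]0, t[ (EFin \o (fun s => k * `|g s|)).
    rewrite (_ : _ \o _ = (fun s => k%:E * `|(EFin \o g) s|)%E).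
      by apply: integrableZl => //; exact: integrable_abse.
    by apply/funext => s /=; rewrite EFinM.
  rewrite (_ : _ \o _ = ((EFin \o (fun s => k * `|g s|)%R) \+ (EFin \o cst k0))%E)//.
  by apply: integrableD => //; exact: integrable_oo_cst.
apply: le_integrable ib => //; first exact/measurable_EFinP.
move=> s; rewrite /= in_itv/= => /andP[s0 st]; rewrite lee_fin.
have [h1 h2] := control_bounds s0 (lt_le_trans st tT).
have RR0 := RR_gt0 hP; have RL0 := RL_gt0 hP.
have lR0 := lagrangian_ge0 hR; have lL0 := lagrangian_ge0 hL.
have := lagrangian_lipschitz hR (g s) 0; have := lagrangian_lipschitz hL (g s) 0.
rewrite !subr0 !ler_norml => /andP[_ h3] /andP[_ h4].
have h5 := lR0 (g s); have h6 := lL0 (g s); have h7 := lR0 0; have h8 := lL0 0.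
rewrite /= in h3 h4 h5 h6 h7 h8.
have g0 := normr_ge0 (g s).
have h9 : 0 <= RR P * `|g s| by rewrite mulr_ge0// ltW.
have h10 : 0 <= RL P * `|g s| by rewrite mulr_ge0// ltW.
have -> : `|k * `|g s| + k0| = k * `|g s| + k0.
  by rewrite ger0_norm// /k /k0 mulrDl; have := normr_ge0 (A0 P); lra.
have hA0 : - A0 P <= `|A0 P| by rewrite ler_normr lexx orbT.
rewrite density_bool /k /k0 /LR /LL mulrDl.
have [e|e|e] := ltgtP (c s) 0; rewrite !(mulr0, mulr1, add0r, addr0, subr0).
- by apply/andP; split; lra.
- by apply/andP; split; lra.
- by apply/andP; split; lra.
Unshelve. all: by end_near. Qed.

Lemma density_side s r : strict_side s (c r) ->
  density P A c g r = lagrangian (sideH P s) (sideR P s) (g r).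
Proof.
rewrite /strict_side density_bool; case: s => cr; rewrite cr.
  by rewrite (gt_eqF cr) ltNge (ltW cr)/= mulr1 !mulr0 addr0 subr0.
by rewrite (lt_eqF cr) ltNge (ltW cr)/= mulr1 !mulr0 add0r subr0.
Qed.

Lemma density_zero r : c r = 0 -> density P A c g r = - A r.
Proof. by move=> cr; rewrite density_bool cr ltxx eqxx !mulr0 mulr1 !add0r. Qed.

Lemma density_integrable_oo a b : 0 <= a -> b <= t ->
  mu.-integrable `]a, b[ (EFin \o density P A c g).
Proof. exact: integrable_ooS density_integrable. Qed.

(** Jensen's inequality in dual form: with p the maximising slope for the total displacement, the
    running cost is at least p g - H p, whose integral is the kernel. *)
Lemma moving_cost_ge s a b : 0 <= a -> a <= b -> b <= t ->
  (forall r, a < r < b -> strict_side s (c r)) ->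
  KS s (c b - c a) (b - a) <= \int[mu]_(r in `]a, b[) density P A c g r.
Proof.
move=> a0 ab bt hs; have [cc gi gE] := hc.
have [p [rp p0 <-]] := kern_max (side_ham hP s) (c b - c a) (b - a).
have giab : mu.-integrable `]a, b[ (EFin \o g) by exact: integrable_ooS gi _ _.
have gip : mu.-integrable `]a, b[ (EFin \o (fun r => p * g r)).
  rewrite (_ : _ \o _ = (fun r => p%:E * (EFin \o g) r)%E); last exact/funext.
  exact: integrableZl.
have -> : (c b - c a) * p - (b - a) * sideH P s p =
    \int[mu]_(r in `]a, b[) (p * g r - cst (sideH P s p) r).
  rewrite RintegralB//; last exact: integrable_oo_cst.
  by rewrite RintegralZl// gE// Rintegral_oo_cst//; ring.
apply: le_Rintegral => //.
- rewrite (_ : _ \o _ = (EFin \o (fun r => p * g r)%R) \- (EFin \o cst (sideH P s p)))%E//.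
  by apply: integrableB => //; exact: integrable_oo_cst.
- exact: density_integrable_oo.
move=> r /=; rewrite in_itv/= => rab; rewrite (density_side (hs _ rab)).
by rewrite mulrC; exact: lagrangian_ge (side_ham hP s) _ _ _ _.
Qed.

Lemma affine_cost s a b al : 0 <= a -> a <= b -> b <= t ->
  (forall r, a < r < b -> strict_side s (c r)) ->
  {ae mu, forall r, r \in `]a, b[ -> g r = al} ->
  \int[mu]_(r in `]a, b[) density P A c g r = KS s (al * (b - a)) (b - a).
Proof.
move=> a0 ab bt hs gal.
transitivity (\int[mu]_(r in `]a, b[) cst (lagrangian (sideH P s) (sideR P s) al) r).
  apply: ae_eq_Rintegral; apply: ae_sub gal => r gr rab.
  by rewrite (@density_side s) ?gr//; apply: hs; move: rab; rewrite /= in_itv.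
rewrite Rintegral_oo_cst//.
move: ab; rewrite le_eqVlt => /predU1P[->|ab].
  by rewrite subrr !mulr0 (kern0 (side_ham hP s))// mul0r.
by rewrite (kern_lagrangian (side_ham hP s)) ?subr_gt0// mulfK ?gt_eqF ?subr_gt0// mulrC.
Qed.

Lemma resting_cost a b : 0 <= a -> a <= b -> b <= t ->
  (forall r, a < r < b -> c r = 0) ->
  \int[mu]_(r in `]a, b[) density P A c g r = wait A b - wait A a.
Proof.
move=> a0 ab bt hs; rewrite waitB ?(le_trans bt)//.
by apply: eq_Rintegral => r /set_mem/=; rewrite in_itv/= => /hs/density_zero.
Qed.

Lemma primitive_opp : primitive_of t (fun s => - c s) (fun s => - g s).
Proof.
have [cc gi gE] := hc; split.
- by move=> x; apply: cvgN; exact: cc.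
- by rewrite (_ : _ \o _ = \- (EFin \o g))%E//; exact: integrableN.
move=> a b a0 ab bt; under eq_Rintegral do rewrite -mulN1r.
rewrite RintegralZl// ?gE//; first by ring.
exact: integrable_ooS gi _ _.
Qed.

(* The slopes p minimising the Hamiltonians give an affine minorant of the
   running cost whose linear part integrates to zero over each excursion. *)
Lemma excursion_cost_ge a b : 0 <= a -> a <= b -> b <= t -> c a = 0 -> c b = 0 ->
  wait A b - wait A a <= \int[mu]_(r in `]a, b[) density P A c g r.
Proof.
move=> a0 ab bt ca cb; have [cc gi gE] := hc.
have giab : mu.-integrable `]a, b[ (EFin \o g) by exact: integrable_ooS gi _ _.
have [p [rp p0 _ pE]] := ham_min (side_ham hP true).
have [q [rq q0 _ qE]] := ham_min (side_ham hP false).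
have eR := excursion_integral hc a0 ab bt ca cb.
have eL := @excursion_integral _ t a b _ _ primitive_opp a0 ab bt.
rewrite ca cb oppr0 in eL; have {}eL := eL erefl erefl.
have mgt : measurable [set r | 0 < c r].
  by apply: open_measurable; exact: open_comp (fun x _ => cc x) (@open_gt R 0).
have mlt : measurable [set r | 0 < - c r].
  rewrite (_ : [set r | _] = [set r | c r < 0]).
    by apply: open_measurable; exact: open_comp (fun x _ => cc x) (@open_lt R 0).
  by apply/seteqP; split => r /=; rewrite oppr_gt0.
have mgab : measurable_fun `]a, b[ g by apply/measurable_EFinP; case/integrableP : giab.
have iS (S : set R) : measurable S ->
    mu.-integrable `]a, b[ (EFin \o (fun r => g r * \1_S r)).
  move=> mS; apply: le_integrable giab => //.
    by apply/measurable_EFinP; apply: measurable_funM => //; exact: measurable_indic.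
  move=> r _; rewrite /= lee_fin normrM indicE.
  by case: (_ \in _); rewrite ?normr1 ?normr0 ?mulr1 ?mulr0.
have iN (S : set R) : measurable S ->
    mu.-integrable `]a, b[ (EFin \o (fun r => - g r * \1_S r)).
  move=> mS; rewrite (_ : _ \o _ = \- (EFin \o (fun r => g r * \1_S r)%R))%E.
    by apply: integrableN; exact: iS.
  by apply/funext => r /=; rewrite mulNr.
have iZ k f : mu.-integrable `]a, b[ (EFin \o f) ->
    mu.-integrable `]a, b[ (EFin \o (fun r => k * f r)).
  move=> fi; rewrite (_ : _ \o _ = (fun r => k%:E * (EFin \o f) r)%E); last exact/funext.
  exact: integrableZl.
have iA : mu.-integrable `]a, b[ (EFin \o (fun s => - A s)).
  by apply: controlN_integrable => //; exact: le_trans tT.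
pose f1 r := p * (g r * \1_[set r | 0 < c r] r).
pose f2 r := - q * (- g r * \1_[set r | 0 < - c r] r).
have i1 : mu.-integrable `]a, b[ (EFin \o f1) by exact: iZ (iS _ mgt).
have i2 : mu.-integrable `]a, b[ (EFin \o f2) by exact: iZ (iN _ mlt).
have i12 : mu.-integrable `]a, b[ (EFin \o (fun r => f1 r + f2 r)).
  by rewrite (_ : _ \o _ = (EFin \o f1) \+ (EFin \o f2))%E//; exact: integrableD.
have -> : wait A b - wait A a = \int[mu]_(r in `]a, b[) (f1 r + f2 r + - A r).
  rewrite (RintegralD _ i12 iA)// (RintegralD _ i1 i2)// -waitB ?(le_trans bt)//.
  rewrite /f1 /f2 !RintegralZl ?eR ?eL ?mulr0 ?add0r//; [exact: iN|exact: iS].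
apply: le_Rintegral => //.
- by rewrite (_ : _ \o _ = (EFin \o (fun r => f1 r + f2 r)%R) \+ (EFin \o (fun r => - A r)%R))%E//; exact: integrableD.
- exact: density_integrable_oo.
move=> r /=; rewrite in_itv/= => /andP[ar rb].
have [Ar _] := control_bounds (le_lt_trans a0 ar) (lt_le_trans rb (le_trans bt tT)).
have hR := A0_ge P true; have hL := A0_ge P false.
rewrite /kern_lip opprK -pE -qE in hR hL.
rewrite /f1 /f2 (@indic_bool _ _ [set r | 0 < c r] _ (0 < c r))// (@indic_bool _ _ [set r | 0 < - c r] _ (c r < 0))//; last first.
  by rewrite /= oppr_gt0.
have [e|e|e] := ltgtP (c r) 0; rewrite !(mulr0, mulr1, add0r, addr0).
- rewrite (@density_side false)//.
  by have := lagrangian_ge (side_ham hP false) (g r) rq q0; rewrite /= in hL *; lra.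
- rewrite (@density_side true)//.
  by have := lagrangian_ge (side_ham hP true) (g r) rp p0; rewrite /= in hR *; lra.
- by rewrite density_zero.
Qed.

Lemma constant_side a b : (forall r, a < r < b -> c r != 0) ->
  exists s, forall r, a < r < b -> strict_side s (c r).
Proof.
have [cc _ _] := hc; move=> c0.
have [[r0 r0ab]|nr] := pselect (exists r, a < r < b); last first.
  by exists true => r rab; exfalso; apply: nr; exists r.
have key x y : a < x < b -> a < y < b -> 0 < c x -> 0 < c y.
  move=> xab yab cx; rewrite ltNge; apply/negP => cy.
  have [xy|/ltW yx] := leP x y.
    have [|z] := @IVT _ c x y 0 xy (continuous_subspaceT cc).
      by rewrite ge_min le_max cy (ltW cx) !orbT.
    rewrite in_itv/= => /andP[xz zy] cz; have := c0 z; rewrite cz eqxx.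
    have -> : a < z < b by lra.
    by move=> /(_ isT).
  have [|z] := @IVT _ c y x 0 yx (continuous_subspaceT cc).
    by rewrite ge_min le_max cy (ltW cx) !orbT.
  rewrite in_itv/= => /andP[xz zy] cz; have := c0 z; rewrite cz eqxx.
  have -> : a < z < b by lra.
  by move=> /(_ isT).
have [cr|cr] := ltP 0 (c r0).
  by exists true => r rab; exact: key r0ab rab cr.
exists false => r rab; rewrite /strict_side lt_neqAle c0//= leNgt.
by apply/negP => /(key _ _ rab r0ab); rewrite ltNge cr.
Qed.

Lemma junction_cost_ge t1 t2 : 0 <= t1 -> t1 <= t2 -> t2 < t ->
  c t1 = 0 -> c t2 = 0 -> c t != 0 ->
  (forall r, 0 < r < t1 -> c r != 0) -> (forall r, t2 < r < t -> c r != 0) ->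
  arrival P t1 - wait A t1 + wait A t2 + KS (0 < c t) (c t) (t - t2) <=
  \int[mu]_(r in `]0, t[) density P A c g r + u0 P (c 0).
Proof.
move=> t10 t12 t2t c1 c2 ct n1 n2.
have [cc gi gE] := hc.
rewrite (@Rintegral_split _ _ 0 t t1); last 2 first.
- exact: density_integrable.
- by rewrite t10 (le_trans t12 (ltW t2t)).
rewrite (@Rintegral_split _ _ t1 t t2); last 2 first.
- exact: density_integrable_oo.
- by rewrite t12 ltW.
have m := excursion_cost_ge t10 t12 (ltW t2t) c1 c2.
have [s1 hs1] := constant_side n1; have [s2 hs2] := constant_side n2.
have b1 := moving_cost_ge (lexx 0) t10 (le_trans t12 (ltW t2t)) hs1.
have b2 := moving_cost_ge (le_trans t10 t12) (ltW t2t) (lexx t) hs2.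
have s2E : s2 = (0 < c t).
  apply: side_unique; rewrite /strict_side.
  pose r := (t2 + t) / 2.
  have rt : t2 < r < t by rewrite /r; lra.
  have := hs2 _ rt; rewrite /strict_side.
  case: s2 {hs2 b2} => cr; apply: contrapT => /negP; rewrite -leNgt => cle.
    have [|z] := @IVT _ c r t 0 (ltW (andP rt).2) (continuous_subspaceT cc).
      by rewrite ge_min le_max cle (ltW cr) !orbT.
    rewrite in_itv/= => /andP[rz zt] cz.
    have [zt'|zt'] := eqVneq z t; first by move: ct; rewrite -zt' cz eqxx.
    have := n2 z; rewrite cz eqxx; have -> : t2 < z < t.
      by rewrite (lt_le_trans (andP rt).1 rz) lt_neqAle zt'.
    by move=> /(_ isT).
  have [|z] := @IVT _ c r t 0 (ltW (andP rt).2) (continuous_subspaceT cc).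
    by rewrite ge_min le_max cle (ltW cr) ?orbT.
  rewrite in_itv/= => /andP[rz zt] cz.
  have [zt'|zt'] := eqVneq z t; first by move: ct; rewrite -zt' cz eqxx.
  have := n2 z; rewrite cz eqxx; have -> : t2 < z < t.
    by rewrite (lt_le_trans (andP rt).1 rz) lt_neqAle zt'.
  by move=> /(_ isT).
rewrite s2E c2 subr0 in b2; rewrite c1 sub0r subr0 in b1.
suff : arrival P t1 <= u0 P (c 0) + KS s1 (- c 0) t1 by lra.
(* If t1 = 0 the first interval is empty and [s1] is arbitrary. Otherwise c 0 belongs to the closed
   half-line [s1] as a limit from the right, and may be the origin itself. *)
move: t10; rewrite le_eqVlt => /predU1P[t10|t10].
  rewrite -t10 arrival0// in c1 *; rewrite c1 oppr0 lerDl.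
  exact: kern_ge0 (side_ham hP _) _ _.
apply: arrival_le => //; first exact: ltW.
have : closed (@halfline R s1) by rewrite /halfline; case: (s1); [exact: closed_ge|exact: closed_le].
have cl : c r @[r --> 0^'+] --> c 0 by apply: cvg_at_right_filter; exact: cc.
move=> hcl; apply: (@closed_cvg _ _ _ (at_right_proper_filter (0 : R)) c _ hcl _ _ cl).
near=> r; have := hs1 r; rewrite /strict_side /halfline/=.
have -> : 0 < r < t1.
  by apply/andP; split; near: r; [exact: nbhs_right_gt|exact: nbhs_right_lt].
by case: (s1) => /(_ isT) /ltW.
Unshelve. all: by end_near. Qed.

Lemma direct_cost_ge : (forall r, 0 <= r <= t -> c r != 0) ->
  strict_side (0 < c t) (c 0) /\
  u0 P (c 0) + KS (0 < c t) (c t - c 0) t <=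
  \int[mu]_(r in `]0, t[) density P A c g r + u0 P (c 0).
Proof.
move=> n0; have [cc gi gE] := hc.
have [s hs] : exists s, forall r, -1 < r < t + 1 -> 0 <= r <= t -> strict_side s (c r).
  have key x y : 0 <= x <= t -> 0 <= y <= t -> 0 < c x -> 0 < c y.
    move=> xab yab cx; rewrite ltNge; apply/negP => cy.
    have [xy|/ltW yx] := leP x y.
      have [|z] := @IVT _ c x y 0 xy (continuous_subspaceT cc).
        by rewrite ge_min le_max cy (ltW cx) !orbT.
      rewrite in_itv/= => /andP[xz zy] cz; have := n0 z; rewrite cz eqxx.
      have -> : 0 <= z <= t by lra.
      by move=> /(_ isT).
    have [|z] := @IVT _ c y x 0 yx (continuous_subspaceT cc).
      by rewrite ge_min le_max cy (ltW cx) !orbT.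
    rewrite in_itv/= => /andP[xz zy] cz; have := n0 z; rewrite cz eqxx.
    have -> : 0 <= z <= t by lra.
    by move=> /(_ isT).
  have t00 : (0 : R) <= 0 <= t by rewrite lexx ltW.
  have [cr|cr] := ltP 0 (c 0).
    by exists true => r _ rab; exact: key t00 rab cr.
  exists false => r _ rab; rewrite /strict_side lt_neqAle n0//= leNgt.
  by apply/negP => /(key _ _ rab t00); rewrite ltNge cr.
have hs' r : 0 <= r <= t -> strict_side s (c r) by move=> rt; apply: hs => //; lra.
have <- : s = (0 < c t) by apply: side_unique; apply: hs'; rewrite lexx ltW.
split; first by apply: hs'; rewrite lexx ltW.
rewrite addrC lerD2r.
have := @moving_cost_ge s 0 t (lexx 0) (ltW t0) (lexx t).
rewrite subr0; apply => r /andP[r0 rt]; apply: hs'; by rewrite !ltW.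
Qed.

End primitive.

Lemma path_cost_density t gamma : 0 < t -> t <= T -> H1 t gamma ->
  exists c g, [/\ primitive_of t c g, forall s, 0 <= s <= t -> c s = gamma s,
    {ae mu, forall s, s \in `]0, t[ -> derive1 gamma s = g s} &
    path_cost P A t gamma =
      \int[mu]_(s in `]0, t[) density P A c g s + u0 P (c 0)].
Proof.
move=> t0 tT /(H1_primitive t0)[c [g [hc cE gE]]].
exists c, g; split => //; rewrite /path_cost cE ?lexx ?ltW//; congr +%R.
apply: ae_eq_Rintegral; apply: ae_sub gE => s gE st.
rewrite gE//; move: st; rewrite /= in_itv/= => /andP[s0 st].
rewrite density_bool cE ?ltW//.
rewrite (@indic_bool _ _ [set r | 0 < gamma r] _ (0 < gamma s)) ?(@indic_bool _ _ [set r | gamma r < 0] _ (gamma s < 0))//.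
by rewrite (@indic_bool _ _ [set r | gamma r = 0] _ (gamma s == 0))//=; split => /eqP.
Qed.

End fixed_control.

End path_cost_bounds.

(** * Explicit paths and the value formula *)

Section polylines.
Context (R : realType).
Local Notation mu := (@lebesgue_measure R).

(** Speed al until t1, then rest, then speed be from t2 to t. Clamping the time exhibits it as the
    primitive of a combination of two indicators. *)
Definition polyline (y al t1 be t2 t s : R) : R :=
  y + al * Num.max 0 (Num.min s t1) + be * Num.max 0 (Num.min s t - t2).

Lemma Rintegral_oo_indic (s a b : R) : 0 <= a ->
  \int[mu]_(r in `]0, s[) (\1_(`]a, b[%classic) r : R) = Num.max 0 (Num.min s b - a).
Proof.
move=> a0; rewrite /Rintegral integral_indic//.
rewrite (_ : _ `&` _ = `]a, Num.min s b[%classic); last first.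
  apply/seteqP; split => z /=; rewrite !in_itv/= lt_min.
    by move=> [/andP[-> ->] /andP[_ ->]].
  by move=> /andP[az /andP[zs zb]]; rewrite az zb zs (le_lt_trans a0 az).
have -> : fine (mu `]a, Num.min s b[) = fine (lebesgue_measure (`]a, Num.min s b[%classic : set R)) by [].
rewrite lebesgue_measure_itv/= lte_fin; case: ifP => h.
  by rewrite -EFinB/= max_r// subr_ge0 ltW.
by rewrite max_l// subr_le0 leNgt h.
Qed.

Lemma polyline_H1 y al t1 be t2 t : 0 <= t1 -> 0 <= t2 ->
  H1 t (polyline y al t1 be t2 t).
Proof.
move=> t10 t20.
pose g s := al * \1_(`]0, t1[%classic) s + be * \1_(`]t2, t[%classic) s.
have mg : measurable_fun `]0, t[ g.
  by apply: measurable_funD; apply: measurable_funM => //; exact: measurable_indic.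
have gb s : `|g s| <= `|al| + `|be|.
  rewrite /g (le_trans (ler_normD _ _))// !normrM !indicE.
  by case: (_ \in _); case: (_ \in _); rewrite ?normr1 ?normr0 ?mulr1 ?mulr0 ?addr0 ?add0r ?lerDl ?lerDr.
exists g; split => //.
  apply: le_integrable (integrable_oo_cst 0 t ((`|al| + `|be|) ^+ 2)) => //.
    by apply/measurable_EFinP; apply: measurable_funX.
  move=> s _; rewrite /= lee_fin (ger0_norm (sqr_ge0 (g s))) (ger0_norm (sqr_ge0 _)).
  by rewrite -real_normK ?num_real// ler_sqr ?nnegrE ?addr_ge0.
have i1 s (a b k : R) : mu.-integrable `]0, s[ (EFin \o (fun r => k * \1_(`]a, b[%classic) r)).
  apply: le_integrable (integrable_oo_cst 0 s `|k|) => //.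
    apply/measurable_EFinP; apply: measurable_funM => //; exact: measurable_indic.
  move=> r _; rewrite /= lee_fin normrM normr_id indicE.
  by case: (_ \in _); rewrite ?normr1 ?normr0 ?mulr1 ?mulr0.
have i0 s (a b : R) : mu.-integrable `]0, s[ (EFin \o (\1_(`]a, b[%classic) : R -> R)).
  have := i1 s a b 1; congr (integrable _ _ _).
  by apply/funext => r /=; rewrite mul1r.
move=> s; rewrite in_itv/= => /andP[s0 st].
rewrite /g RintegralD// !RintegralZl// !Rintegral_oo_indic// subr0.
rewrite /polyline (min_l t10) (min_l (le_trans s0 st)) maxxx.
have -> : Num.max 0 (0 - t2) = 0 by rewrite max_l// sub0r oppr_le0.
by ring.
Qed.

End polylines.

Section explicit_paths.
Context (R : realType) (P : junction R) (hP : standing_assumptions P).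
Local Notation mu := (@lebesgue_measure R).
Local Notation T := (horizon P).
Local Notation KS s := (kern (sideH P s) (sideR P s)).
Context (A : R -> R) (hA : control P A).

Lemma affine_derive1 (f : R -> R) (a b al be : R) :
  (forall r, a < r < b -> f r = al * r + be) ->
  forall r, a < r < b -> derive1 f r = al.
Proof.
move=> fE r /andP[ar rb].
have near_r : \forall x \near r, f x = al * x + be.
  near=> x; apply: fE; apply/andP; split; near: x.
    exact: lt_nbhsr.
  exact: lt_nbhsl.
rewrite derive1E (near_eq_derive (1 : R) near_r).
have : is_derive r (1 : R) (fun x => al * x + be) al.
  by apply: is_derive_eq; rewrite /GRing.scale/=; ring.
by move=> [].
Unshelve. all: by end_near. Qed.

Lemma strict_sideW s (y : R) : strict_side s y -> halfline s y.
Proof. by rewrite /strict_side /halfline/=; case: s => /ltW. Qed.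

Lemma strict_side0 (x : R) : x != 0 -> strict_side (0 < x) x.
Proof. by rewrite /strict_side => x0; case: ltgtP x0 => //; rewrite eqxx. Qed.

Lemma strict_side_scale s (y l : R) : 0 < l -> strict_side s y -> strict_side s (l * y).
Proof.
by move=> l0; rewrite /strict_side; case: s => y0; [rewrite mulr_gt0|rewrite pmulr_rlt0].
Qed.

(** The start y = 0 with t1 > 0 is excluded because the path would vanish on (0, t1), against
    [junction_path_start]. *)
Lemma junction_polyline x t t1 t2 s y : x != 0 -> t <= T -> 0 <= t1 -> t1 <= t2 ->
  t2 < t -> (t1 = 0 /\ y = 0) \/ (0 < t1 /\ strict_side s y) ->
  exists gamma, [/\ H1 t gamma, gamma t = x, junction_path t t1 t2 gamma &
    path_cost P A t gamma = u0 P y + KS s (- y) t1 + (wait A t2 - wait A t1)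
      + KS (0 < x) x (t - t2)].
Proof.
move=> x0 tT t10 t12 t2t hy.
have t20 := le_trans t10 t12; have t0 := le_lt_trans t20 t2t.
have tt2 : 0 < t - t2 by rewrite subr_gt0.
(* If t1 = 0 then y = 0, and the first speed is the conventional 0 / 0 = 0. *)
pose gamma := polyline y (- y / t1) t1 (x / (t - t2)) t2 t.
have gH : H1 t gamma by exact: polyline_H1.
have yt : y + - y / t1 * t1 = 0.
  case: hy => [[-> ->]|[h _]]; first by rewrite oppr0 !mul0r addr0.
  by rewrite divfK ?gt_eqF// subrr.
have E1 r : 0 <= r <= t1 -> gamma r = - y / t1 * r + y.
  move=> /andP[r0 rt]; rewrite /gamma /polyline (min_l rt) (max_r r0).
  rewrite (min_l (le_trans rt (le_trans t12 (ltW t2t)))) max_l; last by lra.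
  by ring.
have E2 r : t1 <= r <= t2 -> gamma r = 0.
  move=> /andP[t1r rt2]; rewrite /gamma /polyline (min_r t1r) (max_r t10).
  rewrite (min_l (le_trans rt2 (ltW t2t))) max_l; last by lra.
  by rewrite mulr0 addr0.
have E3 r : t2 <= r <= t -> gamma r = x / (t - t2) * r + - (x / (t - t2) * t2).
  move=> /andP[t2r rt]; rewrite /gamma /polyline (min_r (le_trans t12 t2r)) (max_r t10).
  rewrite (min_l rt) max_r; last by lra.
  by rewrite yt; ring.
have gt : gamma t = x.
  by rewrite E3 ?(ltW t2t) ?lexx// -mulrN -mulrDr divfK// gt_eqF.
have ne1 r : 0 < r < t1 -> strict_side s (gamma r).
  move=> /andP[r0 rt]; rewrite E1 ?(ltW r0) ?(ltW rt)//.
  case: hy => [[t1E _]|[t1p hy]]; first by move: (lt_trans r0 rt); rewrite t1E ltxx.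
  have -> : - y / t1 * r + y = (1 - r / t1) * y by field; rewrite gt_eqF.
  by apply: strict_side_scale => //; rewrite subr_gt0 ltr_pdivrMr// mul1r.
have ne3 r : t2 < r < t -> strict_side (0 < x) (gamma r).
  move=> /andP[r0 rt]; rewrite E3 ?(ltW r0) ?(ltW rt)//.
  have -> : x / (t - t2) * r + - (x / (t - t2) * t2) = (r - t2) / (t - t2) * x.
    by field; rewrite gt_eqF.
  by apply: strict_side_scale (strict_side0 x0); rewrite divr_gt0// subr_gt0.
have [c [g [hc cE gE E0]]] := path_cost_density A t0 tT gH.
exists gamma; split => //.
  split => //.
  - split; first by rewrite E2// t12 lexx.
    exists (x / (t - t2)), (- (x / (t - t2) * t2)) => r /=; rewrite in_itv/=.
    exact: E3.
  - by move=> r; rewrite in_itv/= => /andP[h1 h2]; apply: E2; rewrite !ltW.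
  - split.
      exists (- y / t1), y => r /=; rewrite in_itv/= => /andP[h1 h2].
      by apply: E1; rewrite !ltW.
    move=> r; rewrite in_itv/= => /ne1; rewrite /strict_side.
    by case: (s) => h; rewrite ?(gt_eqF h) ?(lt_eqF h).
have cne1 r : 0 < r < t1 -> strict_side s (c r).
  by move=> /[dup] /ne1 + /andP[h1 h2]; rewrite cE// !ltW//= (lt_trans h2)// (le_lt_trans t12).
have cne3 r : t2 < r < t -> strict_side (0 < x) (c r).
  by move=> /[dup] /ne3 + /andP[h1 h2]; rewrite cE// !ltW//= (le_lt_trans t20).
have cz r : t1 < r < t2 -> c r = 0.
  by move=> /andP[h1 h2]; rewrite cE ?E2 ?(ltW h1) ?(ltW h2)// !ltW//= ?(lt_trans h2)// (le_lt_trans t10).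
have di := density_integrable hP hA tT hc.
rewrite E0 (@Rintegral_split _ _ 0 t t1)//; last by rewrite t10 (le_trans t12)// ltW.
rewrite (@Rintegral_split _ _ t1 t t2); last 2 first.
- exact: integrable_ooS di _ _.
- by rewrite t12 ltW.
have g1 : {ae mu, forall r, r \in `]0, t1[ -> g r = - y / t1}.
  apply: ae_sub gE => r gE; rewrite in_itv/= => /andP[r0 r1].
  rewrite -gE; last by rewrite in_itv/= r0 (lt_trans r1)// (le_lt_trans t12).
  apply: (@affine_derive1 gamma 0 t1 (- y / t1) y); last by rewrite r0.
  by move=> z /andP[z0 z1]; apply: E1; rewrite !ltW.
have g3 : {ae mu, forall r, r \in `]t2, t[ -> g r = x / (t - t2)}.
  apply: ae_sub gE => r gE; rewrite in_itv/= => /andP[r0 r1].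
  rewrite -gE; last by rewrite in_itv/= r1 (le_lt_trans t20).
  apply: (@affine_derive1 gamma t2 t (x / (t - t2)) (- (x / (t - t2) * t2))); last by rewrite r0.
  by move=> z /andP[z0 z1]; apply: E3; rewrite !ltW.
rewrite (affine_cost hP A (lexx 0) t10 (le_trans t12 (ltW t2t)) cne1 g1).
rewrite (affine_cost hP A t20 (ltW t2t) (lexx t) cne3 g3).
rewrite (resting_cost hA tT g t10 t12 (ltW t2t) cz).
have c0 : c 0 = y by rewrite cE ?lexx ?(ltW t0)// E1 ?lexx// mulr0 add0r.
have tE : x / (t - t2) * (t - t2) = x by rewrite divfK// gt_eqF.
have yE : - y / t1 * t1 = - y by move: yt; lra.
by rewrite subr0 yE tE c0; ring.
Qed.

Lemma direct_polyline x t y : x != 0 -> 0 < t -> t <= T -> halfline (0 < x) y ->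
  exists gamma, [/\ H1 t gamma, gamma t = x &
    path_cost P A t gamma = u0 P y + KS (0 < x) (x - y) t].
Proof.
move=> x0 t0 tT Dy.
pose gamma := polyline y ((x - y) / t) t 0 t t.
have gH : H1 t gamma by apply: polyline_H1; exact: ltW.
have E r : 0 <= r <= t -> gamma r = (x - y) / t * r + y.
  by move=> /andP[r0 rt]; rewrite /gamma /polyline mul0r addr0 (min_l rt) (max_r r0) addrC.
have ne r : 0 < r < t -> strict_side (0 < x) (gamma r).
  move=> /andP[r0 rt]; rewrite E ?(ltW r0) ?(ltW rt)//.
  have -> : (x - y) / t * r + y = r / t * x + (1 - r / t) * y by field; rewrite gt_eqF.
  have h1 : 0 < r / t by rewrite divr_gt0.
  have h2 : 0 < 1 - r / t by rewrite subr_gt0 ltr_pdivrMr// mul1r.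
  move: (strict_side0 x0) Dy; rewrite /strict_side /halfline/=; case: (boolP (0 < x)) => [hx _ hy|_ hx hy].
    have m1 : 0 < r / t * x by rewrite mulr_gt0.
    have m2 : 0 <= (1 - r / t) * y by rewrite mulr_ge0// ltW.
    lra.
  have m1 : r / t * x < 0 by rewrite pmulr_rlt0.
  have m2 : (1 - r / t) * y <= 0 by rewrite mulr_ge0_le0// ltW.
  lra.
have [c [g [hc cE gE E0]]] := path_cost_density A t0 tT gH.
exists gamma; split => //.
  by rewrite E ?(ltW t0) ?lexx// divfK ?gt_eqF// subrK.
have g1 : {ae mu, forall r, r \in `]0, t[ -> g r = (x - y) / t}.
  apply: ae_sub gE => r gE; rewrite in_itv/= => /andP[r0 r1].
  rewrite -gE; last by rewrite in_itv/= r0.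
  apply: (@affine_derive1 gamma 0 t _ y); last by rewrite r0.
  by move=> z /andP[z0 z1]; apply: E; rewrite !ltW.
have cne r : 0 < r < t -> strict_side (0 < x) (c r).
  by move=> /[dup] /ne + /andP[h1 h2]; rewrite cE// !ltW.
rewrite E0 (affine_cost hP A (lexx 0) (ltW t0) (lexx t) cne g1).
rewrite subr0 divfK ?gt_eqF// cE ?lexx ?(ltW t0)// E ?lexx ?(ltW t0)// mulr0 add0r.
by rewrite addrC.
Qed.

End explicit_paths.

Section value_formula.
Context (R : realType) (P : junction R) (hP : standing_assumptions P).
Local Notation mu := (@lebesgue_measure R).
Local Notation T := (horizon P).
Local Notation KS s := (kern (sideH P s) (sideR P s)).

(** The departure time is bounded by the horizon rather than by t, so that one compact set serves
    all (x, t). Departures after t make sense because [kern] accepts negative durations, and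
    [jcost_normalize] removes them. *)
Definition triangle : set (R * R) :=
  [set z | [/\ 0 <= z.1, z.1 <= z.2 & z.2 <= T]].

(* The pair z consists of the entrance time z.1 and of the departure time z.2. *)
Definition jcost (A : R -> R) (x t : R) (z : R * R) : R :=
  arrival P z.1 - wait A z.1 + wait A z.2 + KS (0 < x) x (t - z.2).

Definition ujunction (A : R -> R) (x t : R) : R :=
  inf [set jcost A x t z | z in triangle].

Definition udirect (x t : R) : R :=
  direct (sideH P (0 < x)) (sideR P (0 < x)) (u0 P) (0 < x) x t.

Definition uvalue (A : R -> R) (x t : R) : R :=
  Num.min (udirect x t) (ujunction A x t).

Lemma lipschitz2_continuous (D : set (R * R)) (f : R * R -> R) (L : R) : 0 < L ->
  (forall z w, D z -> D w -> `|f z - f w| <= L * (`|z.1 - w.1| + `|z.2 - w.2|)) ->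
  {within D, continuous f}.
Proof.
move=> L0 Lf; apply/subspace_continuousP => z Dz.
apply/cvgrPdist_le => e e0; rewrite near_withinE.
have e1 : 0 < e / L / 2 by rewrite !divr_gt0.
have near1 : \forall w \near z, `|z.1 - w.1| <= e / L / 2.
  apply: (@cvgr_dist_le _ _ _ (nbhs z) _ (fun w => w.1) z.1) => //; exact: cvg_fst.
have near2 : \forall w \near z, `|z.2 - w.2| <= e / L / 2.
  apply: (@cvgr_dist_le _ _ _ (nbhs z) _ (fun w => w.2) z.2) => //; exact: cvg_snd.
near=> w; move=> Dw; apply: le_trans (Lf z w Dz Dw) _.
rewrite mulrC -ler_pdivlMr//.
have : `|z.1 - w.1| <= e / L / 2 by near: w.
have : `|z.2 - w.2| <= e / L / 2 by near: w.
lra.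
Unshelve. all: by end_near. Qed.

Lemma compact_triangle : compact triangle.
Proof.
rewrite (_ : triangle = (`[0, T]%classic `*` `[0, T]%classic) `&`
    [set z : R * R | 0 <= z.2 - z.1]).
  apply: compact_closedI; first by apply: compact_setX; exact: segment_compact.
  apply: (@closed_comp _ _ (fun z : R * R => z.2 - z.1) [set r | 0 <= r]).
    by move=> z _; apply: cvgB; [exact: cvg_snd|exact: cvg_fst].
  exact: closed_ge.
apply/seteqP; split => -[a b] /=.
  by move=> [a0 ab bT]; rewrite !in_itv/= a0 bT subr_ge0 ab (le_trans ab)// (le_trans a0).
by rewrite !in_itv/= subr_ge0 => -[[/andP[? _] /andP[_ ?]] ?].
Qed.

Lemma triangle_neq0 : triangle !=set0.
Proof. by exists (0, 0); split => //=; exact: ltW (horizon_gt0 hP). Qed.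

Context (A : R -> R) (hA : control P A).

Lemma wait_lipschitz a b : 0 <= a <= T -> 0 <= b <= T ->
  `|wait A a - wait A b| <= - A0 P * `|a - b|.
Proof.
suff main c d : 0 <= c -> c <= d -> d <= T ->
    `|wait A c - wait A d| <= - A0 P * `|c - d|.
  move=> /andP[a0 aT] /andP[b0 bT]; have [ab|/ltW ba] := leP a b; first exact: main.
  by rewrite distrC (distrC a); exact: main.
move=> c0 cd dT; have /andP[h1 h2] := wait_bounds hA c0 cd dT.
by rewrite distrC (distrC c) !ger0_norm// subr_ge0.
Qed.

Lemma wait_le a b : 0 <= a -> a <= b -> b <= T -> wait A a <= wait A b.
Proof. by move=> a0 ab bT; have /andP[] := wait_bounds hA a0 ab bT; rewrite subr_ge0. Qed.

Lemma jcost_lipschitz : exists2 L : R, 0 < L & forall x t z w, triangle z -> triangle w ->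
  `|jcost A x t z - jcost A x t w| <= L * (`|z.1 - w.1| + `|z.2 - w.2|).
Proof.
have [L1 L10 La] := arrival_lipschitz hP.
pose k := kern_lip (sideH P true) + kern_lip (sideH P false).
have kR := kern_lip_gt0 (side_ham hP true); have kL := kern_lip_gt0 (side_ham hP false).
have A00 := A0_lt0 hP.
exists (L1 + - A0 P + k); first by rewrite /k; lra.
move=> x t z w [z1 z12 z2] [w1 w12 w2].
have h1 := La z.1 w.1 z1 w1.
have h2 : `|wait A z.1 - wait A w.1| <= - A0 P * `|z.1 - w.1|.
  by apply: wait_lipschitz; rewrite ?z1 ?w1/= ?(le_trans z12) ?(le_trans w12).
have h3 : `|wait A z.2 - wait A w.2| <= - A0 P * `|z.2 - w.2|.
  by apply: wait_lipschitz; rewrite ?z2 ?w2 ?andbT ?(le_trans z1 z12) ?(le_trans w1 w12).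
have h4 := kern_lipschitz (side_ham hP (0 < x)) x (t - z.2) x (t - w.2).
rewrite subrr normr0 mulr0 add0r in h4.
have E : t - z.2 - (t - w.2) = w.2 - z.2 by ring.
rewrite E distrC (distrC w.2) in h4.
have h5 : kern_lip (sideH P (0 < x)) * `|z.2 - w.2| <= k * `|z.2 - w.2|.
  by rewrite ler_wpM2r// /k; case: (0 < x); rewrite ?lerDl ?lerDr ltW.
have n1 := normr_ge0 (z.1 - w.1); have n2 := normr_ge0 (z.2 - w.2).
have m1 : 0 <= L1 * `|z.2 - w.2| by rewrite mulr_ge0// ltW.
have m2 : 0 <= k * `|z.1 - w.1| by rewrite mulr_ge0// /k; lra.
move: h1 h2 h3 h4; rewrite !ler_norml /jcost => /andP[? ?] /andP[? ?] /andP[? ?] /andP[? ?].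
apply/andP; split; lra.
Qed.

Lemma jcost_continuous x t : {within triangle, continuous (jcost A x t)}.
Proof. by have [L L0 HL] := jcost_lipschitz; apply: lipschitz2_continuous L0 _; exact: HL. Qed.

Lemma ujunction_min x t : exists z, [/\ triangle z, ujunction A x t = jcost A x t z &
  forall w, triangle w -> ujunction A x t <= jcost A x t w].
Proof.
have [z /set_mem zT zmin] := compact_EVT_min triangle_neq0 compact_triangle (@jcost_continuous x t).
have E : ujunction A x t = jcost A x t z.
  by apply: inf_image_eq => // w wT; apply: zmin; exact: mem_set.
by exists z; split => // w wT; rewrite E; apply: zmin; exact: mem_set.
Qed.

Lemma ujunction_le x t z : triangle z -> ujunction A x t <= jcost A x t z.
Proof. by have [w [_ _]] := ujunction_min x t; apply. Qed.

(* Leaving the junction later than |x| / speed before time t is not needed,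
   since the kernel no longer depends on the duration. *)
Lemma jcost_normalize x t z : x != 0 -> 0 < t -> t <= T -> triangle z ->
  exists w, [/\ triangle w, w.2 < t, w.2 <= z.2, jcost A x t w <= jcost A x t z &
    jcost A x t z <= jcost A x t w -> w.1 = z.1 /\ wait A w.2 = wait A z.2].
Proof.
move=> x0 t0 tT; case: z => t1 t2 [/= t10 t12 t2T].
have [t2t|tt2] := ltP t2 t; first by exists (t1, t2); split.
pose M := speed (sideH P (0 < x)) (sideR P (0 < x)).
have M0 : 0 < M := speed_gt0 (side_ham hP (0 < x)).
have xM : 0 < `|x| / M by rewrite divr_gt0// normr_gt0.
pose sg := Num.max (t - `|x| / M) 0.
have sg0 : 0 <= sg by rewrite le_max lexx orbT.
have sgt : sg < t by rewrite gt_max t0 andbT; lra.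
have sgT : sg <= T := le_trans (ltW sgt) tT.
have K1 : KS (0 < x) x (t - sg) = KS (0 < x) x (t - t2).
  have x00 := normr_ge0 x.
  rewrite !(kern_far (side_ham hP (0 < x)))//.
    by apply: le_trans x00; rewrite mulr_ge0_le0 ?(ltW M0)// subr_le0.
  rewrite mulrC -ler_pdivlMr//.
  have : t - `|x| / M <= sg by rewrite le_max lexx.
  lra.
have [t1s|st1] := leP t1 sg.
  exists (t1, sg); split; rewrite ?(le_trans (ltW sgt))//= /jcost/= K1.
    by rewrite lerD2r lerD2l wait_le// (le_trans (ltW sgt)).
  rewrite lerD2r lerD2l => h; split => //; apply/eqP; rewrite eq_le h andbT.
  by rewrite wait_le// (le_trans (ltW sgt)).
(* Here the entrance has to be advanced to sg as well. The gain is strict because [arrival]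
   increases strictly, so the equality clause becomes void. *)
have lt : jcost A x t (sg, sg) < jcost A x t (t1, t2).
  rewrite /jcost/= K1 ltrD2r subrK.
  have := arrival_lt hP sg0 st1; have := wait_le t10 t12 t2T; lra.
exists (sg, sg); split => //.
- exact: le_trans (ltW sgt) tt2.
- exact: ltW.
- by rewrite leNgt lt.
Qed.

(** For t1 > 0 the last condition keeps the best starting point away from the origin: from there,
    arrival at t1 costs u0 0 + t1 [kern_lip], at least u0 0 - A0 t1 by [A0_ge]. *)
Lemma jcost_path x t t1 t2 : x != 0 -> t <= T -> 0 <= t1 -> t1 <= t2 -> t2 < t ->
  t1 = 0 \/ arrival P t1 < u0 P 0 - A0 P * t1 ->
  exists gamma, [/\ H1 t gamma, gamma t = x, junction_path t t1 t2 gamma &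
    path_cost P A t gamma = jcost A x t (t1, t2)].
Proof.
move=> x0 tT t10 t12 t2t h.
move: t10; rewrite le_eqVlt => /predU1P[E|t10].
  have [//||gamma [g1 g2 g3 g4]] := @junction_polyline _ _ hP _ hA x t t1 t2 true 0 x0 tT _ t12 t2t _.
  - by rewrite E.
  - by left.
  exists gamma; split => //; rewrite g4 /jcost/= -E arrival0// oppr0.
  by rewrite (kern0 (side_ham hP true))// mul0r addr0; ring.
case: h => [E|h]; first by rewrite E ltxx in t10.
have [s [y [Dy yE]]] := arrival_min hP (ltW t10).
have y0 : y != 0.
  apply: contraTneq h => y0; rewrite yE y0 oppr0 (kern0 (side_ham hP s)) ?ltW// -leNgt.
  by have := A0_ge P s; nra.
have [||gamma [g1 g2 g3 g4]] := @junction_polyline _ _ hP _ hA x t t1 t2 s y x0 tT _ t12 t2t _.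
- exact: ltW.
- right; split => //; move: Dy; rewrite /halfline /strict_side/=.
  by case: (s) => ?; rewrite lt_neqAle ?y0 ?(eq_sym 0) ?y0.
by exists gamma; split => //; rewrite g4 /jcost/= yE; ring.
Qed.

(* Arriving at time t1 by staying next to the junction is no better than
   waiting at the junction from the start. *)
Lemma jcost_degenerate x t t1 t2 : 0 <= t1 -> t1 <= t2 -> t2 <= T ->
  u0 P 0 - A0 P * t1 <= arrival P t1 ->
  jcost A x t (0, t2) <= jcost A x t (t1, t2) /\
  (jcost A x t (t1, t2) <= jcost A x t (0, t2) -> wait A t1 = - A0 P * t1).
Proof.
move=> t10 t12 t2T h; rewrite /jcost/= arrival0// wait0 subr0.
have := wait_bounds hA (lexx 0) t10 (le_trans t12 t2T).
rewrite wait0 !subr0 => /andP[h1 h2]; split; lra.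
Qed.

(** The path is cut at its first and last zeros, which exist since the zero set is compact; a path
    without zeros falls under the direct branch. *)
Lemma value_ge x t gamma : x != 0 -> 0 < t -> t <= T -> H1 t gamma -> gamma t = x ->
  uvalue A x t <= path_cost P A t gamma.
Proof.
move=> x0 t0 tT gH gx.
have [c [g [hc cE gE ->]]] := path_cost_density A t0 tT gH.
have [cc gi _] := hc.
have cx : c t = x by rewrite cE ?lexx ?ltW.
pose Z := `[0, t]%classic `&` [set s | c s = 0].
have cZ : compact Z.
  apply: compact_closedI; first exact: segment_compact.
  by apply: (@closed_comp _ _ c [set 0]) => [z _|]; [exact: cc|exact: closed_eq].
have [Z0|/set0P Z0] := eqVneq Z set0.
  have nz r : 0 <= r <= t -> c r != 0.
    move=> rt; apply/eqP => cr; have : Z r by split => //=; rewrite in_itv.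
    by rewrite Z0.
  have [sd le] := direct_cost_ge hP hA t0 tT hc nz.
  rewrite ge_min; apply/orP; left; apply: le_trans le; rewrite cx.
  have Dx : halfline (0 < x) x by apply: strict_sideW; exact: strict_side0.
  have Dc : halfline (0 < x) (c 0) by apply: strict_sideW; rewrite -{1}cx.
  exact: (direct_le (side_ham hP (0 < x)) (@u0_sloped _ _ hP (0 < x))
    (u0_continuous hP) Dx (ltW t0) Dc).
have cid : {within Z, continuous (@id R)}.
  by apply: continuous_subspaceT => z; exact: cvg_id.
have [t1 /set_mem[t1t ct1] t1min] := compact_EVT_min Z0 cZ cid.
have [t2 /set_mem[t2t ct2] t2max] := compact_EVT_max Z0 cZ cid.
move: t1t t2t; rewrite /= !in_itv/= => /andP[t10 t1t] /andP[t20 t2t].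
have t12 : t1 <= t2 by apply: t1min; apply/mem_set; split => //=; rewrite in_itv/= t20.
have {}t2t : t2 < t.
  by rewrite lt_neqAle t2t andbT; apply: contraNneq x0 => E; rewrite -cx -E; apply/eqP.
have := @junction_cost_ge _ _ hP _ hA t tT c g hc t1 t2 t10 t12 t2t ct1 ct2.
rewrite cx => /(_ x0) le; rewrite ge_min; apply/orP; right.
apply: le_trans (le _ _); first exact: (@ujunction_le x t (t1, t2) (And3 t10 t12 (le_trans (ltW t2t) tT))).
  move=> r /andP[r0 rt]; apply/eqP => cr.
  have : t1 <= r.
    by apply: t1min; apply/mem_set; split => //=; rewrite in_itv/= !ltW//= (lt_le_trans rt t1t).
  by rewrite leNgt rt.
move=> r /andP[r0 rt]; apply/eqP => cr.
have : r <= t2.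
  by apply: t2max; apply/mem_set; split => //=; rewrite in_itv/= !ltW//= (le_lt_trans t20 r0).
by rewrite leNgt r0.
Qed.

Lemma value_attained x t : x != 0 -> 0 < t -> t <= T ->
  exists gamma, [/\ H1 t gamma, gamma t = x & path_cost P A t gamma = uvalue A x t].
Proof.
move=> x0 t0 tT.
have [du|uj] := leP (udirect x t) (ujunction A x t).
  have Dx : halfline (0 < x) x by apply: strict_sideW; exact: strict_side0.
  have [y [Dy _ yE _]] := direct_min (side_ham hP (0 < x)) (@u0_sloped _ _ hP (0 < x)) (u0_continuous hP) Dx (ltW t0).
  have [gamma [g1 g2 g3]] := direct_polyline hP A x0 t0 tT Dy.
  by exists gamma; split => //; rewrite g3 /uvalue (min_l du) -yE.
have [z [zT zE zmin]] := ujunction_min x t.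
have [[t1 t2] [[/= t10 t12 t2T] t2t _ le _]] := jcost_normalize x0 t0 tT zT.
have WE : uvalue A x t = ujunction A x t by rewrite /uvalue min_r// ltW.
have E w : triangle w -> jcost A x t w <= jcost A x t z -> jcost A x t w = uvalue A x t.
  by move=> wT h; apply/eqP; rewrite eq_le WE zmin// andbT zE.
have [h|h] := ltP (arrival P t1) (u0 P 0 - A0 P * t1).
  have [gamma [g1 g2 _ g4]] := jcost_path x0 tT t10 t12 t2t (or_intror h).
  by exists gamma; split => //; rewrite g4 E.
have [le' _] := @jcost_degenerate x t t1 t2 t10 t12 t2T h.
have [gamma [g1 g2 _ g4]] := jcost_path x0 tT (lexx 0) (le_trans t10 t12) t2t (or_introl erefl).
exists gamma; split => //; rewrite g4 E ?(le_trans le')//.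
by split => //=; exact: le_trans t12.
Qed.

Lemma value_uvalue x t : x != 0 -> 0 < t -> t <= T -> value P A x t = uvalue A x t.
Proof.
move=> x0 t0 tT; rewrite /value gt_eqF//.
have [gamma [g1 g2 g3]] := value_attained x0 t0 tT; rewrite -g3.
apply: inf_image_eq => // eta [e1 e2]; rewrite g3; exact: value_ge.
Qed.

End value_formula.

(** * Differentiability of the value function *)

Section plane_differentiability.
Context (R : realType).

Lemma differentiable_expand (f : R * R -> R) (x t q c : R) :
  (forall e : R, 0 < e -> exists2 d : R, 0 < d & forall h k : R, `|h| < d -> `|k| < d ->
    `|f (x + h, t + k) - f (x, t) - (q * h - c * k)| <= e * (`|h| + `|k|)) ->
  differentiable f (x, t).
Proof.
move=> Hf.
(* Once the affine part is removed the differential to be identified is the zero map; the affine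
   part is differentiable by itself. *)
pose rho (z : R * R) := f z - f (x, t) - (q * (z.1 - x) - c * (z.2 - t)).
pose V : normedModType R := (R * R)%type.
pose df : {linear V -> R^o} := \0.
have lit : (rho : V -> R^o) \o shift (x, t) = cst (rho (x, t)) + df +o_ (0 : V) id.
  apply/eqaddoP => e e0; have e20 : 0 < e / 2 by rewrite divr_gt0.
  have [d d0 Hd] := Hf _ e20.
  near=> z.
  have zd : `|z| < d.
    near: z; have := @nbhs0_lt R V d d0; exact.
  have {}zd : Num.max `|z.1| `|z.2| < d := zd.
  move: zd.
  rewrite gt_max => /andP[z1 z2].
  have rho0 : rho (x, t) = 0 by rewrite /rho /= !subrr !mulr0 !subrr.
  have := Hd _ _ z1 z2.
  suff: `|f (x + z.1, t + z.2) - f (x, t) - (q * z.1 - c * z.2)| <= e / 2 * (`|z.1| + `|z.2|) ->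
    `|rho (z + (x, t)) - (rho (x, t) + 0)| <= e * Num.max `|z.1| `|z.2| by [].
  rewrite rho0 addr0 subr0 /rho.
  have -> : z + (x, t) = (x + z.1, t + z.2) by case: (z) => a b; rewrite /= addrC.
  have -> : x + z.1 - x = z.1 by ring.
  have -> : t + z.2 - t = z.2 by ring.
  move=> /le_trans; apply.
  have m1 : `|z.1| <= Num.max `|z.1| `|z.2| by rewrite le_max lexx.
  have m2 : `|z.2| <= Num.max `|z.1| `|z.2| by rewrite le_max lexx orbT.
  have := ler_wpM2l (ltW e0) m1; have := ler_wpM2l (ltW e0) m2; lra.
have c0 : continuous df by move=> z; exact: cvg_cst.
have dE := diff_unique c0 lit.
have drho : differentiable (rho : V -> R^o) (x, t).
  by apply/diff_locallyP; rewrite dE.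
have -> : f = (rho : (R * R)%type -> R) + ((q \*: (fst : (R * R)%type -> R)) - (c \*: (snd : (R * R)%type -> R)) + cst (f (x, t) - q * x + c * t)).
  apply/funext => z; rewrite /= /rho.
  rewrite -[RHS]/(f z - f (x, t) - (q * (z.1 - x) - c * (z.2 - t)) + (q * z.1 - c * z.2 + (f (x, t) - q * x + c * t))).
  by ring.
apply: differentiableD => //; apply: differentiableD; last exact: differentiable_cst.
apply: differentiableB; apply: differentiableZ.
  by apply: (@linear_differentiable _ _ _ (@fst R R)) => z; exact: cvg_fst.
by apply: (@linear_differentiable _ _ _ (@snd R R)) => z; exact: cvg_snd.
Unshelve. all: by end_near. Qed.

Lemma differentiable_partial (f : R * R -> R) (x t : R) :
  differentiable f (x, t) -> exists q : R, forall e : R, 0 < e ->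
    exists2 d : R, 0 < d & forall h : R, `|h| < d ->
      `|f (x + h, t) - f (x, t) - q * h| <= e * `|h|.
Proof.
move=> /diff_locallyP[_ /eqaddoP Hf].
exists ('d f (x, t) (1, 0)) => e e0.
have /nbhs_ballP[d /= d0 Hd] := Hf e e0.
exists d => // h hd.
have nh : `|(h, 0 : R)| = `|h| :> R.
  by rewrite prod_normE/= normr0 max_l.
have hb : ball (0 : R * R) d (h, 0).
  by rewrite -ball_normE /= sub0r normrN nh.
have := Hd _ hb.
move=> Hh; have {Hh} : `|f ((h, 0) + (x, t)) - (f (x, t) + 'd f (x, t) (h, 0))| <= e * `|(h, 0 : R)| := Hh.
rewrite nh.
have -> : (h, 0) + (x, t) = (x + h, t) by congr pair; rewrite /= ?add0r// addrC.
have -> : (h, 0) = h *: (1, 0) :> R * R by congr pair; rewrite /= ?mulr1 ?mulr0//; [exact: esym (mulr1 _)|exact: esym (mulr0 _)].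
by rewrite linearZ /= opprD addrA [h *: _]mulrC.
Qed.

End plane_differentiability.

Section danskin.
Context (R : realType) (H : R -> R) (r : R) (hH : hamiltonian H r).
Local Notation K := (kern H r).
Local Notation argK := (kargmax H r).

Lemma kern_convex x w tau l : 0 <= l -> l <= 1 ->
  K (x + l * w) tau - K x tau <= l * (K (x + w) tau - K x tau).
Proof.
move=> l0 l1; have [p [rp p0 <-]] := kern_max hH (x + l * w) tau.
have := kern_ge hH x tau rp p0; have := kern_ge hH (x + w) tau rp p0; nra.
Qed.

Lemma within_fst (T U : topologicalType) (D : set T) (E : set U) (f : T -> R) (z : T * U) :
  {within D, continuous f} -> D z.1 ->
  f w.1 @[w --> within (D `*` E) (nbhs z)] --> f z.1.
Proof.
move=> /subspace_continuousP cf Dz; apply: cvg_comp (cf _ Dz).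
move=> B HB; rewrite /within/= in HB *.
case: z Dz HB => a b /= Da HB.
have : nbhs (a, b) (fst @^-1` (fun t => D t -> B t)).
  by exists ((fun t => D t -> B t), setT) => [|[u v] []//]; split => //; exact: filterT.
by apply: filterS => -[u v] /= h [Du _]; exact: h.
Qed.

Arguments within_fst {T U D} E {f z}.

(* Near-minimisers have their maximising slopes close to q, by compactness. *)
Lemma danskin_lower (T : topologicalType) (D : set T) (c X tau : T -> R) (W q : R) :
  compact D -> {within D, continuous c} -> {within D, continuous X} ->
  {within D, continuous tau} -> - r <= q -> q <= 0 ->
  (forall i, D i -> W <= c i + K (X i) (tau i)) ->
  (forall i, D i -> c i + K (X i) (tau i) = W ->
    forall p, argK (X i) (tau i) p -> p = q) ->
  forall e : R, 0 < e -> exists2 d : R, 0 < d & forall h k : R, `|h| < d -> `|k| < d ->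
    forall i, D i ->
    W + q * h - H q * k - e * (`|h| + `|k|) <= c i + K (X i + h) (tau i + k).
Proof.
move=> cD cc cX ct rq q0 Wle Wq e e0.
have /cvgrPdist_le/(_ e e0)/nbhs_ballP[eta0 /= eta00 Heta] : H z @[z --> q] --> H q.
  exact: (ham_cont hH).
pose eta := Num.min eta0 e.
have eta_gt0 : 0 < eta by rewrite lt_min eta00.
pose B := `[- r, 0]%classic `\` ball q eta.
have cB : compact B.
  rewrite /B setDE; apply: compact_closedI; first exact: segment_compact.
  exact/open_closedC/ball_open.
(* The value at i plus the defect of p as a maximiser. It equals W only if i is a minimiser and p
   its slope, hence p = q, so compactness keeps it away from W on [D] times [B]. *)
pose Psi (z : T * R) := c z.1 + K (X z.1) (tau z.1) +
  (K (X z.1) (tau z.1) - (X z.1 * z.2 - tau z.1 * H z.2)).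
have cPsi : {within D `*` B, continuous Psi}.
  apply/subspace_continuousP => z [Dz Bz].
  have fc := within_fst B cc Dz.
  have fX := within_fst B cX Dz.
  have ft := within_fst B ct Dz.
  have fz : w.2 @[w --> within (D `*` B) (nbhs z)] --> z.2.
    by apply: cvg_within_filter; exact: cvg_snd.
  have fH : H w.2 @[w --> within (D `*` B) (nbhs z)] --> H z.2.
    by apply: cvg_comp fz _; exact: (ham_cont hH).
  have fK : K (X w.1) (tau w.1) @[w --> within (D `*` B) (nbhs z)] --> K (X z.1) (tau z.1).
    apply/cvgrPdist_le => a a0.
    have r0 := ham_r hH; have l0 := kern_lip_gt0 hH.
    have b1 : 0 < a / (2 * r) by rewrite divr_gt0// mulr_gt0.
    have b2 : 0 < a / (2 * kern_lip H) by rewrite divr_gt0// mulr_gt0.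
    move/cvgrPdist_le : fX => /(_ _ b1) nX; move/cvgrPdist_le : ft => /(_ _ b2) nt.
    near=> w; apply: le_trans (kern_lipschitz hH _ _ _ _) _.
    have h1 : `|X z.1 - X w.1| <= a / (2 * r) by near: w; exact: nX.
    have h2 : `|tau z.1 - tau w.1| <= a / (2 * kern_lip H) by near: w; exact: nt.
    have h3 : r * (a / (2 * r)) = a / 2 by field; rewrite gt_eqF.
    have h4 : kern_lip H * (a / (2 * kern_lip H)) = a / 2 by field; rewrite gt_eqF.
    have h5 : r * `|X z.1 - X w.1| <= a / 2 by rewrite -h3 ler_wpM2l// ltW.
    have h6 : kern_lip H * `|tau z.1 - tau w.1| <= a / 2 by rewrite -h4 ler_wpM2l// ltW.
    lra.
  apply: cvgD; first exact: cvgD.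
  by apply: cvgB => //; apply: cvgB; exact: cvgM.
have [|dl dl0 Hdl] := compact_strict_gap (c := W) (compact_setX cD cB) cPsi.
  move=> [i p] [/= Di [/=]]; rewrite in_itv/= => /andP[rp p0] pb.
  have h1 := Wle _ Di; have h2 := kern_ge hH (X i) (tau i) rp p0.
  rewrite /Psi/= lt_neqAle; apply/andP; split; last by lra.
  apply/eqP => E; apply: pb.
  have Ei : c i + K (X i) (tau i) = W by lra.
  have Ep : argK (X i) (tau i) p by split => //; lra.
  by rewrite (Wq _ Di Ei _ Ep); exact: ballxx.
have r0 := ham_r hH; have l0 := kern_lip_gt0 hH.
exists (dl / (2 * (r + kern_lip H)) / 2); first by rewrite !divr_gt0// mulr_gt0// addr_gt0.
move=> h k hd kd i Di.
have hk : 2 * (r + kern_lip H) * (`|h| + `|k|) < dl.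
  rewrite mulrC -ltr_pdivlMr; last by rewrite mulr_gt0// addr_gt0.
  lra.
have n1 := normr_ge0 h; have n2 := normr_ge0 k.
have [p Ep] := kern_max hH (X i) (tau i); have [rp p0 pE] := Ep.
have [pb|pb] := pselect (ball q eta p).
  have pq : `|p - q| <= e.
    move: pb; rewrite -ball_normE /= distrC => /ltW/le_trans; apply.
    by rewrite /eta ge_min lexx orbT.
  have Hpq : `|H q - H p| <= e.
    by apply: Heta; move: pb; rewrite -!ball_normE /= => /lt_le_trans; apply; rewrite ge_min lexx.
  have := kargmax_affine hH (X i + h) (tau i + k) Ep; have := Wle _ Di.
  have -> : X i + h - X i = h by ring.
  have -> : tau i + k - tau i = k by ring.
  have m1 : - (e * `|h|) <= (p - q) * h.
    rewrite lerNl; apply: le_trans (ler_norm _) _.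
    by rewrite normrN normrM ler_wpM2r.
  have m2 : - (e * `|k|) <= (H q - H p) * k.
    rewrite lerNl; apply: le_trans (ler_norm _) _.
    by rewrite normrN normrM ler_wpM2r.
  lra.
have := Hdl (i, p) _; rewrite /Psi/= => /(_ _).
have Bp : B p by split => //=; rewrite in_itv/= rp.
move=> /(_ (conj Di Bp)); rewrite pE subrr addr0 => gap.
have := kern_lipschitz hH (X i) (tau i) (X i + h) (tau i + k).
have -> : X i - (X i + h) = - h by ring.
have -> : tau i - (tau i + k) = - k by ring.
rewrite !normrN ler_norml => /andP[_ hK].
have m1 : q * h <= r * `|h|.
  apply: le_trans (ler_norm _) _; rewrite normrM ler_wpM2r//.
  by rewrite ler0_norm// lerNl.
have m2 : - (H q * k) <= kern_lip H * `|k|.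
  apply: le_trans (ler_norm _) _; rewrite normrN normrM ler_wpM2r//.
  exact: ham_norm hH _ rq q0.
have m3 : 0 <= r * `|k| by rewrite mulr_ge0// ltW.
have m4 : 0 <= kern_lip H * `|h| by rewrite mulr_ge0// ltW.
have m5 : 0 <= e * (`|h| + `|k|) by rewrite mulr_ge0 ?addr_ge0// ltW.
lra.
Unshelve. all: by end_near. Qed.

End danskin.

(** * Optimal last stretches, kinks, and the common slope at a point of differentiability *)

Section extremal_structure.
Context (R : realType) (P : junction R) (hP : standing_assumptions P).
Local Notation mu := (@lebesgue_measure R).
Local Notation T := (horizon P).
Local Notation KS s := (kern (sideH P s) (sideR P s)).
Local Notation argS s := (kargmax (sideH P s) (sideR P s)).
Context (A : R -> R) (hA : control P A).

(* Optimality of the last stretch of a path: it arrives at x with displacement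
   X during the time tau, coming either from the initial line or from the
   junction. *)
Definition last_stretch (x t X tau : R) :=
  (exists y, [/\ halfline (0 < x) y, X = x - y, tau = t &
     u0 P y + KS (0 < x) X tau = uvalue P A x t]) \/
  (exists z, [/\ triangle P z, X = x, tau = t - z.2 &
     jcost P A x t z = uvalue P A x t]).

Lemma last_stretch_exists x t : x != 0 -> 0 <= t ->
  exists X tau, last_stretch x t X tau.
Proof.
move=> x0 t0; rewrite /last_stretch /uvalue.
have [c|c] := leP (udirect P x t) (ujunction P A x t).
  have [y [Dy _ E _]] := direct_min (side_ham hP (0 < x)) (@u0_sloped _ _ hP (0 < x))
    (@u0_continuous _ _ hP) (strict_sideW (strict_side0 x0)) t0.
  by exists (x - y), t; left; exists y; split.
have [z [Dz E _]] := ujunction_min hP hA x t.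
by exists x, (t - z.2); right; exists z; split.
Qed.

Lemma last_stretch_neq0 x t X tau : x != 0 -> 0 < t -> last_stretch x t X tau ->
  X != 0 \/ 0 < tau.
Proof. by move=> x0 t0 [[y [_ _ -> _]]|[z [_ -> _ _]]]; [right|left]. Qed.

Lemma side_shift (x h : R) : `|h| < `|x| -> (0 < x + h) = (0 < x).
Proof.
move=> hx; apply/idP/idP => c.
  rewrite ltNge; apply/negP => x0; move: hx; rewrite (ler0_norm x0).
  by have := ler_norm h; lra.
by move: hx; rewrite (gtr0_norm c); have := ler_norm (- h); rewrite normrN; lra.
Qed.

(** Keeping the start of the last stretch and moving only its end gives a competitor, so the kernel
    touches the value from above at (x, t). *)
Lemma last_stretch_touch x t X tau h k : x != 0 -> last_stretch x t X tau ->
  `|h| < `|x| -> 0 <= t + k ->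
  uvalue P A (x + h) (t + k) <=
  uvalue P A x t - KS (0 < x) X tau + KS (0 < x) (X + h) (tau + k).
Proof.
move=> x0 st hx tk; have sE := side_shift hx.
have xh0 : x + h != 0.
  by apply/eqP => xh; move: hx; rewrite (_ : h = - x) ?normrN ?ltxx//; lra.
case: st => [[y [Dy -> -> E]]|[z [Dz -> -> E]]].
  rewrite -E /uvalue ge_min; apply/orP; left.
  rewrite (_ : _ - _ = u0 P y); last by ring.
  rewrite (_ : x - y + h = x + h - y); last by ring.
  rewrite /udirect sE.
  apply: (direct_le (side_ham hP (0 < x)) (@u0_sloped _ _ hP (0 < x))
    (@u0_continuous _ _ hP)) => //.
  by rewrite -sE; exact: strict_sideW (strict_side0 xh0).
rewrite -E /uvalue ge_min; apply/orP; right.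
apply: (le_trans (ujunction_le hP hA _ _ Dz)).
by rewrite /jcost sE (_ : t + k - z.2 = t - z.2 + k); [lra|ring].
Qed.

Definition kinked (t : R) := [set x : R | x != 0 /\
  exists X tau X' tau' p p', [/\ last_stretch x t X tau, last_stretch x t X' tau',
    argS (0 < x) X tau p, argS (0 < x) X' tau' p' & p < p']].

Lemma last_stretch_slope x t X tau p e : x != 0 -> 0 < t -> last_stretch x t X tau ->
  argS (0 < x) X tau p -> 0 < e ->
  exists2 d : R, 0 < d & forall h k : R, `|h| < d -> `|k| < d ->
    uvalue P A (x + h) (t + k) <=
    uvalue P A x t + p * h - sideH P (0 < x) p * k + e * (`|h| + `|k|).
Proof.
move=> x0 t0 st ap e0.
have [d d0 Hd] := kern_expand (side_ham hP (0 < x)) ap (last_stretch_neq0 x0 t0 st) e0.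
exists (Num.min d (Num.min `|x| t)); first by rewrite !lt_min d0 normr_gt0 x0.
move=> h k; rewrite !lt_min => /and3P[hd hx _] /and3P[kd _ kt].
have tk : 0 <= t + k by have := ler_norm (- k); rewrite normrN; lra.
have := last_stretch_touch x0 st hx tk; have := Hd _ _ hd kd; lra.
Qed.

Lemma countable_kinked t : 0 < t -> countable (kinked t).
Proof.
move=> t0; apply: (@countable_kinks _ (fun x => uvalue P A x t)).
move=> x [x0 [X [tau [X' [tau' [p [p' [st st' ap ap' pp']]]]]]]].
exists p, p'; split => // rho Hrho.
  have e0 : 0 < (rho - p) / 2 by lra.
  have [d d0 Hd] := last_stretch_slope x0 t0 st ap e0.
  exists d => // h /andP[h0 hd].
  have := Hd h 0; rewrite (gtr0_norm h0) normr0 addr0 mulr0 subr0 => /(_ hd d0).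
  have : 0 < (rho - p) * h by rewrite mulr_gt0// subr_gt0.
  lra.
have e0 : 0 < (p' - rho) / 2 by lra.
have [d d0 Hd] := last_stretch_slope x0 t0 st' ap' e0.
exists d => // h /andP[h0 hd].
have := Hd (- h) 0; rewrite normrN (gtr0_norm h0) normr0 addr0 mulr0 subr0 => /(_ hd d0).
have : 0 < (p' - rho) * h by rewrite mulr_gt0// subr_gt0.
lra.
Qed.

(** Derived from [jcost_lipschitz] at x = 0 and t = 0 by subtracting the kernel; at x = 0 the side
    test fails, so that kernel is the left one. *)
Lemma waiting_continuous : {within triangle P,
  continuous (fun z => arrival P z.1 - wait A z.1 + wait A z.2)}.
Proof.
have [L L0 HL] := jcost_lipschitz hP hA.
have l0 := kern_lip_gt0 (side_ham hP false).
apply: (@lipschitz2_continuous _ _ _ (L + kern_lip (sideH P false))).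
  exact: addr_gt0.
move=> z w Dz Dw; have := HL 0 0 _ _ Dz Dw.
have := kern_lipschitz (side_ham hP false) 0 (0 - z.2) 0 (0 - w.2).
rewrite /jcost ltxx subrr normr0 mulr0 !sub0r add0r.
have -> : - z.2 - (- w.2) = - (z.2 - w.2) by ring.
rewrite normrN.
set a := arrival P z.1 - _ + _; set b := arrival P w.1 - _ + _.
set k1 := kern _ _ _ _; set k2 := kern _ _ _ _ => h1 h2.
have -> : a - b = (a + k1 - (b + k2)) - (k1 - k2) by ring.
apply: le_trans (ler_normB _ _) _.
have : 0 <= kern_lip (sideH P false) * `|z.1 - w.1| by rewrite mulr_ge0// ltW.
lra.
Qed.

(** Without a kink all optimal last stretches share one slope q, and the gradient is (q, - H q). One
    stretch gives the expansion from above, [danskin_lower] on both branches gives it from below. *)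
Lemma uvalue_differentiable x t : x != 0 -> 0 < t -> t < T -> ~ kinked t x ->
  differentiable (fun z : R * R => value P A z.1 z.2) (x, t).
Proof.
move=> x0 t0 tT nk.
have hH := side_ham hP (0 < x).
have [X [tau st]] := last_stretch_exists x0 (ltW t0).
have [q aq] := kern_max hH X tau; have [rq q0 _] := aq.
have uq X' tau' p : last_stretch x t X' tau' -> argS (0 < x) X' tau' p -> p = q.
  move=> st' ap; apply/eqP; rewrite eq_le !leNgt; apply/andP; split; apply/negP => pq.
    by apply: nk; split => //; exists X, tau, X', tau', q, p.
  by apply: nk; split => //; exists X', tau', X, tau, p, q.
apply: (@differentiable_expand _ _ _ _ q (sideH P (0 < x) q)) => e e0.
have [d1 d10 Hup] := last_stretch_slope x0 t0 st aq e0.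
have Wj z : triangle P z -> uvalue P A x t <=
    (arrival P z.1 - wait A z.1 + wait A z.2) + KS (0 < x) x (t - z.2).
  by move=> Dz; rewrite /uvalue ge_min (ujunction_le hP hA x t Dz) orbT.
have [d2 d20 Hj] : exists2 d : R, 0 < d & forall h k : R, `|h| < d -> `|k| < d ->
    forall z, triangle P z ->
    uvalue P A x t + q * h - sideH P (0 < x) q * k - e * (`|h| + `|k|) <=
    (arrival P z.1 - wait A z.1 + wait A z.2) + KS (0 < x) (x + h) (t - z.2 + k).
  apply: (danskin_lower hH (X := cst x) (tau := fun z => t - z.2)
    (@compact_triangle _ P) waiting_continuous) => //.
  - by apply: continuous_subspaceT => z; exact: cvg_cst.
  - apply: continuous_subspaceT => z.
    by apply: cvgB; [exact: cvg_cst|exact: cvg_snd].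
  - move=> z Dz E p ap; apply: uq ap; right; exists z; split => //.
set M := speed (sideH P (0 < x)) (sideR P (0 < x)).
have M0 : 0 < M := speed_gt0 hH.
(* Finite speed: for end points within distance 1 and times below t + 1, optimal direct starts stay
   in this compact set. *)
pose D := @halfline R (0 < x) `&` `[x - (M * (t + 1) + 1), x + (M * (t + 1) + 1)].
have cD : compact D.
  rewrite /D setIC; apply: compact_closedI; first exact: segment_compact.
  rewrite /halfline; case: (0 < x); [exact: closed_ge|exact: closed_le].
have dle := direct_le hH (@u0_sloped _ _ hP (0 < x)) (@u0_continuous _ _ hP).
have Dx := strict_sideW (strict_side0 x0).
have [d3 d30 Hd] : exists2 d : R, 0 < d & forall h k : R, `|h| < d -> `|k| < d ->
    forall y, D y ->
    uvalue P A x t + q * h - sideH P (0 < x) q * k - e * (`|h| + `|k|) <=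
    u0 P y + KS (0 < x) (x - y + h) (t + k).
  apply: (danskin_lower hH (X := fun y => x - y) (tau := cst t) cD) => //.
  - by apply: continuous_subspaceT => z; exact: u0_continuous.
  - apply: continuous_subspaceT => z.
    by apply: cvgB; [exact: cvg_cst|exact: cvg_id].
  - by apply: continuous_subspaceT => z; exact: cvg_cst.
  - move=> y [Dy _]; rewrite /uvalue ge_min; apply/orP; left; apply: dle => //; exact: ltW.
  - move=> y [Dy _] E p ap; apply: uq ap; left; exists y; split => //.
exists (Num.min (Num.min d1 (Num.min d2 d3)) (Num.min (Num.min `|x| 1) (Num.min t (T - t)))).
  by rewrite !lt_min d10 d20 d30 normr_gt0 x0 ltr01 t0 subr_gt0.
move=> h k; rewrite !lt_min.
move=> /andP[/and3P[h1 h2 h3] /andP[/andP[hx hl] _]].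
move=> /andP[/and3P[k1 k2 k3] /andP[/andP[_ kl] /andP[kt kT]]].
have nk' := ler_norm (- k); have pk := ler_norm k; rewrite normrN in nk'.
have sE := side_shift hx.
have xh0 : x + h != 0.
  by apply/eqP => xh; move: hx; rewrite (_ : h = - x) ?normrN ?ltxx//; lra.
rewrite /= !(value_uvalue hP hA)//; try lra.
have := Hup _ _ h1 k1.
have lo : uvalue P A x t + q * h - sideH P (0 < x) q * k - e * (`|h| + `|k|) <=
    uvalue P A (x + h) (t + k).
  rewrite [X in _ <= X]/uvalue le_min; apply/andP; split.
    have Dxh : @halfline R (0 < x) (x + h).
      by rewrite -sE; exact: strict_sideW (strict_side0 xh0).
    have tk0 : 0 <= t + k by lra.
    have [y [Dy yM E _]] := direct_min hH (@u0_sloped _ _ hP (0 < x))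
      (@u0_continuous _ _ hP) Dxh tk0.
    rewrite /udirect sE E (_ : x + h - y = x - y + h); last by ring.
    apply: Hd => //; split => //=; rewrite in_itv/=.
    have Mk : M * (t + k) <= M * (t + 1) by rewrite ler_wpM2l ?ltW//; lra.
    have := ler_norm (x + h - y); have := ler_norm (- (x + h - y)).
    have := ler_norm (- h); have := ler_norm h; rewrite !normrN.
    by move=> ? ? ? ?; apply/andP; split; move: yM; rewrite -/M; lra.
  have [z [Dz -> _]] := ujunction_min hP hA (x + h) (t + k).
  rewrite /jcost sE (_ : t + k - z.2 = t - z.2 + k); last by ring.
  exact: Hj.
by move: lo => lo up; rewrite ler_norml; apply/andP; split; lra.
Qed.

(** The partial derivative q in x is a subgradient of the kernel of every optimal last stretch. If
    the inequality failed at X', convexity would carry the failure, in proportion, to points close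
    to X, where the kernel touches the value from above. *)
Lemma differentiable_slope x t : x != 0 -> 0 < t -> t <= T ->
  differentiable (fun z : R * R => value P A z.1 z.2) (x, t) ->
  exists q, forall X tau, last_stretch x t X tau -> 0 <= tau -> argS (0 < x) X tau q.
Proof.
move=> x0 t0 tT /differentiable_partial[q Hq]; exists q => X tau st tau0.
have hH := side_ham hP (0 < x).
apply: (kargmax_subgradient hH tau0) => X'.
have [->|XX'] := eqVneq X' X; first by rewrite subrr mulr0 addr0.
rewrite leNgt; apply/negP => lt.
set w := X' - X; have w0 : 0 < `|w| by rewrite normr_gt0 subr_eq0.
pose g := KS (0 < x) X tau + q * w - KS (0 < x) X' tau.
have g0 : 0 < g by rewrite /g subr_gt0.
have e0 : 0 < g / (2 * `|w|) by rewrite divr_gt0// mulr_gt0.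
have [d d0 Hd] := Hq _ e0.
pose m := Num.min d (Num.min `|x| `|w|) / 2.
have m1 : 0 < Num.min d (Num.min `|x| `|w|) by rewrite !lt_min d0 normr_gt0 x0.
have m0 : 0 < m by rewrite divr_gt0.
have mm : 2 * m = Num.min d (Num.min `|x| `|w|) by rewrite /m; field.
have [md [mx mw]] : m < d /\ m < `|x| /\ m < `|w|.
  have : 2 * m <= d by rewrite mm ge_min lexx.
  have : 2 * m <= `|x| by rewrite mm !ge_min lexx orbT.
  have : 2 * m <= `|w| by rewrite mm !ge_min lexx !orbT.
  by move=> ? ? ?; split; [|split]; lra.
pose l := m / `|w|.
have l0 : 0 < l by rewrite divr_gt0.
have l1 : l <= 1 by rewrite ler_pdivrMr// mul1r ltW.
have nlw : `|l * w| = m by rewrite normrM (gtr0_norm l0) divfK// gt_eqF.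
have hx : `|l * w| < `|x| by rewrite nlw.
have hd : `|l * w| < d by rewrite nlw.
have xlw : x + l * w != 0.
  by apply/eqP => xh; move: hx; rewrite (_ : l * w = - x) ?normrN ?ltxx//; lra.
have := Hd _ hd; rewrite /= !(value_uvalue hP hA)// nlw ler_norml => /andP[lo _].
have t00 : 0 <= t + 0 by rewrite addr0 ltW.
have := last_stretch_touch x0 st hx t00; rewrite !addr0.
have := kern_convex hH X w tau (ltW l0) l1; rewrite -/w.
rewrite (_ : X + w = X'); last by rewrite /w; ring.
have : g / (2 * `|w|) * m = l * (g / 2) by rewrite /l; field; rewrite gt_eqF.
have : 0 < l * g by rewrite mulr_gt0.
move: lo; rewrite /g => *; nra.
Qed.

End extremal_structure.

(** * Optimal paths at points of differentiability *)

Section optimal_paths.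
Context (R : realType) (P : junction R) (hP : standing_assumptions P).
Local Notation mu := (@lebesgue_measure R).
Local Notation T := (horizon P).
Local Notation KS s := (kern (sideH P s) (sideR P s)).
Local Notation argS s := (kargmax (sideH P s) (sideR P s)).
Context (A : R -> R) (hA : control P A).

Definition optimal_times (x t : R) (z : R * R) :=
  triangle P z /\ jcost P A x t z = uvalue P A x t.

Lemma affine_neq0 (g : R -> R) (a b : R) : a < b -> affine_on `[a, b] g ->
  g a = 0 -> g b != 0 -> forall r, a < r <= b -> g r != 0.
Proof.
move=> ab [al [be E]] ga gb r /andP[ar rb].
have Ea : g a = al * a + be by apply: E; rewrite /= in_itv/= lexx ltW.
have Eb : g b = al * b + be by apply: E; rewrite /= in_itv/= lexx ltW.
have Er : g r = al * r + be by apply: E; rewrite /= in_itv/= (ltW ar).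
have e1 : g r = al * (r - a) by rewrite Er; have := ga; rewrite Ea; lra.
have e2 : g b = al * (b - a) by rewrite Eb; have := ga; rewrite Ea; lra.
rewrite e1 mulf_neq0//; last by rewrite subr_eq0 gt_eqF.
by apply: contraNneq gb => al0; rewrite e2 al0 mul0r.
Qed.

Section junction_shape.
Context (x t : R) (gamma : R -> R) (x0 : x != 0) (t0 : 0 < t) (tT : t <= T).
Context (opt : optimal_path P A x t gamma).

(** The record gives zeros on the open interval and at t2 only. The value at t1 follows by
    continuity, or from t1 = t2. *)
Lemma junction_path_entrance t1 t2 : junction_path t t1 t2 gamma -> gamma t1 = 0.
Proof.
move=> [[z1 z12 z2t] [g2 _] stay _].
have [<-//|t12] := eqVneq t2 t1.
have [gH _ _] := opt.
have [c [g [cg cgam _ _]]] := path_cost_density A t0 tT gH.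
have [cc _ _] := cg.
have lt12 : t1 < t2 by rewrite lt_neqAle eq_sym t12.
rewrite -cgam; last by rewrite z1/=; lra.
apply/eqP; apply/negP => /negP c0.
have := cc t1 => /cvgrPdist_lt/(_ `|c t1|); rewrite normr_gt0 => /(_ c0).
move=> /nbhs_ballP[d /= d0 Hd].
pose m := Num.min d (t2 - t1) / 2.
have m1 : 0 < Num.min d (t2 - t1) by rewrite lt_min d0 subr_gt0.
have mm : 2 * m = Num.min d (t2 - t1) by rewrite /m; field.
have md : 2 * m <= d by rewrite mm ge_min lexx.
have mt : 2 * m <= t2 - t1 by rewrite mm ge_min lexx orbT.
have m0 : 0 < m by rewrite divr_gt0.
have := Hd (t1 + m); rewrite (cgam (t1 + m)); last by apply/andP; split; lra.
rewrite stay; last by rewrite in_itv/=; apply/andP; split; lra.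
rewrite subr0 ltxx => /(_ _)/negP; apply.
  rewrite -ball_normE /= (_ : t1 - (t1 + m) = - m); last by ring.
  by rewrite normrN gtr0_norm//; lra.
by [].
Qed.

Lemma junction_path_zero t1 t2 s : junction_path t t1 t2 gamma -> 0 < s -> s < t ->
  gamma s = 0 <-> t1 <= s <= t2.
Proof.
move=> jp s0 st; have g1 := junction_path_entrance jp.
have [[z1 z12 z2t] [g2 ex] stay [_ start]] := jp; have [_ gx _] := opt.
split=> [gs|/andP[]].
  apply/andP; split; rewrite leNgt; apply/negP => c.
    by have := start s; rewrite in_itv/= s0 c gs eqxx => /(_ isT).
  have := affine_neq0 z2t ex g2; rewrite gx => /(_ x0 s).
  by rewrite c ltW// gs eqxx => /(_ isT).
rewrite le_eqVlt => /predU1P[<-//|s1].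
rewrite le_eqVlt => /predU1P[->//|s2].
by apply: stay; rewrite in_itv/= s1.
Qed.

Lemma junction_path_optimal t1 t2 : junction_path t t1 t2 gamma ->
  optimal_times x t (t1, t2).
Proof.
move=> jp; have g1 := junction_path_entrance jp.
have [[z1 z12 z2t] [g2 ex] stay [_ start]] := jp; have [gH gx gc] := opt.
have D : triangle P (t1, t2) by split => //=; exact: le_trans (ltW z2t) tT.
split => //; apply/eqP; rewrite eq_le; apply/andP; split; last first.
  by rewrite /uvalue ge_min (ujunction_le hP hA _ _ D) orbT.
rewrite -(value_uvalue hP hA)// -gc.
have [c [g [cg cgam _ ->]]] := path_cost_density A t0 tT gH.
have ct : c t = x by rewrite cgam ?gx// lexx ltW.
rewrite /jcost /= -ct.
apply: (@junction_cost_ge _ _ hP _ hA t tT c g cg t1 t2) => //.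
- by rewrite cgam// z1; lra.
- by rewrite cgam//; apply/andP; split; lra.
- by rewrite ct.
- move=> r /andP[r0 r1]; rewrite cgam; last by apply/andP; split; lra.
  by apply: start; rewrite in_itv/= r0.
- move=> r /andP[r1 r2]; rewrite cgam; last by apply/andP; split; lra.
  by apply: (affine_neq0 z2t ex g2); rewrite ?gx// r1 ltW.
Qed.

Lemma direct_path_optimal : (forall s, s \in `[0, t] -> gamma s != 0) ->
  exists y, strict_side (0 < x) y /\ u0 P y + KS (0 < x) (x - y) t = uvalue P A x t.
Proof.
move=> nz; have [gH gx gc] := opt.
have [c [g [cg cgam _ E]]] := path_cost_density A t0 tT gH.
have ct : c t = x by rewrite cgam ?gx// lexx ltW.
have cnz r : 0 <= r <= t -> c r != 0 by move=> rt; rewrite cgam// nz// in_itv.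
have [sy lo] := direct_cost_ge hP hA t0 tT cg cnz.
exists (c 0); rewrite ct in sy lo; split => //.
apply/eqP; rewrite eq_le; apply/andP; split.
  by rewrite -(value_uvalue hP hA)// -gc E.
rewrite /uvalue ge_min; apply/orP; left.
apply: (direct_le (side_ham hP (0 < x)) (@u0_sloped _ _ hP (0 < x))
  (@u0_continuous _ _ hP)); [exact: strict_sideW (strict_side0 x0)|exact: ltW|].
exact: strict_sideW sy.
Qed.

End junction_shape.

Lemma optimal_times_stretch x t z : optimal_times x t z -> last_stretch P A x t x (t - z.2).
Proof. by move=> [Dz E]; right; exists z. Qed.

Section differentiability_point.
Context (x t : R) (x0 : x != 0) (t0 : 0 < t) (tT : t <= T).
Context (hd : differentiable (fun z : R * R => value P A z.1 z.2) (x, t)).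

(** If the common slope q is inside (- r, 0), then x = (t - z.2) H'(q) determines the departure
    time. Otherwise H q = 0, the kernel has the same value for both durations, and departures can be
    exchanged. *)
Lemma optimal_times_wait z z' : optimal_times x t z -> optimal_times x t z' ->
  z.2 < t -> z'.2 < t -> z.2 <= z'.2 -> wait A z.2 = wait A z'.2.
Proof.
move=> oz oz' zt zt'; rewrite le_eqVlt => /predU1P[->//|zz].
have hH := side_ham hP (0 < x).
have [q Hq] := differentiable_slope hP hA x0 t0 tT hd.
have aq := Hq _ _ (optimal_times_stretch oz); have {}aq := aq ltac:(lra).
have aq' := Hq _ _ (optimal_times_stretch oz'); have {}aq' := aq' ltac:(lra).
have [rq q0 kE] := aq; have [_ _ kE'] := aq'.
have [/andP[rq' q0']|qb] := boolP ((- sideR P (0 < x) < q) && (q < 0)).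
  have e1 := kargmax_interior hH aq rq' q0'; have e2 := kargmax_interior hH aq' rq' q0'.
  have : (z'.2 - z.2) * derive1 (sideH P (0 < x)) q = 0 by lra.
  move/eqP; rewrite mulf_eq0 subr_eq0 gt_eqF//= => /eqP h0.
  by move: x0; rewrite e1 h0 mulr0 eqxx.
have Hq0 := ham_eq0 hH rq q0 qb.
move: kE kE'; rewrite Hq0 !mulr0 subr0 => kE kE'.
have [[z1 z12 z2] E] := oz; have [[z1' z12' z2'] E'] := oz'.
have le2 := wait_le hA (le_trans z1 z12) (ltW zz) z2'.
(* The later departure is advanced to z.2, which must not be a gain. If the entrance z'.1 comes
   after z.2 it is advanced too, and the strict increase of [arrival] gives a contradiction. *)
have [c|c] := leP z'.1 z.2.
  have Dw : triangle P (z'.1, z.2) by split.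
  have : uvalue P A x t <= jcost P A x t (z'.1, z.2).
    by rewrite /uvalue ge_min (ujunction_le hP hA _ _ Dw) orbT.
  by rewrite -E' /jcost /= -kE -kE' => h; apply/eqP; rewrite eq_le le2/=; lra.
have Dw : triangle P (z.2, z.2) by split => //=; exact: le_trans z12.
have : uvalue P A x t <= jcost P A x t (z.2, z.2).
  by rewrite /uvalue ge_min (ujunction_le hP hA _ _ Dw) orbT.
have := arrival_lt hP (le_trans z1 z12) c.
have := wait_le hA z1' z12' z2'.
rewrite -E' /jcost /= -kE -kE' => *; lra.
Qed.

(** For a common slope q inside (- r, 0), the relations x = (t - z.2) H'(q) and x - y = t H'(q) give
    y = - z.2 H'(q), which is not strictly on the side of x. For q = 0 or q = - r the kernels are
    linear in space and optimality yields u0 0 <= u0 y - q y, against the strict slope bounds of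
    u0. *)
Lemma direct_excludes_junction y z :
  strict_side (0 < x) y -> u0 P y + KS (0 < x) (x - y) t = uvalue P A x t ->
  optimal_times x t z -> z.2 < t -> False.
Proof.
move=> sy Ey oz zt; have hH := side_ham hP (0 < x).
have [q Hq] := differentiable_slope hP hA x0 t0 tT hd.
have aq := Hq _ _ (optimal_times_stretch oz); have {}aq := aq ltac:(lra).
have aq' : argS (0 < x) (x - y) t q.
  by apply: Hq (ltW t0); left; exists y; split => //; exact: strict_sideW.
have [rq q0 kE] := aq; have [_ _ kE'] := aq'.
have [[z1 z12 z2] E] := oz.
have xy : 0 < x * y.
  move: sy; rewrite /strict_side; case: ltP => c y0; first by rewrite mulr_gt0.
  by rewrite nmulr_rgt0// lt_neqAle x0.
have [/andP[rq' q0']|qb] := boolP ((- sideR P (0 < x) < q) && (q < 0)).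
  have e1 := kargmax_interior hH aq rq' q0'; have e2 := kargmax_interior hH aq' rq' q0'.
  set h := derive1 _ _ in e1 e2.
  have yE : y = - (z.2 * h) by lra.
  have : x * y = - ((t - z.2) * z.2 * h ^+ 2) by rewrite yE e1; ring.
  have : 0 <= (t - z.2) * z.2 * h ^+ 2.
    apply: mulr_ge0; last exact: sqr_ge0.
    by apply: mulr_ge0; [rewrite subr_ge0 ltW|exact: le_trans z12].
  lra.
have Hq0 := ham_eq0 hH rq q0 qb.
move: kE kE'; rewrite Hq0 !mulr0 !subr0 => kE kE'.
have a0 : u0 P 0 <= arrival P z.1.
  rewrite -(arrival0 hP); have [<-//|nz] := eqVneq 0 z.1.
  by apply/ltW/(arrival_lt hP) => //; rewrite lt_neqAle nz.
have w0 := wait_le hA z1 z12 z2.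
have main : u0 P 0 <= u0 P y - y * q.
  move: E Ey; rewrite /jcost -kE -kE'; lra.
have k0 := kern_ge0 hH x (t - z.2); have kr := kern_geN hH x (t - z.2).
have r0 := ham_r hH.
have qq : q = 0 \/ q = - sideR P (0 < x).
  move: qb; rewrite negb_and -!leNgt => /orP[h|h]; [right|left]; apply/eqP; rewrite eq_le.
    by rewrite h rq.
  by rewrite h q0.
rewrite -kE in k0 kr.
have sl := @u0_sloped _ _ hP (0 < x).
case: qq => qE; move: main; rewrite qE.
  have xp : 0 < x.
    have : - sideR P (0 < x) * x <= 0 by move: kr; rewrite qE mulr0.
    rewrite mulNr oppr_le0 pmulr_rge0// => xx.
    by rewrite lt_neqAle eq_sym x0.
  have y0 : 0 < y by move: xy; rewrite pmulr_rgt0.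
  by have /andP[] := sl 0 y (halfline0 _ _) (strict_sideW sy) y0; lra.
have xn : x < 0.
  rewrite ltNge; apply/negP => xx.
  have : 0 < sideR P (0 < x) * x by rewrite mulr_gt0// lt_neqAle eq_sym x0.
  by move: k0; rewrite qE; lra.
have y0 : y < 0 by move: xy; rewrite nmulr_rgt0.
by have /andP[] := sl y 0 (strict_sideW sy) (halfline0 _ _) y0; lra.
Qed.

(* Times that are optimal without being those of a junction path are covered
   by an initial rest at cost - A0, which is optimal only if A = A0 there. *)
Lemma optimal_times_path z : optimal_times x t z -> exists eta t1 t2,
  [/\ optimal_path P A x t eta, junction_path t t1 t2 eta, t2 <= z.2,
    wait A t2 = wait A z.2 &
    t1 = z.1 \/ t1 = 0 /\ wait A z.1 = - A0 P * z.1].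
Proof.
move=> [Dz E].
have [w [Dw wt wz wle weq]] := jcost_normalize hP hA x0 t0 tT Dz.
have minz w' : triangle P w' -> uvalue P A x t <= jcost P A x t w'.
  by move=> Dw'; rewrite /uvalue ge_min (ujunction_le hP hA _ _ Dw') orbT.
have [w1 w2] : w.1 = z.1 /\ wait A w.2 = wait A z.2 by apply: weq; rewrite E minz.
have Ew : jcost P A x t w = uvalue P A x t.
  by apply/eqP; rewrite eq_le minz// andbT -E.
have [d0 d12 d2] := Dw.
have build t1 : triangle P (t1, w.2) -> jcost P A x t (t1, w.2) = uvalue P A x t ->
    t1 = 0 \/ arrival P t1 < u0 P 0 - A0 P * t1 ->
    exists eta, optimal_path P A x t eta /\ junction_path t t1 w.2 eta.
  move=> [/= a0 a1 a2] Et nd.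
  have [eta [eH ex ej ec]] := jcost_path hP hA x0 tT a0 a1 wt nd.
  by exists eta; split => //; split => //; rewrite ec Et (value_uvalue hP hA).
have [nd|dg] := ltP (arrival P w.1) (u0 P 0 - A0 P * w.1).
  have [||eta [oe je]] := build w.1 _ _ (or_intror nd).
    by case: (w) Dw.
    by case: (w) Ew.
  by exists eta, w.1, w.2; split => //; left.
have [jle jeq] := jcost_degenerate hP hA x t d0 d12 d2 dg.
have Dw0 : triangle P (0, w.2) by split => //=; exact: le_trans d12.
have Ew' : jcost P A x t (w.1, w.2) = uvalue P A x t by rewrite -Ew; case: (w).
have E0 : jcost P A x t (0, w.2) = uvalue P A x t.
  by apply/eqP; rewrite eq_le minz// andbT -Ew'.
have [eta [oe je]] := build 0 Dw0 E0 (or_introl erefl).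
exists eta, 0, w.2; split => //; right; split => //.
by rewrite -w1; apply: jeq; rewrite Ew' E0.
Qed.

Lemma extremal_no_junction gamma :
  (forall s, s \in `[0, t] -> gamma s != 0) -> optimal_path P A x t gamma ->
  forall z, ~ optimal_times x t z.
Proof.
move=> nz og z oz.
have [y [sy Ey]] := direct_path_optimal x0 t0 tT og nz.
have [eta [t1 [t2 [oe je _ _ _]]]] := optimal_times_path oz.
have [[_ _ t2t] _ _ _] := je.
exact: (direct_excludes_junction sy Ey (junction_path_optimal x0 t0 tT oe je)).
Qed.

Lemma extremal_times (le : rel R) gamma t1 t2 : reflexive le ->
  optimal_path P A x t gamma -> junction_path t t1 t2 gamma ->
  (forall eta t1' t2', optimal_path P A x t eta ->
       junction_path t t1' t2' eta -> le t1 t1' /\ t2 <= t2') ->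
  forall z, optimal_times x t z ->
  [/\ t2 <= z.2, wait A z.2 = wait A t2 &
      le t1 z.1 \/ le t1 0 /\ wait A z.1 = - A0 P * z.1].
Proof.
move=> ler og jg ext z oz.
have [eta [t1' [t2' [oe je t2z w2 t1z]]]] := optimal_times_path oz.
have [l1 l2] := ext _ _ _ oe je.
have og' := junction_path_optimal x0 t0 tT og jg.
have oe' := junction_path_optimal x0 t0 tT oe je.
have [[_ _ t2t] _ _ _] := jg; have [[_ _ t2t'] _ _ _] := je.
split; [exact: le_trans t2z| |].
  by rewrite -w2 (optimal_times_wait og' oe').
by case: t1z => [<-|[<- ?]]; [left|right].
Qed.

End differentiability_point.
End optimal_paths.

Lemma compact_sublevel (T : topologicalType) (R : realType) (D : set T)
    (f : T -> R) (c : R) : compact D -> {within D, continuous f} ->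
  compact (D `&` [set z | f z <= c]).
Proof.
move=> cD cf.
have : closed (f @^-1` [set y | y <= c] : set (subspace D)).
  by apply: (continuous_closedP _).1 => //; exact: closed_le.
move=> /closed_subspaceP[V cV VE].
rewrite (_ : D `&` _ = D `&` V); first exact: compact_closedI.
by rewrite [RHS]setIC VE setIC.
Qed.

Lemma within_opp (T : topologicalType) (R : realType) (D : set T) (f : T -> R) :
  {within D, continuous f} -> {within D, continuous (fun z => - f z)}.
Proof. by move=> cf x; apply: cvgN; exact: cf. Qed.

(** * Perturbation of the control *)

Section parametric_minimum.
Context (T : topologicalType) (R : realType) (D : set T) (f g : T -> R).
Context (V Vdir l C : R) (W : R -> R).
Context (cD : compact D) (cf : {within D, continuous f}) (cg : {within D, continuous g}).
Context (Vle : forall z, D z -> V <= f z) (VVdir : V <= Vdir).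
Context (gC : forall z, D z -> `|g z| <= C).
Context (Wle : forall th, 0 < th <= 1 -> W th <= V - th * l).
Context (Wat : forall th, 0 < th <= 1 -> W th = Vdir \/
  exists2 z, D z & W th = f z - th * g z).
Context (gl : forall z, D z -> f z = V -> g z <= l) (dl : Vdir = V -> 0 <= l).

(* Danskin: the right derivative of the minimum of f - th * g at th = 0 is the
   minimum of - g over the minimisers of f. *)
Lemma minimum_rate (eta : R) : 0 < eta ->
  exists2 th0 : R, 0 < th0 & forall th, 0 < th < th0 ->
    `|(W th - V) / th + l| <= eta.
Proof.
move=> eta0.
(* The points with a rate above l + eta form a compact set without minimisers, so they stay above V
   by a fixed amount and cannot win for small th. *)
have [ga ga0 Hga] : exists2 ga : R, 0 < ga & forall z, D z -> l + eta <= g z -> V + ga <= f z.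
  have cD' := compact_sublevel (c := - (l + eta)) cD (within_opp cg).
  have cf' : {within D `&` [set z | - g z <= - (l + eta)], continuous f}.
    by apply: continuous_subspaceW cf => z [].
  have [|ga ga0 H] := compact_strict_gap (c := V) cD' cf'.
    move=> z [Dz /=]; rewrite lerN2 => gz.
    rewrite lt_neqAle Vle// andbT; apply/eqP => E.
    by have := gl Dz (esym E); lra.
  by exists ga => // z Dz gz; apply: H; split => //=; rewrite lerN2.
(* The branch Vdir does not move with th: it is either separated from V, or tied with it, and then l
   >= 0 keeps it above V - th (l + eta). *)
have [gd gd0 Hgd] : exists2 gd : R, 0 < gd & Vdir = V \/ V + gd <= Vdir.
  move: VVdir; rewrite le_eqVlt => /predU1P[->|lt]; first by exists 1 => //; left.
  by exists (Vdir - V); [rewrite subr_gt0|right; lra].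
pose B := `|C| + `|l| + eta + 1.
have nC := normr_ge0 C; have nl := normr_ge0 l.
have nC' := ler_norm C; have nl' := ler_norm l.
have nl'' := ler_norm (- l); rewrite normrN in nl''.
have B0 : 0 < B by rewrite /B; lra.
exists (Num.min 1 (Num.min (ga / B) (gd / B))).
  by rewrite !lt_min ltr01 !divr_gt0.
move=> th; rewrite !lt_min => /and4P[th0 th1 tha thd].
have {}tha : th * B < ga by rewrite -ltr_pdivlMr.
have {}thd : th * B < gd by rewrite -ltr_pdivlMr.
have thin : 0 < th <= 1 by rewrite th0 ltW.
have up := Wle thin.
have lo : V - th * (l + eta) <= W th.
  have lB : - (th * (l + eta)) <= th * B.
    by rewrite -mulrN ler_wpM2l ?(ltW th0)// /B; lra.
  have [->|[z Dz ->]] := Wat thin.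
    have [E|E] := Hgd; last by lra.
    have : 0 <= th * (l + eta) by rewrite mulr_ge0 ?(ltW th0)// addr_ge0 ?dl// ltW.
    by rewrite E; lra.
  have [c|c] := leP (l + eta) (g z).
    have h1 := Hga _ Dz c.
    have h2 := le_trans (ler_norm _) (gC Dz).
    have h3 : th * g z - th * (l + eta) <= th * B.
      by rewrite -mulrBr ler_wpM2l ?(ltW th0)// /B; lra.
    lra.
  have h1 := Vle Dz.
  have h2 : th * g z <= th * (l + eta) by rewrite ler_wpM2l// ltW.
  lra.
rewrite (_ : (W th - V) / th + l = (W th - V + th * l) / th); last first.
  by field; rewrite gt_eqF.
rewrite normrM normfV (gtr0_norm th0) ler_pdivrMr// ler_norml; apply/andP; split; lra.
Qed.
End parametric_minimum.

(** * Extremal minimising pairs and their relation to extremal paths *)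

Section first_optimal.
Context (R : realType) (P : junction R) (hP : standing_assumptions P).
Local Notation T := (horizon P).
Local Notation KS s := (kern (sideH P s) (sideR P s)).
Context (A : R -> R) (hA : control P A).

Definition junction_argmin (x t : R) : set (R * R) :=
  [set z | triangle P z /\ jcost P A x t z = ujunction P A x t].

Definition through (x t : R) : bool := ujunction P A x t <= udirect P x t.

(** Generic in pr, so that the first and last entrances and the first departure share one proof of
    attainment and one of measurability. *)
Definition leastopt (pr : R * R -> R) (x t : R) : R :=
  inf [set pr z | z in junction_argmin x t].

Definition entry_first (x t : R) : R := leastopt fst x t.
Definition entry_last (x t : R) : R := - leastopt (fun z => - z.1) x t.
Definition leave_first (x t : R) : R := leastopt snd x t.

Lemma leastopt_attained pr x t : continuous pr ->
  exists2 z, junction_argmin x t z & leastopt pr x t = pr z /\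
    forall w, junction_argmin x t w -> pr z <= pr w.
Proof.
move=> cpr; pose B := triangle P `&` [set z | jcost P A x t z <= ujunction P A x t].
have BE : B = junction_argmin x t.
  apply/seteqP; split=> z [Dz /= E]; split => //=; last by rewrite E.
  by apply/eqP; rewrite eq_le E ujunction_le.
have cB : compact B.
  by apply: compact_sublevel; [exact: compact_triangle|exact: jcost_continuous].
have B0 : B !=set0.
  by have [z [Dz E _]] := ujunction_min hP hA x t; exists z; split => //=; rewrite E.
have cprB : {within B, continuous pr} by exact: continuous_subspaceT.
have [z zB zmin] := compact_EVT_min B0 cB cprB.
exists z; first by rewrite -BE; exact: set_mem.
have zm w : junction_argmin x t w -> pr z <= pr w.
  by rewrite -BE => Bw; apply: zmin; exact: mem_set.
split => //; apply: inf_image_eq => //.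
by rewrite -BE; exact: set_mem.
Qed.

Lemma entry_firstP x t : exists2 z, junction_argmin x t z &
  entry_first x t = z.1 /\ forall w, junction_argmin x t w -> z.1 <= w.1.
Proof. by apply: leastopt_attained => z; exact: cvg_fst. Qed.

Lemma leave_firstP x t : exists2 z, junction_argmin x t z &
  leave_first x t = z.2 /\ forall w, junction_argmin x t w -> z.2 <= w.2.
Proof. by apply: leastopt_attained => z; exact: cvg_snd. Qed.

Lemma entry_lastP x t : exists2 z, junction_argmin x t z &
  entry_last x t = z.1 /\ forall w, junction_argmin x t w -> w.1 <= z.1.
Proof.
have [|z Bz [E H]] := @leastopt_attained (fun z => - z.1) x t.
  by move=> z; apply: cvgN; exact: cvg_fst.
exists z => //; split; first by rewrite /entry_last E opprK.
by move=> w /H; rewrite lerN2.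
Qed.

Lemma entry_last_bounds x t : 0 <= entry_last x t <= T.
Proof.
have [z [[z1 z12 z2] _] [-> _]] := entry_lastP x t.
by rewrite z1 (le_trans z12).
Qed.

Lemma leave_first_lt x t : x != 0 -> 0 < t -> t <= T -> leave_first x t < t.
Proof.
move=> x0 t0 tT; have [z [Dz Ez] [-> H]] := leave_firstP x t.
have [w [Dw wt wz wle _]] := jcost_normalize hP hA x0 t0 tT Dz.
apply: le_lt_trans wt; apply: H; split => //.
by apply/eqP; rewrite eq_le (ujunction_le hP hA _ _ Dw) andbT -Ez.
Qed.

Lemma optimal_times_argmin x t z : optimal_times P A x t z ->
  through x t /\ junction_argmin x t z.
Proof.
move=> [Dz E]; have := ujunction_le hP hA x t Dz; rewrite E => h.
have uE : ujunction P A x t = uvalue P A x t.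
  by apply/eqP; rewrite eq_le h/= /uvalue ge_min lexx orbT.
split; last by split => //; rewrite uE.
by rewrite /through uE /uvalue ge_min lexx.
Qed.

Lemma argmin_optimal_times x t z : through x t ->
  junction_argmin x t z -> optimal_times P A x t z.
Proof. by move=> J [Dz E]; split => //; rewrite E /uvalue; apply/esym/min_r. Qed.

Section extremal_shape.
Context (x t : R) (x0 : x != 0) (t0 : 0 < t) (tT : t <= T).
Context (hd : differentiable (fun z : R * R => value P A z.1 z.2) (x, t)).
Local Notation J := (through x t).

Lemma no_junction gamma : (forall s, s \in `[0, t] -> gamma s != 0) ->
  optimal_path P A x t gamma -> ~~ J.
Proof.
move=> nz og; apply/negP => J; have [z Bz _] := entry_firstP x t.
exact: (extremal_no_junction hP hA x0 t0 tT hd nz og (argmin_optimal_times J Bz)).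
Qed.

(* A direct path starting at the origin is also a junction path. *)
Lemma junction_direct_start z : optimal_times P A x t z -> z.2 < t ->
  udirect P x t = uvalue P A x t -> optimal_times P A x t (0, 0).
Proof.
move=> oz zt E.
have [y [Dy _ Ey _]] := direct_min (side_ham hP (0 < x)) (@u0_sloped _ _ hP (0 < x))
    (@u0_continuous _ _ hP) (strict_sideW (strict_side0 x0)) (ltW t0).
have Ey' : u0 P y + KS (0 < x) (x - y) t = uvalue P A x t by rewrite -E /udirect Ey.
have [y0|y0] := eqVneq y 0.
  split; first by split => //=; exact: ltW (horizon_gt0 hP).
  by rewrite /jcost /= addrNK (arrival0 hP) subr0 -Ey' y0 subr0.
exfalso; apply: (direct_excludes_junction hP hA x0 t0 tT hd _ Ey' oz zt).
by move: Dy; rewrite /strict_side /halfline; case: (0 < x) => /= c;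
  rewrite lt_neqAle c ?y0// eq_sym y0.
Qed.

(* t1 is the entrance time of the extremal path; for the latest entrance it may
   differ from entry_last, but then A = A0 up to the later of the two. *)
Definition extremal_pair (t1 : R) (gamma : R -> R) :=
  [/\ J, optimal_times P A x t (t1, leave_first x t),
    forall s, 0 < s -> s < t -> gamma s = 0 <-> t1 <= s <= leave_first x t &
    forall z, optimal_times P A x t z -> wait A z.2 = wait A (leave_first x t)].

(** Every optimal pair yields an optimal path leaving no later, so the smallest departure among
    paths is the smallest one among pairs. *)
Lemma extremal_leave (le : rel R) gamma t1 t2 : reflexive le ->
  optimal_path P A x t gamma -> junction_path t t1 t2 gamma ->
  (forall eta t1' t2', optimal_path P A x t eta ->
       junction_path t t1' t2' eta -> le t1 t1' /\ t2 <= t2') ->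
  extremal_pair t1 gamma.
Proof.
move=> ler og jg ext.
have H := extremal_times hP hA x0 t0 tT hd ler og jg ext.
have og' := junction_path_optimal hP hA x0 t0 tT og jg.
have [J Bg] := optimal_times_argmin og'.
have [z Bz [Ez minz]] := leave_firstP x t.
have tE : t2 = leave_first x t.
  apply/eqP; rewrite eq_le Ez (minz _ Bg) andbT.
  by have [] := H _ (argmin_optimal_times J Bz).
rewrite /extremal_pair -tE; split => //.
  move=> s s0 st; exact (junction_path_zero x0 t0 tT og jg s0 st).
by move=> w /H[].
Qed.

(** For the earliest entrance the degenerate alternative of [extremal_times] is harmless: t1 <= 0
    lies below every entrance time. *)
Lemma path_plus_shape gamma : path_plus P A x t gamma ->
  (~~ J /\ forall s, 0 < s -> s < t -> gamma s != 0) \/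
  extremal_pair (entry_first x t) gamma.
Proof.
move=> [og [nz|[t1 [t2 [jg ext]]]]].
  left; split; first exact: no_junction nz og.
  by move=> s s0 st; apply: nz; rewrite in_itv/= !ltW.
right; have ep := extremal_leave (@lexx _ _) og jg ext.
suff -> : entry_first x t = t1 by [].
have [J og' _ _] := ep; have [_ Bg] := optimal_times_argmin og'.
have [z Bz [-> minz]] := entry_firstP x t.
apply/eqP; rewrite eq_le (minz _ Bg)/=.
have [_ _ []//] := extremal_times hP hA x0 t0 tT hd (@lexx _ _) og jg ext
  (argmin_optimal_times J Bz).
by move=> [t10 _]; apply: le_trans t10 _; have [[]] := Bz.
Qed.

(** A degenerate pair may enter later than any path. It then satisfies the equality on [wait], that
    is, A = A0 almost everywhere before its entrance, and this alternative has to be carried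
    along. *)
Lemma path_minus_shape gamma : path_minus P A x t gamma ->
  (~~ J /\ forall s, 0 < s -> s < t -> gamma s != 0) \/
  exists t1, [/\ extremal_pair t1 gamma, t1 <= entry_last x t,
    entry_last x t <= t1 \/ wait A (entry_last x t) = - A0 P * entry_last x t &
    forall z, optimal_times P A x t z -> z.1 <= t1 \/ wait A z.1 = - A0 P * z.1].
Proof.
move=> [og [nz|[t1 [t2 [jg ext]]]]].
  left; split; first exact: no_junction nz og.
  by move=> s s0 st; apply: nz; rewrite in_itv/= !ltW.
have ep := extremal_leave (le := fun a b => b <= a) (@lexx _ _) og jg ext.
right; exists t1; have [J og' _ _] := ep; have [_ Bg] := optimal_times_argmin og'.
have H z : optimal_times P A x t z -> z.1 <= t1 \/ wait A z.1 = - A0 P * z.1.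
  move=> oz; have [_ _ [|[_ ?]]] := extremal_times (le := fun a b => b <= a)
    hP hA x0 t0 tT hd (@lexx _ _) og jg ext oz; [by left|by right].
have [z Bz [zE maxz]] := entry_lastP x t.
split => //; first by rewrite zE; exact: (maxz _ Bg).
by rewrite zE; exact: H (argmin_optimal_times J Bz).
Qed.

End extremal_shape.
End first_optimal.

Section perturbation.
Context (R : realType) (P : junction R) (hP : standing_assumptions P).
Local Notation mu := (@lebesgue_measure R).
Local Notation T := (horizon P).
Context (E : set R) (mE : measurable E).

Definition occupation (s : R) : R := \int[mu]_(r in `]0, s[) (\1_E r : R).

Lemma indic_integrable a b : mu.-integrable `]a, b[ (EFin \o (\1_E : R -> R)).
Proof.
apply: (le_integrable _ _ _ (integrable_oo_cst a b 1)) => //.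
  by apply/measurable_EFinP; exact: measurable_indic.
move=> r _ /=; rewrite lee_fin normr1 indicE.
by case: (_ \in _); rewrite ?normr1 ?normr0.
Qed.

Lemma occupation_bounds a b : 0 <= a -> a <= b ->
  0 <= occupation b - occupation a <= b - a.
Proof.
move=> a0 ab; rewrite /occupation (@Rintegral_split _ _ 0 b a) ?a0//; last first.
  exact: indic_integrable.
rewrite addrAC subrr add0r; apply/andP; split.
  have := Rintegral_oo_cst 0 ab; rewrite mul0r => <-.
  apply: le_Rintegral => //; [exact: integrable_oo_cst|exact: indic_integrable].
have := Rintegral_oo_cst 1 ab; rewrite mul1r => <-.
apply: le_Rintegral => //; [exact: indic_integrable|exact: integrable_oo_cst|].
by move=> r _ /=; rewrite indicE; case: (_ \in _).
Qed.

Context (A : R -> R) (hA : control P A) (e : R).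

Definition perturbed (th : R) : R -> R := fun s => A s + th * e * \1_E s.

Context (hAe : control P (perturbed 1)).

Lemma control_perturbed th : 0 <= th <= 1 -> control P (perturbed th).
Proof.
move=> /andP[th0 th1]; have [mA bA] := hA; have [_ bAe] := hAe; split.
  apply: measurable_funD => //; apply: measurable_funM => //.
move=> s sT; have /andP[a1 a2] := bA s sT; have /andP[b1 b2] := bAe s sT.
have E1 : perturbed th s = (1 - th) * A s + th * perturbed 1 s.
  by rewrite /perturbed; ring.
rewrite E1; apply/andP; split; nra.
Qed.

Lemma wait_perturbed th s : 0 <= s -> s <= T ->
  wait (perturbed th) s = wait A s - th * e * occupation s.
Proof.
move=> s0 sT; rewrite /wait /occupation RintegralD//; first last.
- have := @integrableZl _ _ R mu _ (measurable_itv `]0, s[) (th * e) (EFin \o \1_E) (indic_integrable 0 s); exact.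
- exact: (control_integrable_oo hA (lexx 0) sT).
rewrite RintegralZl//; first by ring.
exact: indic_integrable.
Qed.

Definition occupied (z : R * R) : R := e * (occupation z.2 - occupation z.1).

Lemma jcost_perturbed th x t z : triangle P z ->
  jcost P (perturbed th) x t z = jcost P A x t z - th * occupied z.
Proof.
move=> [z1 z12 z2]; rewrite /jcost /occupied !wait_perturbed//; first by ring.
  exact: le_trans z12.
exact: le_trans z12 z2.
Qed.

Lemma occupied_le z : triangle P z -> `|occupied z| <= `|e| * T.
Proof.
move=> [z1 z12 z2]; rewrite /occupied normrM ler_wpM2l//.
have /andP[h1 h2] := occupation_bounds z1 z12.
by rewrite ger0_norm//; lra.
Qed.

Lemma occupied_continuous : {within triangle P, continuous occupied}.
Proof.
apply: (@lipschitz2_continuous _ _ _ (`|e| + 1)); first by rewrite ltr_wpDl.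
have occ_lip a b : 0 <= a -> 0 <= b -> `|occupation a - occupation b| <= `|a - b|.
  move=> a0 b0; have [ab|/ltW ba] := leP a b.
    have /andP[h1 h2] := occupation_bounds a0 ab.
    by rewrite distrC ger0_norm// distrC ger0_norm// subr_ge0.
  have /andP[h1 h2] := occupation_bounds b0 ba.
  by rewrite ger0_norm// ger0_norm// subr_ge0.
move=> z w [z1 z12 _] [w1 w12 _]; rewrite /occupied -mulrBr normrM.
have l1 := occ_lip _ _ z1 w1.
have l2 := occ_lip _ _ (le_trans z1 z12) (le_trans w1 w12).
have -> : occupation z.2 - occupation z.1 - (occupation w.2 - occupation w.1) =
  occupation z.2 - occupation w.2 - (occupation z.1 - occupation w.1) by ring.
apply: le_trans (ler_wpM2l (normr_ge0 e) (ler_normB _ _)) _.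
have n0 := normr_ge0 e; have n1 := normr_ge0 (z.1 - w.1); have n2 := normr_ge0 (z.2 - w.2).
nra.
Qed.

(** Linear in th and uniform in (x, t): this dominates the difference quotients. *)
Lemma uvalue_perturbed_le th x t : 0 <= th <= 1 ->
  `|uvalue P (perturbed th) x t - uvalue P A x t| <= th * (`|e| * T).
Proof.
move=> thin; have hth := control_perturbed thin; have /andP[th0 _] := thin.
have M0 : 0 <= th * (`|e| * T) by rewrite !mulr_ge0// ltW// (horizon_gt0 hP).
have u1 : ujunction P (perturbed th) x t <= ujunction P A x t + th * (`|e| * T).
  have [z [Dz -> _]] := ujunction_min hP hA x t.
  apply: le_trans (ujunction_le hP hth x t Dz) _; rewrite jcost_perturbed// lerD2l.
  rewrite -mulrN ler_wpM2l//; apply: le_trans (ler_norm _) _.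
  by rewrite normrN occupied_le.
have u2 : ujunction P A x t <= ujunction P (perturbed th) x t + th * (`|e| * T).
  have [z [Dz -> _]] := ujunction_min hP hth x t.
  apply: le_trans (ujunction_le hP hA x t Dz) _; rewrite jcost_perturbed//.
  have : th * occupied z <= th * (`|e| * T).
    rewrite ler_wpM2l//; apply: le_trans (ler_norm _) _; exact: occupied_le.
  lra.
rewrite /uvalue; case: (leP (udirect P x t)) => c1; case: (leP (udirect P x t)) => c2;
  rewrite ler_norml; apply/andP; split; lra.
Qed.

Lemma uvalue_rate x t t1 :
  (through P A x t ->
     [/\ optimal_times P A x t (t1, leave_first P A x t),
       forall z, optimal_times P A x t z -> occupied z <= occupied (t1, leave_first P A x t) &
       udirect P x t = uvalue P A x t -> 0 <= occupied (t1, leave_first P A x t)]) ->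
  forall eta, 0 < eta -> exists2 th0 : R, 0 < th0 & forall th, 0 < th < th0 ->
    `|(uvalue P (perturbed th) x t - uvalue P A x t) / th +
      (through P A x t)%:R * occupied (t1, leave_first P A x t)| <= eta.
Proof.
move=> HJ.
have cont th : 0 < th <= 1 -> control P (perturbed th).
  by move=> /andP[h1 h2]; apply: control_perturbed; rewrite ltW.
apply: (minimum_rate (D := triangle P) (f := jcost P A x t) (g := occupied)
  (Vdir := udirect P x t) (C := `|e| * T) (W := fun th => uvalue P (perturbed th) x t)).
- exact: compact_triangle.
- exact: jcost_continuous.
- exact: occupied_continuous.
- by move=> z Dz; rewrite /uvalue ge_min (ujunction_le hP hA _ _ Dz) orbT.
- by rewrite /uvalue ge_min lexx.
- exact: occupied_le.
- move=> th thin; have [J|J] := boolP (through P A x t).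
    have [[Dz Ez] _ _] := HJ J; rewrite mul1r -Ez.
    rewrite /uvalue ge_min; apply/orP; right.
    by rewrite -jcost_perturbed//; apply: ujunction_le => //; exact: cont.
  rewrite mul0r mulr0 subr0 /uvalue ge_min; apply/orP; left.
  by rewrite le_min lexx/= ltW// ltNge.
- move=> th thin; rewrite /uvalue.
  case: (leP (udirect P x t)) => c; first by left.
  have [z [Dz -> _]] := ujunction_min hP (cont _ thin) x t.
  by right; exists z => //; rewrite jcost_perturbed.
- move=> z Dz Ez; have oz : optimal_times P A x t z by [].
  have [J _] := optimal_times_argmin hP hA oz; have [_ H _] := HJ J.
  by rewrite J mul1r; exact: H.
- move=> Ed; have [J|J] := boolP (through P A x t); last by rewrite mul0r.
  by have [_ _] := HJ J => /(_ Ed); rewrite mul1r.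
Qed.

End perturbation.

(** * Measurability and iterated integrals *)

Section plane_measurability.
Context (R : realType).
Local Notation plane := (measurableTypeR R * measurableTypeR R)%type.

Lemma open_plane_measurable (O : set (R * R)) : open O -> measurable (O : set plane).
Proof.
move=> oO.
pose box (q : rat * rat * (rat * rat)) : set plane :=
  `]ratr q.1.1, ratr q.1.2[%classic `*` `]ratr q.2.1, ratr q.2.2[%classic.
have -> : O = \bigcup_(q in [set q | box q `<=` O]) box q.
  apply/seteqP; split=> [z Oz|z [q /= qO /qO//]].
  have := open_nbhs_nbhs (conj oO Oz) => /nbhs_ballP[d /= d0 Hd].
  have rb (a : R) : exists p : rat * rat, ratr p.1 < a /\ a < ratr p.2 /\
      a - d < ratr p.1 /\ ratr p.2 < a + d.
    have h1 : a - d < a by rewrite ltrBlDr ltrDl.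
    have h2 : a < a + d by rewrite ltrDl.
    have [p /andP[p1 p2]] := rat_in_itvoo h1; have [q /andP[q1 q2]] := rat_in_itvoo h2.
    by exists (p, q).
  have [p [p1 [p2 [p3 p4]]]] := rb z.1; have [q [q1 [q2 [q3 q4]]]] := rb z.2.
  exists (p, q) => /=; last by split => /=; rewrite in_itv/= ?p1 ?q1.
  move=> w [/=]; rewrite !in_itv/= => /andP[w1 w2] /andP[w3 w4].
  apply: Hd; split; rewrite -ball_normE /= ltr_norml; apply/andP; split; lra.
rewrite bigcup_mkcond; apply: countable_bigcupT_measurable => // q.
by case: ifP => // _; exact: measurableX.
Qed.

Lemma plane_continuous_measurable (D : set (R * R)) (f : R * R -> R) :
  measurable (D : set plane) -> {within D, continuous f} ->
  measurable_fun (D : set plane) f.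
Proof.
move=> mD /continuousP cf; apply: (measurability _ (RGenOpens.measurableE R)).
move=> _ [_ [a [b ->] <-]].
have /cf/open_subspaceP[V oV VD] : open (`]a, b[%classic : set R) by exact: interval_open.
rewrite setIC -VD; apply: measurableI => //; exact: open_plane_measurable.
Qed.
End plane_measurability.

(** * Iterated integrals of bounded functions supported in a box of finite measure *)

Section real_fubini.
Context d1 d2 (T1 : measurableType d1) (T2 : measurableType d2) (R : realType).
Context (m1 : {sigma_finite_measure set T1 -> \bar R}).
Context (m2 : {sigma_finite_measure set T2 -> \bar R}).
Context (S1 : set T1) (S2 : set T2) (C : R).
Context (mS1 : measurable S1) (mS2 : measurable S2).
Context (f1 : (m1 S1 < +oo)%E) (f2 : (m2 S2 < +oo)%E).
Context (h : T1 * T2 -> R) (mh : measurable_fun setT h).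
Context (hC : forall x y, `|h (x, y)| <= C * \1_S1 x * \1_S2 y).

Lemma bounded_support_integrable d (T : measurableType d)
    (m : {measure set T -> \bar R}) (S : set T) (k : T -> R) (K : R) :
  measurable S -> (m S < +oo)%E -> measurable_fun setT k ->
  (forall x, `|k x| <= K * \1_S x) -> m.-integrable setT (EFin \o k).
Proof.
move=> mS fS mk kK.
apply: (le_integrable _ _ _ (g := fun x => (K%:E * (\1_S x)%:E)%E)) => //.
- exact/measurable_EFinP.
- move=> x _; rewrite -EFinM; change (`|(k x)%:E| <= `|(K * \1_S x)%:E|)%E; rewrite !abse_EFin lee_fin; apply: le_trans (kK x) _; exact: ler_norm.
- apply: integrableZl => //; apply/integrableP; split.
    by apply/measurable_EFinP; exact: measurable_indic.
  under eq_integral do rewrite gee0_abs ?lee_fin//.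
  by rewrite integral_indic// setIT.
Qed.

Lemma section2_integrable x : m2.-integrable setT (EFin \o (fun y => h (x, y))).
Proof.
apply: (@bounded_support_integrable _ _ _ S2 _ (C * \1_S1 x)) => //.
exact: measurableT_comp mh (measurable_pair1 x).
Qed.

Lemma section1_integrable y : m1.-integrable setT (EFin \o (fun x => h (x, y))).
Proof.
apply: (@bounded_support_integrable _ _ _ S1 _ (C * \1_S2 y)) => //.
  exact: measurableT_comp mh (measurable_pair2 y).
by move=> x; rewrite mulrAC.
Qed.

Lemma product_integrable : (m1 \x m2)%E.-integrable setT (EFin \o h).
Proof.
apply: (@bounded_support_integrable _ _ (m1 \x m2)%E (S1 `*` S2) _ C) => //.
- exact: measurableX.
- have := product_measure1E m1 m2 mS1 mS2; rewrite /= => ->.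
  by rewrite lte_mul_pinfty// ge0_fin_numE.
- move=> [x y]; apply: le_trans (hC x y) _; rewrite -mulrA.
  by rewrite !indicE in_setX; do 2!case: (_ \in _); rewrite /= ?mulr1 ?mulr0.
Qed.

Lemma section2_fin x : (\int[m2]_y h (x, y))%:E = (\int[m2]_y (h (x, y))%:E)%E.
Proof.
by rewrite fineK//; apply: integrable_fin_num => //; exact: section2_integrable.
Qed.

Lemma section1_fin y : (\int[m1]_x h (x, y))%:E = (\int[m1]_x (h (x, y))%:E)%E.
Proof.
by rewrite fineK//; apply: integrable_fin_num => //; exact: section1_integrable.
Qed.

Lemma Rintegral_iterated12 :
  \int[m1]_x \int[m2]_y h (x, y) = \int[(m1 \x m2)%E]_z h z.
Proof.
rewrite /Rintegral; congr fine; under eq_integral do rewrite section2_fin.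
exact: (integral12_prod_meas1 product_integrable).
Qed.

Lemma Rintegral_iterated21 :
  \int[m2]_y \int[m1]_x h (x, y) = \int[(m1 \x m2)%E]_z h z.
Proof.
rewrite /Rintegral; congr fine; under eq_integral do rewrite section1_fin.
exact: (integral21_prod_meas1 product_integrable).
Qed.

Lemma section_integral_measurable2 : measurable_fun setT (fun y => \int[m1]_x h (x, y)).
Proof.
apply/measurable_EFinP.
rewrite (_ : _ \o _ = fun y => (\int[m1]_x (h (x, y))%:E)%E); last first.
  by apply/funext => y /=; rewrite section1_fin.
exact: (measurable_fubini_G product_integrable).
Qed.

Lemma section_integral_measurable1 : measurable_fun setT (fun x => \int[m2]_y h (x, y)).
Proof.
apply/measurable_EFinP.
rewrite (_ : _ \o _ = fun x => (\int[m2]_y (h (x, y))%:E)%E); last first.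
  by apply/funext => x /=; rewrite section2_fin.
exact: (measurable_fubini_F product_integrable).
Qed.

Lemma Rintegral_support_bound d (T : measurableType d)
    (m : {measure set T -> \bar R}) (S : set T) (k : T -> R) (K : R) :
  measurable S -> (m S < +oo)%E -> measurable_fun setT k -> 0 <= K ->
  (forall x, `|k x| <= K * \1_S x) -> `|\int[m]_x k x| <= K * fine (m S).
Proof.
move=> mS fS mk K0 kK; have ik := bounded_support_integrable mS fS mk kK.
apply: le_trans (le_normr_Rintegral _ ik) _ => //.
have -> : K * fine (m S) = \int[m]_x (K * \1_S x).
  rewrite RintegralZl//; last first.
    by apply: (@bounded_support_integrable _ _ _ S _ 1) => // x; rewrite mul1r ger0_norm.
  by rewrite /Rintegral integral_indic// setIT.
apply: le_Rintegral => //; first exact: (integrable_abse ik).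
apply: (@bounded_support_integrable _ _ _ S _ K) => //.
  exact: measurable_funM.
by move=> x; rewrite ger0_norm// mulr_ge0.
Qed.

Lemma section_integral_bound1 x : 0 <= C ->
  `|\int[m2]_y h (x, y)| <= C * fine (m2 S2) * \1_S1 x.
Proof.
move=> C0; rewrite mulrAC; apply: Rintegral_support_bound => //.
- exact: measurableT_comp mh (measurable_pair1 x).
- exact: mulr_ge0.
Qed.

Lemma section_integral_bound2 y : 0 <= C ->
  `|\int[m1]_x h (x, y)| <= C * fine (m1 S1) * \1_S2 y.
Proof.
move=> C0; rewrite mulrAC; apply: Rintegral_support_bound => //.
- exact: measurableT_comp mh (measurable_pair2 y).
- exact: mulr_ge0.
- by move=> x; rewrite mulrAC.
Qed.

End real_fubini.

Lemma sublevel_measurable d (T : measurableType d) (R : realType) (f : T -> R) :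
  (forall c, measurable [set x | f x <= c]) -> measurable_fun setT f.
Proof.
move=> mf; apply: (measurability _ (RGenOInfty.measurableE R)).
move=> _ [_ [a ->] <-]; rewrite setTI.
rewrite (_ : _ @^-1` _ = ~` [set x | f x <= a]); first exact: measurableC.
by apply/seteqP; split=> x /=; rewrite in_itv/= andbT ltNge => /negP.
Qed.

Section value_measurability.
Context (R : realType) (P : junction R) (hP : standing_assumptions P).
Local Notation T := (horizon P).
Local Notation KS s := (kern (sideH P s) (sideR P s)).
Local Notation plane := (measurableTypeR R * measurableTypeR R)%type.

Lemma lipschitz_plane_measurable (f : R * R -> R) (L : R) : 0 < L ->
  (forall z w, `|f z - f w| <= L * (`|z.1 - w.1| + `|z.2 - w.2|)) ->
  measurable_fun (setT : set plane) f.
Proof.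
move=> L0 fL; apply: plane_continuous_measurable; first exact: measurableT.
by apply: (lipschitz2_continuous L0) => z w _ _.
Qed.

Lemma measurable_side : measurable_fun (setT : set plane) (fun z : plane => (0 : R) < z.2).
Proof. by apply: measurable_fun_ltr => //; exact: measurable_snd. Qed.

Lemma measurable_side_fun (g : bool -> plane -> R) :
  (forall s, measurable_fun setT (g s)) ->
  measurable_fun setT (fun z : plane => g ((0 : R) < z.2) z).
Proof.
move=> mg; rewrite (_ : (fun z => _) = fun z : plane => if (0 : R) < z.2 then g true z else g false z).
  by apply: measurable_fun_ifT => //; exact: measurable_side.
by apply/funext => z; case: ifP.
Qed.

(** The Lipschitz estimates for the direct branch require nonnegative times; truncating the time
    gives functions defined on the whole plane. *)
Definition forward (z : plane) : plane := (Num.max z.1 0, z.2).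

Lemma measurable_forward : measurable_fun setT forward.
Proof.
apply: measurable_fun_pair; last exact: measurable_snd.
by apply: measurable_maxr => //; exact: measurable_fst.
Qed.

Lemma max_lipschitz (a b c : R) : `|Num.max a c - Num.max b c| <= `|a - b|.
Proof.
have [ac|ac] := leP a c; have [bc|bc] := leP b c.
- by rewrite subrr normr0.
- by rewrite distrC gtr0_norm ?subr_gt0//; have := ler_norm (- (a - b)); rewrite normrN; lra.
- by rewrite gtr0_norm ?subr_gt0//; have := ler_norm (a - b); lra.
- by [].
Qed.

Lemma min_lipschitz (a b c : R) : `|Num.min a c - Num.min b c| <= `|a - b|.
Proof.
have [ac|ac] := leP a c; have [bc|bc] := leP b c.
- by [].
- by rewrite distrC ger0_norm ?subr_ge0//; have := ler_norm (- (a - b)); rewrite normrN; lra.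
- by rewrite ger0_norm ?subr_ge0//; have := ler_norm (a - b); lra.
- by rewrite subrr normr0.
Qed.

Lemma udirect_measurable :
  measurable_fun setT (fun z : plane => udirect P z.2 (Num.max z.1 0)).
Proof.
(* Projecting x on the half-line s gives, for each fixed s, a Lipschitz function of the plane, and
   changes nothing when s is the side of x. *)
pose cl (s : bool) (x : R) := if s then Num.max x 0 else Num.min x 0.
rewrite (_ : (fun z => _) = fun z : plane => direct (sideH P (0 < z.2)) (sideR P (0 < z.2))
    (u0 P) (0 < z.2) (cl (0 < z.2) z.2) (Num.max z.1 0)); last first.
  apply/funext => z; rewrite /udirect /cl; have [c|c] := ltP 0 z.2.
    by [].
  by [].
apply: (@measurable_side_fun (fun s z => direct (sideH P s) (sideR P s)
    (u0 P) s (cl s z.2) (Num.max z.1 0))) => s.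
have hH := side_ham hP s.
have r0 := ham_r hH; have l0 := kern_lip_gt0 hH.
apply: (@lipschitz_plane_measurable _ (sideR P s + kern_lip (sideH P s))).
  exact: addr_gt0.
move=> z w.
have Dcl x : @halfline R s (cl s x).
  by rewrite /halfline /cl; case: s {hH r0 l0}; rewrite /= ?le_max ?ge_min lexx orbT.
have m0 a : (0 : R) <= Num.max a 0 by rewrite le_max lexx orbT.
apply: le_trans (direct_lipschitz hH (@u0_sloped _ _ hP s) (@u0_continuous _ _ hP)
  (Dcl _) (Dcl _) (m0 _) (m0 _)) _.
have h1 : `|cl s z.2 - cl s w.2| <= `|z.2 - w.2|.
  by rewrite /cl; case: s {hH r0 l0 Dcl}; [exact: max_lipschitz|exact: min_lipschitz].
have h2 := max_lipschitz z.1 w.1 0.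
have n1 := normr_ge0 (z.1 - w.1); have n2 := normr_ge0 (z.2 - w.2).
have := ler_wpM2l (ltW r0) h1; have := ler_wpM2l (ltW l0) h2.
have := mulr_ge0 (ltW r0) n1; have := mulr_ge0 (ltW l0) n2; lra.
Qed.

Context (A : R -> R) (hA : control P A).

Definition jcost_on (D : set (R * R)) (x t : R) : R :=
  inf [set jcost P A x t z | z in D].

Lemma jcost_ge x t z : triangle P z -> u0 P 0 <= jcost P A x t z.
Proof.
move=> [z1 z12 z2]; have := wait_le hA z1 z12 z2.
have := kern_ge0 (side_ham hP (0 < x)) x (t - z.2).
have : u0 P 0 <= arrival P z.1.
  rewrite -(arrival0 hP); have [<-//|nz] := eqVneq 0 z.1.
  by apply/ltW/(arrival_lt hP) => //; rewrite lt_neqAle nz.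
rewrite /jcost; lra.
Qed.

Lemma jcost_on_measurable D : D `<=` triangle P -> D !=set0 ->
  measurable_fun setT (fun z : plane => jcost_on D z.2 z.1).
Proof.
move=> Dt D0.
apply: (@measurable_side_fun (fun s z => inf [set arrival P w.1 - wait A w.1 + wait A w.2
  + KS s z.2 (z.1 - w.2) | w in D])) => s.
have hH := side_ham hP s; have r0 := ham_r hH; have l0 := kern_lip_gt0 hH.
apply: (@lipschitz_plane_measurable _ (sideR P s + kern_lip (sideH P s))).
  exact: addr_gt0.
pose F (z w : R * R) := arrival P w.1 - wait A w.1 + wait A w.2 + KS s z.2 (z.1 - w.2).
have lo z w : D w -> u0 P 0 <= F z w.
  move=> /Dt[w1 w12 w2]; have := wait_le hA w1 w12 w2.
  have := kern_ge0 hH z.2 (z.1 - w.2).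
  have : u0 P 0 <= arrival P w.1.
    rewrite -(arrival0 hP); have [<-//|nz] := eqVneq 0 w.1.
    by apply/ltW/(arrival_lt hP) => //; rewrite lt_neqAle nz.
  rewrite /F; lra.
have half z z' : inf [set F z w | w in D] <= inf [set F z' w | w in D] +
    (sideR P s + kern_lip (sideH P s)) * (`|z.1 - z'.1| + `|z.2 - z'.2|).
  rewrite -lerBlDr; apply: lb_le_inf; first by case: D0 => w Dw; exists (F z' w), w.
  move=> _ [w Dw <-]; rewrite lerBlDr.
  apply: le_trans (inf_image_le (lo z) Dw) _.
  have := kern_lipschitz hH z.2 (z.1 - w.2) z'.2 (z'.1 - w.2).
  rewrite (_ : z.1 - w.2 - (z'.1 - w.2) = z.1 - z'.1); last by ring.
  rewrite ler_norml => /andP[_]; rewrite /F.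
  have n1 := normr_ge0 (z.1 - z'.1); have n2 := normr_ge0 (z.2 - z'.2).
  have := mulr_ge0 (ltW r0) n1; have := mulr_ge0 (ltW l0) n2; lra.
move=> z z'; have := half z z'; have := half z' z.
rewrite (distrC z'.1) (distrC z'.2) /F => h1 h2.
by rewrite ler_norml; apply/andP; split; lra.
Qed.

Lemma ujunction_measurable : measurable_fun setT (fun z : plane => ujunction P A z.2 z.1).
Proof. by apply: (@jcost_on_measurable (triangle P)) => //; exact: triangle_neq0. Qed.

Lemma ujunction_forward_measurable :
  measurable_fun setT (fun z : plane => ujunction P A z.2 (Num.max z.1 0)).
Proof. exact: measurableT_comp ujunction_measurable measurable_forward. Qed.

Lemma uvalue_measurable :
  measurable_fun setT (fun z : plane => uvalue P A z.2 (Num.max z.1 0)).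
Proof.
apply: measurable_minr; [exact: udirect_measurable|exact: ujunction_forward_measurable].
Qed.

Lemma through_measurable :
  measurable_fun setT (fun z : plane => through P A z.2 (Num.max z.1 0)).
Proof.
apply: measurable_fun_ler; [exact: ujunction_forward_measurable|exact: udirect_measurable].
Qed.

(** Some minimiser satisfies pr <= c exactly when minimising over the compact part pr <= c loses
    nothing. Sublevels of [leastopt] thus become comparisons of two measurable functions, in place
    of a measurable selection. *)
Lemma leastopt_le pr c x t : continuous pr ->
  leastopt P A pr x t <= c <->
  (exists2 z, triangle P z & pr z <= c) /\
  jcost_on (triangle P `&` [set z | pr z <= c]) x t <= ujunction P A x t.
Proof.
move=> cpr; have [z [Dz Ez] [E H]] := leastopt_attained hP hA x t cpr.
split=> [|[D0 le]].
  rewrite E => zc; split; first by exists z.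
  rewrite -Ez; apply: (@inf_image_le _ _ _ _ (u0 P 0)) => //.
  by move=> w [Dw _]; exact: jcost_ge.
pose D := triangle P `&` [set z | pr z <= c].
have cD : compact D.
  by apply: compact_sublevel; [exact: compact_triangle|exact: continuous_subspaceT].
have cj : {within D, continuous (jcost P A x t)}.
  have := @jcost_continuous _ _ hP _ hA x t.
  by apply: continuous_subspaceW => w [].
have D1 : D !=set0 by have [w] := D0; exists w.
have [w wD wmin] := compact_EVT_min D1 cD cj.
have [Dw wc] : D w by exact: set_mem.
have wE : jcost P A x t w = ujunction P A x t.
  apply/eqP; rewrite eq_le (ujunction_le hP hA _ _ Dw) andbT.
  apply: le_trans le; apply: lb_le_inf; first by exists (jcost P A x t w), w.
  by move=> _ [v Dv <-]; apply: wmin; exact: mem_set.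
by rewrite E; apply: le_trans (H _ _) wc.
Qed.

Lemma leastopt_measurable pr : continuous pr ->
  measurable_fun setT (fun z : plane => leastopt P A pr z.2 z.1).
Proof.
move=> cpr; apply: sublevel_measurable => c.
have [D0|D0] := pselect (exists2 z, triangle P z & pr z <= c); last first.
  rewrite (_ : [set _ | _] = set0); first exact: measurable0.
  by apply/seteqP; split=> // z /= /(leastopt_le _ _ _ cpr)[].
rewrite (_ : [set _ | _] = setT `&` [set z : plane |
    jcost_on (triangle P `&` [set z | pr z <= c]) z.2 z.1 <= ujunction P A z.2 z.1]).
  apply: measurable_fun_le => //; last exact: ujunction_measurable.
  by apply: jcost_on_measurable; [move=> z []|have [z] := D0; exists z].
by rewrite setTI; apply/seteqP; split=> z /=; [move=> /(leastopt_le _ _ _ cpr)[]|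
  move=> h; apply/(leastopt_le _ _ _ cpr)].
Qed.

Lemma entry_first_measurable :
  measurable_fun setT (fun z : plane => entry_first P A z.2 (Num.max z.1 0)).
Proof.
apply: (measurableT_comp _ measurable_forward (f := fun z : plane => entry_first P A z.2 z.1)).
by apply: leastopt_measurable => z; exact: cvg_fst.
Qed.

Lemma leave_first_measurable :
  measurable_fun setT (fun z : plane => leave_first P A z.2 (Num.max z.1 0)).
Proof.
apply: (measurableT_comp _ measurable_forward (f := fun z : plane => leave_first P A z.2 z.1)).
by apply: leastopt_measurable => z; exact: cvg_snd.
Qed.

Lemma entry_last_measurable :
  measurable_fun setT (fun z : plane => entry_last P A z.2 (Num.max z.1 0)).
Proof.
apply: (measurableT_comp _ measurable_forward (f := fun z : plane => entry_last P A z.2 z.1)).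
apply: measurable_funN.
by apply: leastopt_measurable => z; apply: cvgN; exact: cvg_fst.
Qed.

End value_measurability.

(** * First variation of the cost *)

Section convex_C1.
Context (R : realType) (f : R -> R) (a b : R) (ab : a < b).
Context (f_convex : @convex_function R R^o `[a, b] f) (f_C1 : C1_on `[a, b] f).
Local Notation df := (derive_within `[a, b] f).

Lemma convex_segment x y l : a <= x <= b -> a <= y <= b -> 0 <= l <= 1 ->
  f (x + l * (y - x)) <= f x + l * (f y - f x).
Proof.
move=> xab yab /andP[l0 l1].
have := f_convex (Itv01 l0 l1) (x := y) (y := x).
rewrite !inE/= !in_itv/= => /(_ yab xab).
move=> h; have {h} : f (l * y + (1 - l) * x) <= l * f y + (1 - l) * f x := h.
rewrite (_ : l * y + (1 - l) * x = x + l * (y - x)); last by ring.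
by rewrite (_ : l * f y + (1 - l) * f x = f x + l * (f y - f x)); last by ring.
Qed.

(** The secant from x towards y lies below the chord and its slope tends to the derivative at x. The
    argument stays inside the interval, so it covers the end points, where the derivative is
    one-sided. *)
Lemma convex_tangent x y : a <= x <= b -> a <= y <= b ->
  f x + df x * (y - x) <= f y.
Proof.
move=> xab yab; have [->|xy] := eqVneq y x; first by rewrite subrr mulr0 addr0.
rewrite leNgt; apply/negP => lt.
pose g := f x + df x * (y - x) - f y.
have g0 : 0 < g by rewrite subr_gt0.
have w0 : 0 < `|y - x| by rewrite normr_gt0 subr_eq0.
have e0 : 0 < g / (2 * `|y - x|) by rewrite divr_gt0// mulr_gt0.
have := f_C1.1 x; rewrite /= in_itv/= => /(_ xab)/cvgrPdist_le/(_ _ e0).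
rewrite -/(df x) => -[d /= d0 Hd].
pose m := Num.min d `|y - x| / 2.
have m1 : 0 < Num.min d `|y - x| by rewrite lt_min d0.
have mm : 2 * m = Num.min d `|y - x| by rewrite /m; field.
have m0 : 0 < m by rewrite divr_gt0.
have md : 2 * m <= d by rewrite mm ge_min lexx.
have mw : 2 * m <= `|y - x| by rewrite mm ge_min lexx orbT.
pose l := m / `|y - x|.
have l0 : 0 < l by rewrite divr_gt0.
have l1 : l <= 1 by rewrite ler_pdivrMr// mul1r; lra.
have lw : `|l * (y - x)| = m by rewrite normrM (gtr0_norm l0) divfK// gt_eqF.
have zab : a <= x + l * (y - x) <= b.
  by move: xab yab => /andP[h1 h2] /andP[h3 h4]; apply/andP; split; nra.
have lyx : l * (y - x) != 0 by apply: mulf_neq0; [rewrite gt_eqF|rewrite subr_eq0].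
have := Hd (x + l * (y - x)); rewrite /ball_ /=.
have -> : x + l * (y - x) - x = l * (y - x) by ring.
have -> : x - (x + l * (y - x)) = - (l * (y - x)) by ring.
rewrite normrN lw.
have ne : x + l * (y - x) != x by rewrite -subr_eq0 addrC addKr.
move=> /(_ _ ne); rewrite in_itv/= => /(_ _ zab).
have seg := convex_segment xab yab (introT andP (conj (ltW l0) l1)).
move=> /(_ ltac:(lra)).
set q := (_ / _) => Hq.
have qE : q * (l * (y - x)) = f (x + l * (y - x)) - f x by rewrite /q divfK.
have q1 : q * (y - x) <= f y - f x.
  by rewrite -(ler_pM2l l0); nra.
have := ler_wpM2r (ltW w0) Hq; rewrite -normrM.
have -> : g / (2 * `|y - x|) * `|y - x| = g / 2 by field; rewrite gt_eqF.
rewrite ler_norml => /andP[_].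
by rewrite /g in g0 *; lra.
Qed.

(** Continuous on the whole line, so that its composition with a control is measurable. *)
Definition slope_ext : R -> R := df \o clamp a b.

Lemma slope_ext_continuous : continuous slope_ext.
Proof. by apply: clamp_continuous; [exact: ltW|exact: f_C1.2]. Qed.

Lemma slope_extE x : a <= x <= b -> slope_ext x = df x.
Proof. by move=> xab; rewrite /slope_ext /= clamp_id. Qed.

Lemma slope_ext_bounded : exists2 C : R, 0 < C & forall x, `|slope_ext x| <= C.
Proof.
have cn : {within `[a, b], continuous (fun x => `|slope_ext x|)}.
  by apply: continuous_subspaceT => x; apply: cvg_norm; exact: slope_ext_continuous.
have [c _ cmax] := EVT_max (ltW ab) cn.
exists (`|slope_ext c| + 1); first by rewrite ltr_wpDl.
move=> x; have := @clamp_in _ a b x (ltW ab) => xab.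
have := cmax (clamp a b x); rewrite in_itv/= => /(_ xab).
by rewrite /slope_ext /= (clamp_id xab) => /le_trans; apply; rewrite lerDl.
Qed.

Lemma convex_C1_lipschitz : exists2 C : R, 0 < C & forall x y,
  `|(f \o clamp a b) x - (f \o clamp a b) y| <= C * `|x - y|.
Proof.
have [C C0 HC] := slope_ext_bounded; exists C => // x y /=.
have cl := max_lipschitz (Num.min x b) (Num.min y b) a.
have {}cl : `|clamp a b x - clamp a b y| <= `|x - y|.
  rewrite /clamp maxC (maxC a); apply: le_trans cl _; exact: min_lipschitz.
have xab := @clamp_in _ a b x (ltW ab); have yab := @clamp_in _ a b y (ltW ab).
have h1 := convex_tangent xab yab; have h2 := convex_tangent yab xab.
have b1 := HC x; have b2 := HC y; rewrite /slope_ext /= in b1 b2.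
move: h1 h2 b1 b2 cl; set X := clamp a b x; set Y := clamp a b y => h1 h2 b1 b2 cl.
have k1 : `|df X * (Y - X)| <= C * `|x - y|.
  by rewrite normrM ler_pM// distrC.
have k2 : `|df Y * (X - Y)| <= C * `|x - y|.
  by rewrite normrM ler_pM.
move: k1 k2; rewrite !ler_norml => /andP[k1 k1'] /andP[k2 k2'].
by apply/andP; split; lra.
Qed.

End convex_C1.

Section real_limits.
Context d (T : measurableType d) (R : realType) (m : {measure set T -> \bar R}).

Lemma Rintegral_dominated (S : set T) (K : R) (k_ : nat -> T -> R) (k : T -> R) :
  measurable S -> (m S < +oo)%E -> (forall n, measurable_fun setT (k_ n)) ->
  measurable_fun setT k -> (forall n x, `|k_ n x| <= K * \1_S x) ->
  {ae m, forall x, k_ n x @[n --> \oo] --> k x} ->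
  \int[m]_x k_ n x @[n --> \oo] --> \int[m]_x k x.
Proof.
move=> mS fS mk_ mk kK cv.
have iK : m.-integrable setT (EFin \o (fun x => K * \1_S x)).
  apply: (bounded_support_integrable mS fS (K := `|K|)).
    exact: measurable_funM.
  by move=> x; rewrite normrM [X in _ * X]ger0_norm.
have [|||||ik _ lim] := @dominated_convergence _ _ _ m setT measurableT
  (fun n => EFin \o k_ n) (EFin \o k) (EFin \o (fun x => K * \1_S x)).
- by move=> n; apply/measurable_EFinP.
- exact/measurable_EFinP.
- by apply: filterS cv => x cx _; apply: cvg_EFin => //; exact: nearW.
- exact: iK.
- by apply: nearW => x n _ /=; rewrite lee_fin.
apply: fine_cvg; rewrite fineK; first exact: lim.
exact: integrable_fin_num ik.
Qed.
End real_limits.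

Section iterated_limits.
Context (R : realType).
Local Notation mu := (@lebesgue_measure R).
Local Notation plane := (measurableTypeR R * measurableTypeR R)%type.
Context (S1 S2 : set (measurableTypeR R)) (mS1 : measurable S1) (mS2 : measurable S2).
Context (f1 : (mu S1 < +oo)%E) (f2 : (mu S2 < +oo)%E).

(** At each t the function g t has to agree with h only for almost every x. In this way [value] and
    the path selections are replaced by measurable functions of the plane. *)
Lemma iterated_section (D : set R) (h : plane -> R) (C : R) (g : R -> R -> R) :
  measurable_fun setT h ->
  (forall x y, `|h (x, y)| <= C * \1_S1 x * \1_S2 y) ->
  (forall t, D t -> {ae mu, forall x, g t x = h (t, x)}) ->
  (forall t, ~ D t -> {ae mu, forall x, h (t, x) = 0}) ->
  \int[mu]_(t in D) \int[mu]_x g t x = \int[(mu \x mu)%E]_z h z.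
Proof.
move=> mh hC gh h0.
rewrite -(Rintegral_iterated12 mS1 mS2 f1 f2 mh hC) Rintegral_mkcond.
apply: eq_Rintegral => t _; rewrite patchE.
have [Dt|Dt] := pselect (D t).
  rewrite mem_set//; apply: ae_eq_Rintegral.
  by apply: ae_sub (gh t Dt) => x ->.
rewrite memNset//; transitivity (\int[mu]_(x in setT) (cst (0 : R) x)).
  by rewrite Rintegral_cst// mul0r.
by apply: ae_eq_Rintegral; apply: ae_sub (h0 t Dt) => x /= ->.
Qed.

(** The exceptional x form a null set for each t, but nothing is known of their union as a subset of
    the plane. Dominated convergence is therefore applied in x first and then in t. *)
Lemma iterated_limit (C : R) (h_ : nat -> plane -> R) (h : plane -> R) :
  0 <= C -> (forall n, measurable_fun setT (h_ n)) -> measurable_fun setT h ->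
  (forall n x y, `|h_ n (x, y)| <= C * \1_S1 x * \1_S2 y) ->
  (forall x y, `|h (x, y)| <= C * \1_S1 x * \1_S2 y) ->
  (forall t, S1 t -> {ae mu, forall x, h_ n (t, x) @[n --> \oo] --> h (t, x)}) ->
  \int[(mu \x mu)%E]_z h_ n z @[n --> \oo] --> \int[(mu \x mu)%E]_z h z.
Proof.
move=> C0 mh_ mh hC_ hC cv.
rewrite -(Rintegral_iterated12 mS1 mS2 f1 f2 mh hC).
under eq_fun do rewrite -(Rintegral_iterated12 mS1 mS2 f1 f2 (mh_ _) (hC_ _)).
apply: (@Rintegral_dominated _ _ _ _ S1 (C * fine (mu S2))) => //.
- by move=> n; exact: (section_integral_measurable1 mS1 mS2 f1 f2 (mh_ n) (hC_ n)).
- exact: (section_integral_measurable1 mS1 mS2 f1 f2 mh hC).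
- by move=> n t; exact: (section_integral_bound1 mS2 f2 (mh_ n) (hC_ n)).
apply: nearW => t; have [S1t|S1t] := pselect (S1 t); last first.
  have z n x : h_ n (t, x) = 0.
    by apply/eqP; rewrite -normr_le0; apply: le_trans (hC_ n t x) _; rewrite indicE memNset// mulr0 mul0r.
  have z' x : h (t, x) = 0.
    by apply/eqP; rewrite -normr_le0; apply: le_trans (hC t x) _; rewrite indicE memNset// mulr0 mul0r.
  have -> : (fun n => \int[mu]_y h_ n (t, y)) = cst (\int[mu]_y h (t, y)).
    by apply/funext => n; apply: eq_Rintegral => y _; rewrite z z'.
  exact: cvg_cst.
apply: (@Rintegral_dominated _ _ _ _ S2 (C * \1_S1 t)) => //.
- by move=> n; exact: measurableT_comp (mh_ n) (measurable_pair1 t).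
- exact: measurableT_comp mh (measurable_pair1 t).
- exact: cv.
Qed.

End iterated_limits.

Lemma closed_plane_measurable (R : realType) (D : set (R * R)) : closed D ->
  measurable (D : set (measurableTypeR R * measurableTypeR R)).
Proof. by move=> /closed_openC/open_plane_measurable/measurableC; rewrite setCK. Qed.

Section first_variation.
Context (R : realType) (P : junction R) (hP : standing_assumptions P).
Local Notation mu := (@lebesgue_measure R).
Local Notation T := (horizon P).
Local Notation plane := (measurableTypeR R * measurableTypeR R)%type.

Section weight.
Context (phi : R -> R -> R) (hphi : continuous_compact_support P phi).

(* Points of the plane are pairs (t, x), time first, contrary to phi and value. *)
Definition weight (z : plane) : R := phi z.2 z.1 * \1_(`]0, T[%classic) z.1.

Let strip : set (R * R) := [set z | z.2 \in `[0, T]].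

Lemma closed_strip : closed strip.
Proof.
have -> : strip = snd @^-1` `[0, T]%classic by [].
by apply: (continuous_closedP _).1; [move=> z; exact: cvg_snd|exact: interval_closed].
Qed.

Lemma weight_measurable : measurable_fun setT weight.
Proof.
have [cphi _] := hphi.
have ms := closed_plane_measurable closed_strip.
have := plane_continuous_measurable ms cphi.
move=> /(measurable_restrictT _ ms) m1.
pose swap (z : plane) : plane := (z.2, z.1).
have msw : measurable_fun setT swap.
  by apply: measurable_fun_pair; [exact: measurable_snd|exact: measurable_fst].
have m2 := measurableT_comp m1 msw.
have mi : measurable_fun setT (fun z : plane => \1_(`]0, T[%classic : set (measurableTypeR R)) z.1 : R).
  apply: (@measurableT_comp _ _ _ _ _ _ (\1_(`]0, T[%classic : set (measurableTypeR R)) : _ -> R)).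
    exact: measurable_indic.
  exact: measurable_fst.
rewrite (_ : weight = fun z => ((fun z : R * R => phi z.1 z.2) \_ strip \o swap) z *
    \1_(`]0, T[%classic : set (measurableTypeR R)) z.1); first exact: measurable_funM.
apply/funext => z; rewrite /weight /= patchE /=.
case: ifPn => // /negP zs; rewrite !indicE mul0r memNset ?mulr0//= in_itv/=.
by move=> /andP[z1 z2]; apply: zs; apply/mem_set; rewrite /strip /= in_itv/= !ltW.
Qed.

Lemma weight_bounded : exists B C : R, [/\ 0 < B, 0 < C & forall t x,
  `|weight (t, x)| <= C * \1_(`]0, T[%classic) t * \1_(`[- B, B]%classic) x].
Proof.
have [cphi cK] := hphi; set K := closure _ in cK.
have KS : K `<=` strip.
  by move: closed_strip => /closure_id ->; apply: closure_subset => z [].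
have [B B0 HB] : exists2 B : R, 0 < B & forall z, K z -> `|z.1| <= B /\ `|phi z.1 z.2| <= B.
  have [->|/set0P K0] := eqVneq K set0; first by exists 1.
  have c1 : {within K, continuous (fun z : R * R => `|z.1|)}.
    apply: continuous_subspaceT => z.
    by apply: (@cvg_norm _ R^o); exact: cvg_fst.
  have c2 : {within K, continuous (fun z : R * R => `|phi z.1 z.2|)}.
    have c0 := continuous_subspaceW KS cphi.
    by move=> z; apply: (@cvg_norm _ R^o); exact: c0.
  have [z1 _ m1] := compact_EVT_max K0 cK c1.
  have [z2 _ m2] := compact_EVT_max K0 cK c2.
  exists (`|z1.1| + `|phi z2.1 z2.2| + 1).
    by rewrite ltr_wpDl// addr_ge0.
  move=> z Kz; have h1 := m1 z (mem_set Kz); have h2 := m2 z (mem_set Kz).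
  have := normr_ge0 z1.1; have := normr_ge0 (phi z2.1 z2.2).
  by split; lra.
exists B, B; split => // t x; rewrite /weight /= normrM.
have [tT|tT] := boolP (t \in (`]0, T[%classic : set R)); last first.
  by rewrite !indicE (negbTE tT) normr0 mulr0 mulr0 mul0r.
rewrite !indicE tT normr1 !mulr1.
have [->|nz] := eqVneq (phi x t) 0.
  by rewrite normr0 mulr_ge0// ltW.
have Kz : K (x, t).
  apply: subset_closure; split => //=.
  by move/set_mem : tT; rewrite /= !in_itv/= => /andP[t0 tT]; rewrite !ltW.
have [h1 h2] := HB _ Kz.
by rewrite mem_set ?mulr1//= in_itv/= -ler_norml.
Qed.

End weight.

Lemma uvalue_bound A x t : control P A -> 0 <= t ->
  `|uvalue P A x t - u0 P 0| <= sideR P (0 < x) * `|x| + kern_lip (sideH P (0 < x)) * t.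
Proof.
move=> hA t0; have hH := side_ham hP (0 < x).
have r0 := ham_r hH; have l0 := kern_lip_gt0 hH.
have Dx : @halfline R (0 < x) x by rewrite /halfline; case: ltP => //= /ltW.
have := direct_lipschitz hH (@u0_sloped _ _ hP (0 < x)) (@u0_continuous _ _ hP)
  Dx (halfline0 _ _) t0 (lexx 0).
rewrite (direct0 hH (@u0_sloped _ _ hP (0 < x)) (@u0_continuous _ _ hP)) !subr0 (ger0_norm t0).
have ju : u0 P 0 <= ujunction P A x t.
  by have [z [Dz -> _]] := ujunction_min hP hA x t; exact: jcost_ge.
have m0 : 0 <= sideR P (0 < x) * `|x| + kern_lip (sideH P (0 < x)) * t.
  by rewrite addr_ge0// mulr_ge0// ltW.
rewrite -/(udirect P x t) !ler_norml => /andP[d1 d2].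
rewrite /uvalue; case: (leP (udirect P x t)) => c; apply/andP; split; lra.
Qed.

Lemma fin_oo (a b : R) : (mu `]a, b[%classic < +oo)%E.
Proof. by rewrite lebesgue_measure_itv/=; case: ifP => _; rewrite -?EFinB ltry. Qed.

Lemma fin_cc (a b : R) : (mu `[a, b]%classic < +oo)%E.
Proof. by rewrite lebesgue_measure_itv/=; case: ifP => _; rewrite -?EFinB ltry. Qed.

Lemma ae_neq0 : {ae mu, forall x : R, x != 0}.
Proof.
exists [set (0 : R)]; split => //; first exact: lebesgue_measure_set1.
by move=> x /= /negP; rewrite negbK => /eqP.
Qed.

Section cost.
Context (phi : R -> R -> R) (hphi : continuous_compact_support P phi) (f : R -> R).
Context (A : R -> R) (hA : control P A).

Definition weighted_value (z : plane) : R :=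
  weight phi z * uvalue P A z.2 (Num.max z.1 0).

Lemma weighted_value_measurable : measurable_fun setT weighted_value.
Proof.
by apply: measurable_funM; [exact: weight_measurable|exact: uvalue_measurable].
Qed.

Lemma weighted_value_bounded (B C : R) : (forall t x,
    `|weight phi (t, x)| <= C * \1_(`]0, T[%classic) t * \1_(`[- B, B]%classic) x) ->
  0 < C -> exists2 D : R, 0 < D & forall t x,
  `|weighted_value (t, x)| <= D * \1_(`]0, T[%classic) t * \1_(`[- B, B]%classic) x.
Proof.
move=> HC C0.
pose U := `|u0 P 0| + (sideR P true + sideR P false) * `|B|
  + (kern_lip (sideH P true) + kern_lip (sideH P false)) * T + 1.
have T0 := horizon_gt0 hP.
have r1 := ham_r (side_ham hP true); have r2 := ham_r (side_ham hP false).
have l1 := kern_lip_gt0 (side_ham hP true); have l2 := kern_lip_gt0 (side_ham hP false).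
have U0 : 0 < U.
  by rewrite /U ltr_wpDl// !addr_ge0// mulr_ge0// ?addr_ge0// ltW.
exists (C * U); first exact: mulr_gt0.
move=> t x; rewrite /weighted_value /= normrM.
have := HC t x; rewrite !indicE.
have [tT|_] := boolP (t \in _); last first.
  by rewrite mulr0 mul0r normr_le0 => /eqP ->; rewrite normr0 mul0r mulr0 mul0r.
have [xB|_] := boolP (x \in _); last first.
  by rewrite mulr0 normr_le0 => /eqP ->; rewrite normr0 mul0r mulr0.
rewrite !mulr1 => w1; apply: ler_pM => //.
move/set_mem : tT; rewrite /= in_itv/= => /andP[t0 tT].
move/set_mem : xB; rewrite /= in_itv/= -ler_norml => xB.
rewrite max_l; last exact: ltW.
have {}xB : `|x| <= `|B| := le_trans xB (ler_norm B).
have := uvalue_bound x hA (ltW t0).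
have : sideR P (0 < x) * `|x| <= (sideR P true + sideR P false) * `|B|.
  by apply: ler_pM => //; case: (0 < x); rewrite ?(ltW r1) ?(ltW r2)// ?lerDl ?lerDr ltW.
have : kern_lip (sideH P (0 < x)) * t <= (kern_lip (sideH P true) + kern_lip (sideH P false)) * T.
  apply: ler_pM; rewrite ?(ltW t0) ?(ltW tT)//; case: (0 < x);
    by rewrite ?(ltW l1) ?(ltW l2)// ?lerDl ?lerDr ltW.
have := ler_normD (uvalue P A x t - u0 P 0) (u0 P 0); rewrite subrK /U.
lra.
Qed.

Lemma total_costE : total_cost P phi f A =
  \int[(mu \x mu)%E]_z weighted_value z + \int[mu]_(t in `]0, T[) f (A t).
Proof.
rewrite /total_cost; congr (_ + _).
have [B [C [B0 C0 HC]]] := weight_bounded hphi.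
have [D D0 HD] := weighted_value_bounded HC C0.
apply: (iterated_section (measurable_itv `]0, T[) (measurable_itv `[- B, B]%R)
  (fin_oo 0 T) (fin_cc (- B) B) weighted_value_measurable HD).
  move=> t; rewrite /= in_itv/= => /andP[t0 tT].
  apply: ae_sub ae_neq0 => x x0; rewrite /weighted_value /weight /=.
  rewrite (value_uvalue hP hA)// ?(ltW tT)// max_l ?(ltW t0)// indicE mem_set ?mulr1//.
  by rewrite /= in_itv/= t0.
move=> t nt; apply: nearW => x.
by rewrite /weighted_value /weight /= indicE memNset// mulr0 mul0r.
Qed.

End cost.
End first_variation.

Section product_measure.
Context d1 d2 (T1 : measurableType d1) (T2 : measurableType d2) (R : realType).
Context (m1 : {sigma_finite_measure set T1 -> \bar R}).
Context (m2 : {sigma_finite_measure set T2 -> \bar R}).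

Lemma product_sigma_finite : sigma_finite setT (m1 \x m2)%E.
Proof.
have /sigma_finiteP[F [TF ndF Foo]] := sigma_finiteT m1.
have /sigma_finiteP[G [TG ndG Goo]] := sigma_finiteT m2.
exists (fun n => F n `*` G n).
  rewrite -setXTT TF TG predeqE => -[x y]; split=> [[/= [n _ Fnx] [k _ Gky]]|[n _ [/= ? ?]]].
    exists (maxn n k) => //; split.
    - by move: x Fnx; exact/subsetPset/ndF/leq_maxl.
    - by move: y Gky; exact/subsetPset/ndG/leq_maxr.
  by split; exists n.
move=> k; have [mF fF] := Foo k; have [mG fG] := Goo k.
split; first exact: measurableX.
by rewrite product_measure1E// lte_mul_pinfty// ge0_fin_numE.
Qed.

(* The canonical instance covers only products of subprobabilities. *)
Definition product_sfm : {sigma_finite_measure set (T1 * T2)%type -> \bar R} :=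
  HB.pack_for {sigma_finite_measure set (T1 * T2)%type -> \bar R} (m1 \x m2)%E
   (Measure_isSigmaFinite.Build _ _ _ (m1 \x m2)%E product_sigma_finite).
End product_measure.

Lemma continuous_clamp_bounded (R : realType) (g : R -> R) (a b : R) : a <= b ->
  {within `[a, b], continuous g} -> exists2 C : R, 0 < C & forall x, `|(g \o clamp a b) x| <= C.
Proof.
move=> ab cg.
have cn : {within `[a, b], continuous (fun x => `|g x|)}.
  by move=> x; apply: (@cvg_norm _ R^o); exact: cg.
have [c _ cmax] := EVT_max ab cn.
exists (`|g c| + 1); first by rewrite ltr_wpDl.
move=> x; have xab := @clamp_in _ a b x ab.
by have := cmax (clamp a b x); rewrite in_itv/= => /(_ xab) /le_trans; apply; rewrite lerDl.
Qed.

Section running_cost.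
Context (R : realType) (P : junction R) (hP : standing_assumptions P).
Local Notation mu := (@lebesgue_measure R).
Local Notation T := (horizon P).
Context (f : R -> R) (f_convex : @convex_function R R^o `[A0 P, 0] f)
  (f_C1 : C1_on `[A0 P, 0] f).
Local Notation df := (slope_ext f (A0 P) 0).

Lemma control_comp_measurable (g : R -> R) A : control P A -> continuous g ->
  measurable_fun `]0, T[ (g \o A).
Proof.
by move=> [mA _] cg; apply: measurableT_comp => //; exact: continuous_measurable_fun.
Qed.

Lemma bounded_oo_integrable (g : R -> R) (C : R) : measurable_fun `]0, T[ g ->
  (forall s, 0 < s < T -> `|g s| <= C) -> mu.-integrable `]0, T[ (EFin \o g).
Proof.
move=> mg gC; apply: (le_integrable _ _ _ (integrable_oo_cst 0 T C)) => //.
  exact/measurable_EFinP.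
move=> s /=; rewrite in_itv/= => sT; rewrite lee_fin; apply: le_trans (gC s sT) _.
exact: ler_norm.
Qed.

(** The tangent is taken at the new control B, which bounds the increment from above; as B tends to
    A the slope at B converges by continuity of f'. *)
Lemma running_cost_tangent A B : control P A -> control P B ->
  \int[mu]_(s in `]0, T[) f (B s) - \int[mu]_(s in `]0, T[) f (A s) <=
  \int[mu]_(s in `]0, T[) (df (B s) * (B s - A s)).
Proof.
move=> hA hB; have A00 := A0_lt0 hP.
have [L L0 HL] := convex_C1_lipschitz A00 f_convex f_C1.
have cf : continuous (f \o clamp (A0 P) 0).
  move=> x; apply/cvgrPdist_le => e e0; near=> y.
  apply: le_trans (HL x y) _; rewrite mulrC -ler_pdivlMr//; near: y.
  have /cvgrPdist_le := @cvg_id _ (nbhs x); apply; exact: divr_gt0.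
have [C C0 HC] := continuous_clamp_bounded (ltW A00) (continuous_subspaceT cf).
have fE D s : control P D -> 0 < s < T -> f (D s) = (f \o clamp (A0 P) 0) (D s).
  move=> [_ bD] sT; have := bD s; rewrite in_itv/= => /(_ sT) Ds.
  by rewrite /= clamp_id.
have fC D s : control P D -> 0 < s < T -> `|(f \o clamp (A0 P) 0) (D s)| <= C.
  move=> [_ bD] sT; have := bD s; rewrite in_itv/= => /(_ sT) Ds.
  by have := HC (D s); rewrite /= !clamp_id.
have fi D : control P D -> mu.-integrable `]0, T[ (EFin \o (fun s => f (D s))).
  move=> hD; apply: (@bounded_oo_integrable _ C).
    apply: eq_measurable_fun (control_comp_measurable hD cf) => s.
    by rewrite inE/= in_itv/= => sT; rewrite [RHS](fE _ _ hD).
  by move=> s sT; rewrite fE// fC.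
have [M M0 HM] := slope_ext_bounded A00 f_C1.
have di : mu.-integrable `]0, T[ (EFin \o (fun s => df (B s) * (B s - A s))).
  apply: (@bounded_oo_integrable _ (M * - A0 P)).
    apply: measurable_funM.
      exact: control_comp_measurable hB (slope_ext_continuous A00 f_C1).
    by apply: measurable_funB; [case: hB|case: hA].
  move=> s /andP[s0 sT]; rewrite normrM; apply: ler_pM => //.
  have [a1 a2] := control_bounds hA s0 sT; have [b1 b2] := control_bounds hB s0 sT.
  by rewrite ler_norml; apply/andP; split; lra.
have step : \int[mu]_(s in `]0, T[) f (B s) - \int[mu]_(s in `]0, T[) f (A s) =
    \int[mu]_(s in `]0, T[) (f (B s) - f (A s)).
  by rewrite RintegralB//; exact: fi.
rewrite step; apply: le_Rintegral => //.
  rewrite (_ : EFin \o _ = (EFin \o (fun s => f (B s))) \- (EFin \o (fun s => f (A s))))%E//.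
  by apply: integrableB => //; exact: fi.
move=> s; rewrite /= in_itv/= => /andP[s0 sT].
have [a1 a2] := control_bounds hA s0 sT; have [b1 b2] := control_bounds hB s0 sT.
have aa : A0 P <= A s <= 0 by rewrite a1.
have bb : A0 P <= B s <= 0 by rewrite b1.
have := convex_tangent f_convex f_C1 bb aa.
by rewrite slope_extE//; lra.
Unshelve. all: by end_near. Qed.

End running_cost.

(** * Waiting indicator and exchange of the integrals in (t, x) and s *)

Section variation.
Context (R : realType) (P : junction R) (hP : standing_assumptions P).
Local Notation mu := (@lebesgue_measure R).
Local Notation T := (horizon P).
Local Notation plane := (measurableTypeR R * measurableTypeR R)%type.
Context (phi : R -> R -> R) (hphi : continuous_compact_support P phi).
Context (A : R -> R) (hA : control P A).
Context (entry : plane -> R) (mentry : measurable_fun setT entry).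
Local Notation leave t x := (leave_first P A x t).

Lemma ae_avoid2 (a b : R) : {ae mu, forall s : R, s != a /\ s != b}.
Proof.
exists [set a; b]; split.
- by apply: measurableU; exact: measurable_set1.
- by apply: countable_lebesgue_measure0; apply: finite_set_countable; exact: finite_set2.
- move=> s /= h; apply: contrapT => /not_orP[sa sb]; apply: h.
  by split; apply/eqP.
Qed.

Lemma occupation_interval (E : set R) (t1 t2 : R) : measurable E -> 0 <= t1 -> t1 <= t2 ->
  occupation E t2 - occupation E t1 = \int[mu]_s (\1_E s * (t1 <= s <= t2)%R%:R).
Proof.
move=> mE t10 t12; rewrite /occupation (@Rintegral_split _ _ 0 t2 t1) ?t10//; last first.
  exact: indic_integrable.
rewrite addrAC subrr add0r Rintegral_mkcond; apply: ae_eq_Rintegral.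
apply: ae_sub (ae_avoid2 t1 t2) => s [s1 s2] _; rewrite patchE.
case: ifPn => [/set_mem|/negP h].
  by rewrite /= in_itv/= => /andP[h1 h2]; rewrite (ltW h1) (ltW h2) mulr1.
have [/andP[h1 h2]|_] := boolP (t1 <= s <= t2); last by rewrite mulr0.
by exfalso; apply: h; apply/mem_set; rewrite /= in_itv/= !lt_neqAle h1 h2 s2 eq_sym s1.
Qed.

Definition waits_at (z : plane) (s : R) : bool :=
  through P A z.2 (Num.max z.1 0) &&
  (entry z <= s <= leave (Num.max z.1 0) z.2).

(** The integral in the conclusion, with [waits_at] in place of a selection. The restriction t > s
    needs no indicator, since for x != 0 the first departure precedes t; see [rest_gain_section]. *)
Definition rest_gain (s : R) : R :=
  \int[(mu \x mu)%E]_z (weight P phi z * (waits_at z s)%:R).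

Section test_set.
Context (E : set R) (mE : measurable (E : set (measurableTypeR R))) (ET : E `<=` `]0, T[).

Definition rest_kernel (w : plane * measurableTypeR R) : R :=
  weight P phi w.1 * (waits_at w.1 w.2)%:R * \1_E w.2.

Lemma rest_kernel_measurable : measurable_fun setT rest_kernel.
Proof.
apply: measurable_funM.
  apply: measurable_funM.
    exact: measurableT_comp (weight_measurable hphi) measurable_fst.
  rewrite (_ : (fun w => _) = (fun w : plane * measurableTypeR R =>
      if waits_at w.1 w.2 then 1 else 0)); last by apply/funext => w; case: waits_at.
  apply: measurable_fun_ifT => //.
  have m1 : measurable_fun setT (fun w : plane * measurableTypeR R =>
      through P A w.1.2 (Num.max w.1.1 0)).
    exact: measurableT_comp (through_measurable hP hA) measurable_fst.
  have m2 : measurable_fun setT (fun w : plane * measurableTypeR R => entry w.1 <= w.2).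
    apply: measurable_fun_ler; last exact: measurable_snd.
    exact: measurableT_comp mentry measurable_fst.
  have m3 : measurable_fun setT (fun w : plane * measurableTypeR R =>
      w.2 <= leave (Num.max w.1.1 0) w.1.2).
    apply: measurable_fun_ler; first exact: measurable_snd.
    exact: measurableT_comp (leave_first_measurable hP hA) measurable_fst.
  by apply: measurable_and => //; exact: measurable_and.
apply: (@measurableT_comp _ _ _ _ _ _ (\1_E : measurableTypeR R -> R)).
  exact: measurable_indic.
exact: measurable_snd.
Qed.

Context (B C : R) (HC : forall t x,
  `|weight P phi (t, x)| <= C * \1_(`]0, T[%classic) t * \1_(`[- B, B]%classic) x).
Let mu2 : {sigma_finite_measure set plane -> \bar R} := product_sfm mu mu.
Let box : set plane := `]0, T[%classic `*` `[- B, B]%classic.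

Lemma rest_kernel_bounded z s :
  `|rest_kernel (z, s)| <= C * \1_box z * \1_(`]0, T[%classic) s.
Proof.
rewrite /rest_kernel /= normrM (normrM (weight P phi z)).
have h1 : `|weight P phi z| <= C * \1_box z.
  case: z => t x; apply: le_trans (HC t x) _; rewrite -mulrA !indicE in_setX.
  by do 2!case: (_ \in _); rewrite /= ?mulr1 ?mulr0.
have h2 : `|(waits_at z s)%:R : R| <= 1 by case: waits_at; rewrite ?normr1 ?normr0.
have h3 : `|(\1_E s : R)| <= \1_(`]0, T[%classic) s.
  rewrite !indicE; have [/set_mem/ET sT|_] := boolP (s \in E); last by rewrite normr0.
  by rewrite normr1 mem_set.
apply: ler_pM => //; rewrite -[leRHS]mulr1; apply: ler_pM => //.
Qed.

Lemma measurable_box : measurable box.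
Proof. by apply: measurableX. Qed.

Lemma fin_box : ((mu \x mu)%E box < +oo)%E.
Proof.
have := product_measure1E mu mu (measurable_itv `]0, T[) (measurable_itv `[- B, B]%R).
rewrite /= => ->; apply: lte_mul_pinfty => //.
  rewrite ge0_fin_numE//; exact: fin_oo.
exact: fin_cc.
Qed.

Lemma rest_kernel_swap :
  \int[(mu \x mu)%E]_z \int[mu]_s rest_kernel (z, s) = \int[mu]_s (\1_E s * rest_gain s).
Proof.
apply: etrans (Rintegral_iterated12 (m1 := mu2) (m2 := mu) measurable_box
  (measurable_itv `]0, T[) fin_box (fin_oo 0 T) rest_kernel_measurable rest_kernel_bounded) _.
apply: etrans (esym (Rintegral_iterated21 (m1 := mu2) (m2 := mu) measurable_box
  (measurable_itv `]0, T[) fin_box (fin_oo 0 T) rest_kernel_measurable rest_kernel_bounded)) _.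
apply: eq_Rintegral => s _; rewrite /rest_kernel /rest_gain /=.
rewrite indicE; case: (s \in E); last first.
  rewrite mul0r; transitivity (\int[(mu \x mu)%E]_z (cst (0 : R) z)).
    by apply: eq_Rintegral => z _; rewrite mulr0.
  by rewrite Rintegral_cst// mul0r.
by rewrite mul1r; apply: eq_Rintegral => z _; rewrite mulr1.
Qed.

End test_set.
End variation.

Lemma ae_unkinked (R : realType) (P : junction R) (hP : standing_assumptions P)
    (A : R -> R) (hA : control P A) (t : R) : 0 < t ->
  {ae @lebesgue_measure R, forall x, x != 0 /\ ~ kinked P A t x}.
Proof.
move=> t0; have ck := countable_kinked hP hA t0.
exists ([set 0] `|` kinked P A t); split.
- apply: measurableU; first exact: measurable_set1.
  exact: countable_measurable.
- rewrite null_set_setU//.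
  + exact: countable_measurable.
  + exact: lebesgue_measure_set1.
  + exact: countable_lebesgue_measure0.
- move=> x /= hx; have [x0|x0] := eqVneq x 0; first by left.
  by right; apply: contrapT => xk; apply: hx.
Qed.

(** * Minimality tested on one perturbation *)

Section minimality.
Context (R : realType) (P : junction R) (hP : standing_assumptions P).
Local Notation mu := (@lebesgue_measure R).
Local Notation T := (horizon P).
Local Notation plane := (measurableTypeR R * measurableTypeR R)%type.
Context (phi : R -> R -> R) (hphi : continuous_compact_support P phi).
Context (f : R -> R) (f_convex : @convex_function R R^o `[A0 P, 0] f)
  (f_C1 : C1_on `[A0 P, 0] f).
Local Notation df := (slope_ext f (A0 P) 0).
Context (A : R -> R) (hmin : minimizer P phi f A).
Context (entry : plane -> R) (mentry : measurable_fun setT entry).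
Local Notation leave t x := (leave_first P A x t).
Context (E : set R) (mE : measurable (E : set (measurableTypeR R))) (ET : E `<=` `]0, T[).
Context (e : R) (hAe : control P (perturbed E A e 1)).
Context (good : forall x t, x != 0 -> 0 < t -> t < T -> ~ kinked P A t x ->
  through P A x t -> exists t1, [/\ optimal_times P A x t (t1, leave t x),
    forall z, optimal_times P A x t z -> occupied E e z <= occupied E e (t1, leave t x) &
    forall s, E s -> (t1 <= s <= leave t x) = (entry (t, x) <= s <= leave t x)]).

Let hA : control P A := hmin.1.
Local Notation theta n := (n.+1%:R^-1 : R).
Local Notation step n := (perturbed E A e (theta n)).

Lemma theta_gt0 n : 0 < theta n. Proof. by rewrite invr_gt0. Qed.
Lemma theta_le1 n : theta n <= 1. Proof. by rewrite invf_le1// ler1n. Qed.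

Lemma step_control n : control P (step n).
Proof.
by apply: (control_perturbed mE hA hAe); rewrite (ltW (theta_gt0 n)) theta_le1.
Qed.

Definition rest_time (z : plane) : R :=
  \int[mu]_s (\1_E s * (waits_at P A entry z s)%:R).

Lemma rest_integrable z : mu.-integrable setT (EFin \o
  (fun s => \1_E s * (waits_at P A entry z s)%:R)).
Proof.
apply: (@bounded_support_integrable _ _ _ mu `]0, T[%classic _ 1) => //.
- exact: fin_oo.
- apply: measurable_funM; first exact: measurable_indic.
  rewrite (_ : (fun s => _) = (fun s => if waits_at P A entry z s then 1 else 0)); last first.
    by apply/funext => s; case: waits_at.
  apply: measurable_fun_ifT => //.
  apply: measurable_and; first exact: measurable_cst.
  by apply: measurable_and; apply: measurable_fun_ler => //; exact: measurable_cst.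
- move=> s; rewrite mul1r normrM !indicE; have [/set_mem/ET sT|_] := boolP (s \in E).
    by rewrite (mem_set sT) normr1 mul1r; case: waits_at; rewrite ?normr1 ?normr0.
  by rewrite normr0 mul0r.
Qed.

Lemma quotient_limit x t : x != 0 -> 0 < t -> t < T -> ~ kinked P A t x ->
  (uvalue P (step n) x t - uvalue P A x t) / theta n @[n --> \oo] -->
  - e * rest_time (t, x).
Proof.
move=> x0 t0 tT nk.
have hd := uvalue_differentiable hP hA x0 t0 tT nk.
have [t1 Ht1] : exists t1, through P A x t ->
    [/\ optimal_times P A x t (t1, leave t x),
    forall z, optimal_times P A x t z -> occupied E e z <= occupied E e (t1, leave t x) &
    forall s, E s -> (t1 <= s <= leave t x) = (entry (t, x) <= s <= leave t x)].
  have [J|J] := boolP (through P A x t); last by exists 0.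
  by have [t1 H] := good x0 t0 tT nk J; exists t1.
have lt := leave_first_lt hP hA x0 t0 (ltW tT).
have rate := uvalue_rate hP mE hA hAe (x := x) (t := t) (t1 := t1).
have -> : - e * rest_time (t, x) = - ((through P A x t)%:R * occupied E e (t1, leave t x)).
  rewrite /rest_time /waits_at /= max_l ?(ltW t0)//.
  have [J|J] := boolP (through P A x t); last first.
    rewrite mul0r oppr0 (_ : (\int[mu]_s _) = 0) ?mulr0//.
    transitivity (\int[mu]_s (cst (0 : R) s)); last by rewrite Rintegral_cst// mul0r.
    by apply: eq_Rintegral => s _; rewrite /= mulr0.
  have [[[d0 d1 d2] _] _ sE] := Ht1 J.
  rewrite mul1r /occupied /= -mulNr; congr (_ * _).
  rewrite (occupation_interval mE d0 d1); apply: eq_Rintegral => s _.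
  by rewrite indicE; have [/set_mem Es|_] := boolP (s \in E); rewrite ?mul0r// sE.
apply/cvgrPdist_le => eta eta0.
have [|th0 th00 Hth] := rate _ eta eta0.
  move=> J; have [oz mz _] := Ht1 J; split => //.
  (* In case of a tie with the direct branch the pair (0, 0) is optimal; it occupies nothing, so the
     maximal occupation is nonnegative. *)
  move=> ud; have := mz _ (junction_direct_start hP hA x0 t0 (ltW tT) hd oz lt ud).
  by rewrite /occupied /= subrr mulr0.
near=> n.
rewrite distrC opprK; apply: Hth; rewrite theta_gt0/=.
near: n.
exact: (near_infty_natSinv_lt (PosNum th00)).
Unshelve. all: by end_near. Qed.

Definition value_quotient (n : nat) (z : plane) : R :=
  weight P phi z * ((uvalue P (step n) z.2 (Num.max z.1 0) -
                     uvalue P A z.2 (Num.max z.1 0)) / theta n).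

Lemma value_variation :
  \int[(mu \x mu)%E]_z value_quotient n z @[n --> \oo] -->
  - e * \int[mu]_s (\1_E s * rest_gain P phi A entry s).
Proof.
have [B [C [B0 C0 HC]]] := weight_bounded hphi.
have mk := rest_kernel_measurable hP hphi hA mentry mE.
have bk := rest_kernel_bounded A entry ET HC.
have mbox := measurable_box P B; have fbox := fin_box P B.
pose mu2 : {sigma_finite_measure set plane -> \bar R} := product_sfm mu mu.
have mS := section_integral_measurable1 (m1 := mu2) (m2 := mu) mbox
  (measurable_itv `]0, T[) fbox (fin_oo 0 T) mk bk.
have bS z := section_integral_bound1 (m2 := mu) (measurable_itv `]0, T[) (fin_oo 0 T) mk bk z (ltW C0).
have e0 := normr_ge0 e; have T0 := ltW (horizon_gt0 hP).
pose F := fine (mu `]0, T[%classic).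
have F0 : 0 <= F by apply: fine_ge0.
(* One constant for both families: T comes from [uvalue_perturbed_le] for the quotients, and F, the
   measure of (0, T), from the integral over s in the limit. *)
pose D := C * (`|e| * (T + F)).
have D0 : 0 <= D by rewrite !mulr_ge0 ?addr_ge0// ltW.
pose h (z : plane) := - e * \int[mu]_s rest_kernel P phi A entry E (z, s).
have boxE t x : \1_(`]0, T[%classic `*` `[- B, B]%classic : set plane) (t, x) =
    \1_(`]0, T[%classic) t * \1_(`[- B, B]%classic) x :> R.
  by rewrite !indicE in_setX; do 2!case: (_ \in _); rewrite /= ?mulr1 ?mulr0.
have hb t x : `|h (t, x)| <= D * \1_(`]0, T[%classic) t * \1_(`[- B, B]%classic) x.
  rewrite /h normrM normrN; have := ler_wpM2l e0 (bS (t, x)); rewrite boxE -/F => /le_trans; apply.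
  rewrite /D -!mulrA mulrCA ler_wpM2l ?(ltW C0)// ler_wpM2l//.
  by rewrite mulrDl lerDr !mulr_ge0.
have mh : measurable_fun setT h by apply: measurable_funM => //; exact: mS.
have mv n : measurable_fun setT (value_quotient n).
  apply: measurable_funM; first exact: weight_measurable.
  apply: measurable_funM => //; apply: measurable_funB.
    exact: (@uvalue_measurable _ _ hP _ (step_control n)).
  exact: (@uvalue_measurable _ _ hP _ hA).
have vb n t x : `|value_quotient n (t, x)| <=
    D * \1_(`]0, T[%classic) t * \1_(`[- B, B]%classic) x.
  rewrite /value_quotient normrM /=.
  have : `|(uvalue P (step n) x (Num.max t 0) - uvalue P A x (Num.max t 0)) / theta n|
      <= `|e| * (T + F).
    rewrite normrM normfV (gtr0_norm (theta_gt0 n)) ler_pdivrMr ?theta_gt0//.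
    have thin : 0 <= theta n <= 1 by rewrite (ltW (theta_gt0 n)) theta_le1.
    apply: le_trans (uvalue_perturbed_le hP mE hA hAe _ _ thin) _.
    rewrite mulrC ler_wpM2r ?(ltW (theta_gt0 n))// ler_wpM2l// lerDl.
    exact: F0.
  move=> q1; have := ler_pM (normr_ge0 _) (normr_ge0 _) (HC t x) q1.
  move=> /le_trans; apply; rewrite /D.
  by rewrite le_eqVlt; apply/orP; left; apply/eqP; ring.
have lim := iterated_limit (measurable_itv `]0, T[) (measurable_itv `[- B, B]%R)
  (fin_oo 0 T) (fin_cc (- B) B) D0 mv mh vb hb _.
suff -> : - e * \int[mu]_s (\1_E s * rest_gain P phi A entry s) =
    \int[(mu \x mu)%E]_z h z.
  apply: lim => t; rewrite /= in_itv/= => /andP[t0 tT].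
  apply: ae_sub (ae_unkinked hP hA t0) => x [x0 nk].
  have -> : h (t, x) = weight P phi (t, x) * (- e * rest_time (t, x)).
    rewrite /h mulrCA; congr (_ * _); rewrite /rest_time -RintegralZl//; last exact: rest_integrable.
    by apply: eq_Rintegral => s _; rewrite /rest_kernel /=; ring.
  rewrite /value_quotient /= max_l ?(ltW t0)//.
  by apply: cvgMr; exact: quotient_limit.
rewrite -(rest_kernel_swap hP hphi hA mentry mE ET HC) /h RintegralZl//.
have bS' z : `|\int[mu]_s rest_kernel P phi A entry E (z, s)| <= C * F *
    \1_(`]0, T[%classic `*` `[- B, B]%classic : set plane) z by exact: bS.
exact: (bounded_support_integrable (m := mu2) mbox fbox mS bS').
Qed.

Definition cost_quotient (n : nat) (s : R) : R := df (step n s) * (e * \1_E s).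

Lemma cost_quotient_limit :
  \int[mu]_(s in `]0, T[) cost_quotient n s @[n --> \oo] -->
  \int[mu]_(s in `]0, T[) (df (A s) * (e * \1_E s)).
Proof.
have A00 := A0_lt0 hP.
have [M M0 HM] := slope_ext_bounded A00 f_C1.
have cdf := slope_ext_continuous A00 f_C1.
rewrite Rintegral_mkcond; under eq_fun do rewrite Rintegral_mkcond.
have mIE : measurable_fun `]0, T[ (fun s => e * \1_E s).
  by apply: measurable_funM => //; exact: measurable_indic.
have bnd (g : R -> R) s : `|((fun s => df (g s) * (e * \1_E s)) \_ `]0, T[) s| <=
    (M * `|e|) * \1_(`]0, T[%classic) s.
  rewrite patchE (indicE _ `]0, T[%classic s); case: ifP => _; last by rewrite normr0 mulr0.
  rewrite mulr1 !normrM; apply: ler_pM => //.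
  by rewrite indicE; case: (s \in E); rewrite ?normr1 ?normr0 ?mulr1 ?mulr0.
apply: (@Rintegral_dominated _ _ _ mu `]0, T[%classic (M * `|e|)) => //.
- exact: fin_oo.
- move=> n; apply/(measurable_restrictT (cost_quotient n) (measurable_itv `]0, T[)).
  apply: measurable_funM => //.
  exact: control_comp_measurable (step_control n) cdf.
- apply/(measurable_restrictT (fun s => df (A s) * (e * \1_E s)) (measurable_itv `]0, T[)).
  apply: measurable_funM => //.
  exact: control_comp_measurable hA cdf.
- by move=> n s; exact: bnd.
- apply: nearW => s; rewrite !patchE; case: ifP => sT; last first.
    by under eq_fun do rewrite patchE sT; exact: cvg_cst.
  under eq_fun do rewrite patchE sT.
  have st : step n s @[n --> \oo] --> A s + 0 * e * \1_E s.
    apply: cvgD; first exact: cvg_cst.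
    by apply: cvgMl; apply: cvgMl; exact: cvg_harmonic.
  rewrite !mul0r addr0 in st.
  by apply: cvgMl; apply: cvg_comp st (cdf _).
Qed.

Lemma total_cost_quotient n :
  0 <= \int[(mu \x mu)%E]_z value_quotient n z + \int[mu]_(s in `]0, T[) cost_quotient n s.
Proof.
have aux (a b c d q : R) : a + c <= b + d -> d - c <= q -> 0 <= b - a + q by lra.
have [B [C [B0 C0 HC]]] := weight_bounded hphi.
have th0 := theta_gt0 n.
have [_ /(_ _ (step_control n))] := hmin.
rewrite (total_costE hP hphi f hA) (total_costE hP hphi f (step_control n)).
have iw D (hD : control P D) : (mu \x mu)%E.-integrable setT (EFin \o weighted_value P phi D).
  have [K K0 HK] := weighted_value_bounded hP hD HC C0.
  exact: (product_integrable (m1 := mu) (m2 := mu) (measurable_itv `]0, T[)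
    (measurable_itv `[- B, B]%R) (fin_oo 0 T) (fin_cc (- B) B)
    (weighted_value_measurable hP hphi hD) HK).
have E1 : \int[(mu \x mu)%E]_z value_quotient n z * theta n =
    \int[(mu \x mu)%E]_z weighted_value P phi (step n) z -
    \int[(mu \x mu)%E]_z weighted_value P phi A z.
  rewrite -RintegralB//; [|exact: iw (step_control n)|exact: iw hA].
  rewrite mulrC -RintegralZl//.
    apply: eq_Rintegral => z _; rewrite /value_quotient /weighted_value.
    by field; rewrite gt_eqF.
  have iB := integrableZl measurableT (theta n)^-1
    (integrableB measurableT (iw _ (step_control n)) (iw _ hA)).
  apply: eq_integrable iB => // z _; rewrite /value_quotient /weighted_value /=.
  by rewrite -EFinB -EFinM; congr (_%:E); ring.
have E2 : \int[mu]_(s in `]0, T[) (df (step n s) * (step n s - A s)) =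
    \int[mu]_(s in `]0, T[) cost_quotient n s * theta n.
  have [M M0 HM] := slope_ext_bounded (A0_lt0 hP) f_C1.
  rewrite mulrC -RintegralZl//.
    apply: eq_Rintegral => s _; rewrite /cost_quotient {2}/perturbed; ring.
  apply: (@bounded_oo_integrable _ _ _ (M * `|e|)).
    apply: measurable_funM.
      exact: control_comp_measurable (step_control n) (slope_ext_continuous (A0_lt0 hP) f_C1).
    by apply: measurable_funM => //; exact: measurable_indic.
  move=> s _; rewrite !normrM; apply: ler_pM => //.
  by rewrite indicE; case: (s \in E); rewrite ?normr1 ?normr0 ?mulr1 ?mulr0.
have := running_cost_tangent hP f_convex f_C1 hA (step_control n).
rewrite E2 => h1 h2.
by rewrite -(pmulr_lge0 _ th0) mulrDl E1; exact: aux h2 h1.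
Qed.

Lemma variation_ge0 :
  e * \int[mu]_s (\1_E s * rest_gain P phi A entry s) <=
  \int[mu]_(s in `]0, T[) (df (A s) * (e * \1_E s)).
Proof.
have lim : (\int[(mu \x mu)%E]_z value_quotient n z +
      \int[mu]_(s in `]0, T[) cost_quotient n s) @[n --> \oo] -->
    - e * \int[mu]_s (\1_E s * rest_gain P phi A entry s) +
      \int[mu]_(s in `]0, T[) (df (A s) * (e * \1_E s)).
  by apply: cvgD; [exact: value_variation|exact: cost_quotient_limit].
rewrite -subr_ge0 addrC -mulNr -(cvg_lim _ lim)//.
apply: limr_ge; first by apply/cvg_ex; eexists; exact: lim.
by apply: nearW => n; exact: total_cost_quotient.
Qed.

End minimality.

Lemma ae_and (R : realType) (P Q : R -> Prop) :
  {ae @lebesgue_measure R, forall x, P x} -> {ae @lebesgue_measure R, forall x, Q x} ->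
  {ae @lebesgue_measure R, forall x, P x /\ Q x}.
Proof.
move=> [N [mN N0 HN]] [M [mM M0 HM]]; exists (N `|` M); split.
- exact: measurableU.
- by rewrite null_set_setU.
- move=> x /= /not_andP[nP|nQ]; [left; exact: HN|right; exact: HM].
Qed.

(** * From the integrated inequality to the conditions at almost every time *)

Section pointwise_conditions.
Context (R : realType) (P : junction R) (hP : standing_assumptions P).
Local Notation mu := (@lebesgue_measure R).
Local Notation T := (horizon P).
Local Notation plane := (measurableTypeR R * measurableTypeR R)%type.
Context (phi : R -> R -> R) (hphi : continuous_compact_support P phi).
Context (f : R -> R) (f_convex : @convex_function R R^o `[A0 P, 0] f)
  (f_C1 : C1_on `[A0 P, 0] f).
Local Notation df := (slope_ext f (A0 P) 0).
Context (A : R -> R) (hmin : minimizer P phi f A).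
Let hA : control P A := hmin.1.
Local Notation leave t x := (leave_first P A x t).

Section test_sets.
Context (entry : plane -> R) (mentry : measurable_fun setT entry).
Local Notation gain := (rest_gain P phi A entry).

(** The pair (t1, [leave t x]) realises the largest rate among the optimal pairs. Its entrance may
    differ from [entry], provided that no point of E detects the difference; this freedom serves the
    latest entrance. *)
Definition admissible_test (E : set R) (e : R) :=
  control P (perturbed E A e 1) /\
  forall x t, x != 0 -> 0 < t -> t < T -> ~ kinked P A t x ->
  through P A x t -> exists t1, [/\ optimal_times P A x t (t1, leave t x),
    forall z, optimal_times P A x t z -> occupied E e z <= occupied E e (t1, leave t x) &
    forall s, E s -> (t1 <= s <= leave t x) = (entry (t, x) <= s <= leave t x)].

Lemma rest_gain_integrable (E : set R) : measurable (E : set (measurableTypeR R)) ->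
  E `<=` `]0, T[ -> mu.-integrable E (EFin \o gain).
Proof.
move=> mE ET; have [B [C [B0 C0 HC]]] := weight_bounded hphi.
have mk := rest_kernel_measurable hP hphi hA mentry mE.
have bk := rest_kernel_bounded A entry ET HC.
have mbox := measurable_box P B; have fbox := fin_box P B.
pose mu2 : {sigma_finite_measure set plane -> \bar R} := product_sfm mu mu.
have mS := section_integral_measurable2 (m1 := mu2) (m2 := mu) mbox
  (measurable_itv `]0, T[) fbox (fin_oo 0 T) mk bk.
have bS s := section_integral_bound2 (m1 := mu2) mbox fbox mk bk s (ltW C0).
have ik := bounded_support_integrable (m := mu) (measurable_itv `]0, T[) (fin_oo 0 T) mS bS.
have := integrableS measurableT mE (@subsetT _ E) ik.
apply: eq_integrable => // s /set_mem Es.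
congr (_%:E); rewrite /rest_gain; apply: eq_Rintegral => z _.
by rewrite /rest_kernel /= indicE mem_set// mulr1.
Qed.

Lemma df_integrable (E : set R) : measurable (E : set (measurableTypeR R)) ->
  E `<=` `]0, T[ -> mu.-integrable E (EFin \o (fun s => df (A s))).
Proof.
move=> mE ET; have [M M0 HM] := slope_ext_bounded (A0_lt0 hP) f_C1.
have : mu.-integrable `]0, T[ (EFin \o (fun s => df (A s))).
  apply: (@bounded_oo_integrable _ _ _ M) => // .
  exact: control_comp_measurable hA (slope_ext_continuous (A0_lt0 hP) f_C1).
exact: integrableS.
Qed.

(** Over E, [variation_ge0] bounds the integral of e [gain] by that of e [df], while the pointwise
    violation bounds the latter by the former minus c times the measure of E. *)
Lemma test_set_null (E : set R) (e c : R) : measurable (E : set (measurableTypeR R)) ->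
  E `<=` `]0, T[ -> admissible_test E e -> 0 < c ->
  (forall s, E s -> e * (df (A s) - gain s) <= - c) -> mu E = 0%E.
Proof.
move=> mE ET [hAe good] c0 Ec.
have fE : (mu E < +oo)%E.
  by apply: le_lt_trans (mu_le mE _ ET) (fin_oo 0 T).
have iG := rest_gain_integrable mE ET; have iD := df_integrable mE ET.
have ieG : mu.-integrable E (EFin \o (fun s => e * gain s)).
  by have := @integrableZl _ _ R mu _ mE e (EFin \o gain) iG; exact.
have ieD : mu.-integrable E (EFin \o (fun s => e * df (A s))).
  by have := @integrableZl _ _ R mu _ mE e (EFin \o (fun s => df (A s))) iD; exact.
have ic : mu.-integrable E (EFin \o cst (- c)).
  by apply: (@integrableS _ _ _ mu `]0, T[%classic) => //; exact: integrable_oo_cst.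
have := variation_ge0 hP hphi f_convex f_C1 hmin mentry mE ET hAe good.
have -> : \int[mu]_s (\1_E s * gain s) = \int[mu]_(s in E) gain s.
  rewrite [RHS]Rintegral_mkcond; apply: eq_Rintegral => s _.
  by rewrite patchE indicE; case: ifP; rewrite ?mul1r ?mul0r.
have -> : \int[mu]_(s in `]0, T[) (df (A s) * (e * \1_E s)) = \int[mu]_(s in E) (e * df (A s)).
  rewrite [RHS]Rintegral_mkcond Rintegral_mkcond; apply: eq_Rintegral => s _.
  rewrite !patchE indicE; have [/set_mem Es|nE] := boolP (s \in E).
    by rewrite (mem_set (ET _ Es)) mulr1 mulrC.
  by case: ifP; rewrite ?mulr0.
rewrite -RintegralZl// => up.
have lo : \int[mu]_(s in E) (e * df (A s)) <= \int[mu]_(s in E) (e * gain s + cst (- c) s).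
  apply: le_Rintegral => //.
    by have := integrableD mE ieG ic; exact.
  by move=> s Es; have := Ec s Es; rewrite mulrBr /=; lra.
have := le_trans up lo; rewrite RintegralD// Rintegral_cst//.
rewrite -subr_ge0 addrAC subrr add0r mulNr oppr_ge0 pmulr_rle0// => mE0.
apply/eqP; rewrite eq_le measure_ge0 andbT.
by rewrite -(@fineK _ (mu E)) ?ge0_fin_numE// lee_fin.
Qed.

(** A perturbation of fixed size has to be admissible on the whole test set. The sets F n provide
    room 1/(n+1), a second index quantifies the violation, and countably many null sets remain. *)
Lemma pointwise_sign (sg : R) (F : nat -> set R) :
  (forall n, measurable (F n : set (measurableTypeR R))) -> (forall n, F n `<=` `]0, T[) ->
  (forall n (E : set R), measurable (E : set (measurableTypeR R)) -> E `<=` F n ->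
     admissible_test E (sg * n.+1%:R^-1)) ->
  {ae mu, forall s, (exists n, F n s) -> 0 <= sg * (df (A s) - gain s)}.
Proof.
move=> mF FT adm.
pose E (q : nat * nat) : set (measurableTypeR R) :=
  F q.1 `&` [set s | sg * (df (A s) - gain s) <= - q.2.+1%:R^-1].
have mE q : measurable (E q).
  apply: measurable_fun_le => //.
  apply: measurable_funM => //; apply: measurable_funB.
    have mc := control_comp_measurable hA (slope_ext_continuous (A0_lt0 hP) f_C1).
    exact: measurable_funS (measurable_itv _) (FT q.1) mc.
  have iG := rest_gain_integrable (mF q.1) (FT q.1).
  by have /measurable_EFinP := measurable_int _ iG.
have E0 q : mu (E q) = 0%E.
  have ET : E q `<=` `]0, T[ by move=> s [/FT].
  (* The violation 1/(k+1) is multiplied by the size 1/(n+1) of the perturbation. *)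
  have c0 : 0 < q.1.+1%:R^-1 * q.2.+1%:R^-1 :> R by rewrite mulr_gt0// invr_gt0.
  apply: (test_set_null (mE q) ET (adm _ _ (mE q) (@subIsetl _ _ _)) c0).
  move=> s [_ /= le]; rewrite -mulrA mulrCA -mulrN ler_wpM2l// invr_ge0//.
have negl : mu.-negligible (\bigcup_q E q).
  have [u [bu]] : exists u : nat -> nat * nat, True /\ forall q, exists n, u n = q.
    exists (fun n => odflt (0%N, 0%N) (choice.unpickle n)); split => // q.
    by exists (choice.pickle q); rewrite choice.pickleK.
  move=> Hu; apply: (@negligibleS _ _ _ mu (\bigcup_n E (u n))).
    by move=> s [q _ Es]; have [n un] := Hu q; exists n => //; rewrite un.
  by apply: negligible_bigcup => n; apply/negligibleP; [exact: mE|exact: E0].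
move: negl => [N [mN N0 sub]]; exists N; split => // s /= h; apply: sub.
move: h => /not_implyP[[n Fs]] /negP; rewrite -ltNge => neg.
have [k hk] := ltr_add_invr neg.
by exists (n, k) => //; split => //=; apply: ltW; rewrite -[ltRHS]sub0r ltrBrDr.
Qed.

End test_sets.
Lemma rest_gain_section (entry : plane -> R) (g : R -> R -> R -> R) s :
  measurable_fun setT entry -> 0 < s -> s < T ->
  (forall x t, x != 0 -> s < t -> t < T -> ~ kinked P A t x ->
     g x t s = 0 <-> waits_at P A entry (t, x) s) ->
  \int[mu]_(t in `]s, T[) \int[mu]_x (phi x t * \1_[set r | g x t r = 0] s) =
  rest_gain P phi A entry s.
Proof.
move=> mentry s0 sT Hg.
have [B [C [B0 C0 HC]]] := weight_bounded hphi.
have mk := rest_kernel_measurable hP hphi hA mentry (measurable_itv `]0, T[).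
have ms : measurable_fun setT (fun z : plane => weight P phi z * (waits_at P A entry z s)%:R).
  have := measurableT_comp mk (measurable_pair2 (s : measurableTypeR R)).
  apply: eq_measurable_fun => z _; rewrite /rest_kernel /= indicE mem_set ?mulr1//.
  by rewrite /= in_itv/= s0.
apply: (iterated_section (measurable_itv `]0, T[) (measurable_itv `[- B, B]%R)
  (fin_oo 0 T) (fin_cc (- B) B) (C := C) ms).
- move=> t x; have w1 : `|(waits_at P A entry (t, x) s)%:R : R| <= 1.
    by case: waits_at; rewrite ?normr1 ?normr0.
  have := ler_pM (normr_ge0 _) (normr_ge0 _) (HC t x) w1.
  by rewrite mulr1 -normrM.
- move=> t; rewrite /= in_itv/= => /andP[st tT]; have t0 := lt_trans s0 st.
  apply: ae_sub (ae_unkinked hP hA t0) => x [x0 nk].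
  rewrite (@indic_bool _ _ _ _ (waits_at P A entry (t, x) s)); last exact (Hg _ _ x0 st tT nk).
  by rewrite /weight /= indicE mem_set ?mulr1//= in_itv/= t0.
- move=> t; rewrite /= in_itv/= => nt.
  have [t0|t0] := leP t 0.
    apply: nearW => x; rewrite /weight /= indicE memNset ?mulr0 ?mul0r//.
    by rewrite /= in_itv/= ltNge t0.
  have [tT|tT] := ltP t T; last first.
    apply: nearW => x; rewrite /weight /= indicE memNset ?mulr0 ?mul0r//.
    by rewrite /= in_itv/= [t < T]ltNge tT andbF.
  have ts : t <= s by rewrite leNgt; apply/negP => st; apply: nt; rewrite st.
  apply: ae_sub (@ae_neq0 R) => x x0.
  have := leave_first_lt hP hA x0 t0 (ltW tT) => lt.
  rewrite /waits_at /= max_l ?(ltW t0)// [s <= _]leNgt (lt_le_trans lt ts).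
  by rewrite !andbF mulr0.
Qed.

Lemma perturbed_test_control (E : set R) (e : R) : measurable (E : set (measurableTypeR R)) ->
  (forall s, E s -> 0 < s -> s < T -> A0 P <= A s + e <= 0) -> control P (perturbed E A e 1).
Proof.
move=> mE bE; have [mA bA] := hA; split.
  apply: measurable_funD => //; apply: measurable_funM => //.
move=> s sT; rewrite /perturbed mul1r indicE.
have [/set_mem Es|_] := boolP (s \in E); last by rewrite mulr0 addr0; exact: bA.
by move: sT; rewrite in_itv/= mulr1 => /andP[]; exact: bE.
Qed.

Lemma control_level_measurable (c : R) (b : bool) :
  measurable (`]0, T[%classic `&` [set s | if b then A s <= c else c <= A s]
    : set (measurableTypeR R)).
Proof.
have [mA _] := hA; case: b; apply: measurable_fun_le => //; exact: measurable_cst.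
Qed.

Lemma plus_condition (gplus : R -> R -> R -> R) :
  path_selection (@path_plus R) P A gplus ->
  {ae mu, forall s, s \in `]0, T[ -> A s < 0 ->
     \int[mu]_(t in `]s, T[)
        (\int[mu]_x (phi x t * \1_[set r | gplus x t r = 0] s)) - df (A s) <= 0}.
Proof.
move=> hplus.
pose entry (z : plane) := entry_first P A z.2 (Num.max z.1 0).
have mentry : measurable_fun setT entry := entry_first_measurable hP hA.
have shape x t : x != 0 -> 0 < t -> t < T -> ~ kinked P A t x ->
    (~~ through P A x t /\ forall s, 0 < s -> s < t -> gplus x t s != 0) \/
    extremal_pair P A x t (entry_first P A x t) (gplus x t).
  move=> x0 t0 tT nk; have hd := uvalue_differentiable hP hA x0 t0 tT nk.
  apply: (path_plus_shape hP hA x0 t0 (ltW tT) hd).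
  by apply: hplus => //; rewrite in_itv/= t0.
(* On F n the control can be raised by 1/(n+1) and stay nonpositive; these sets exhaust the times
   where A < 0. *)
pose F n := `]0, T[%classic `&` [set s | A s <= - n.+1%:R^-1].
have adm n (E : set R) : measurable (E : set (measurableTypeR R)) -> E `<=` F n ->
    admissible_test entry E (1 * n.+1%:R^-1).
  move=> mE EF; rewrite mul1r; set e : R := n.+1%:R^-1.
  have e0 : 0 < e by rewrite invr_gt0.
  have hAe : control P (perturbed E A e 1).
    apply: perturbed_test_control => // s Es s0 sT.
    have [_ /= As] := EF _ Es; have [a1 a2] := control_bounds hA s0 sT.
    by rewrite -/e in As; apply/andP; split; lra.
  split => // x t x0 t0 tT nk J.
  have [[/negP//]|[_ op _ hw]] := shape x t x0 t0 tT nk.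
  exists (entry_first P A x t); split => //; last first.
    by move=> s _; rewrite /entry /= max_l// ltW.
  move=> z oz; have [_ Bz] := optimal_times_argmin hP hA oz.
  have [w Bw [-> minw]] := leave_firstP hP hA x t.
  have [v Bv [-> minv]] := entry_firstP hP hA x t.
  have [[z1 z12 z2] _] := Bz; have [[w1 w12 w2] _] := Bw; have [[v1 v12 v2] _] := Bv.
  have wz : w.2 <= z.2 by exact: minw.
  have vz : v.1 <= z.1 by exact: minv.
  have w20 := le_trans w1 w12; have z20 := le_trans z1 z12.
  have waitE : wait A z.2 = wait A w.2.
    rewrite (hw _ oz); congr (wait A _).
    by have [w' Bw' [-> minw']] := leave_firstP hP hA x t; apply/eqP; rewrite eq_le minw'// minw.
  (* Between w.2 and z.2 the waiting cost of A is constant, while that of the raised control is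
     nondecreasing, the control being nonpositive. Hence E has no mass there, and leaving later
     gains nothing. *)
  have occ2 : occupation E z.2 <= occupation E w.2.
    have := wait_le hAe w20 wz z2.
    rewrite !(wait_perturbed mE hA)// ?(le_trans wz)// waitE mul1r lerD2l lerN2.
    by rewrite ler_pM2l.
  have /andP[occ1 _] := occupation_bounds mE v1 vz.
  by rewrite /occupied /= ler_pM2l//; lra.
have := pointwise_sign mentry (fun n => control_level_measurable (- n.+1%:R^-1) true)
  (fun n => @subIsetl _ _ _) adm.
apply: ae_sub => s Hs; rewrite in_itv/= => /andP[s0 sT] As.
have [k hk] := ltr_add_invr As.
have := Hs (ex_intro _ k (conj _ _)); rewrite /= in_itv/= s0 sT mul1r => /(_ isT) gap.
rewrite (@rest_gain_section entry gplus)//.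
  have h : A s <= - k.+1%:R^-1 by apply: ltW; rewrite -sub0r ltrBrDr.
  by move: (gap h); rewrite subr_ge0 subr_le0.
move=> x t x0 st tT nk; have t0 := lt_trans s0 st.
rewrite /waits_at /entry /= max_l ?(ltW t0)//.
have [[nJ nz]|[J _ hz _]] := shape x t x0 t0 tT nk.
  rewrite (negbTE nJ) /=; split => // g0.
  by have := nz s s0 st; rewrite g0 eqxx.
by rewrite J /=; exact: (hz s s0 st).
Qed.

(** T0 is the largest time with A = A0 almost everywhere on (0, T0), read off from the equality in
    the upper bound for [wait]. The degenerate entrances of [path_minus_shape] occur before T0 and
    almost all times with A > A0 after it, so the test sets do not meet the ambiguity. *)
Lemma minimal_control_time : exists T0, [/\ 0 <= T0, T0 <= T,
  forall c, 0 <= c -> c <= T -> wait A c = - A0 P * c -> c <= T0 &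
  {ae mu, forall s, s \in `]0, T[ -> A0 P < A s -> T0 < s}].
Proof.
have TT := horizon_gt0 hP; have A00 := A0_lt0 hP.
pose D := `[0, T]%classic `&` [set c | - A0 P * c - wait A c <= 0].
have cw : {within `[0, T], continuous (fun c => - A0 P * c - wait A c)}.
  apply/subspace_continuousP => c cT; apply/cvgrPdist_le => e e0.
  have L0 : 0 < - (2 * A0 P) by lra.
  exists (e / - (2 * A0 P)) => /=; first exact: divr_gt0.
  move=> b /= cb bT; move: cT bT; rewrite /= !in_itv/= => cT bT.
  have := wait_lipschitz hA cT bT; move: cb; rewrite ltr_pdivlMr// => cb w.
  have -> : - A0 P * c - wait A c - (- A0 P * b - wait A b) =
    - A0 P * (c - b) - (wait A c - wait A b) by ring.
  apply: le_trans (ler_normB _ _) _.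
  rewrite normrM (gtr0_norm (_ : 0 < - A0 P)); last by rewrite oppr_gt0.
  by move: cb; nra.
have cD : compact D by apply: compact_sublevel => //; exact: segment_compact.
have D0 : D !=set0.
  by exists 0; split; rewrite /= ?in_itv/= ?lexx ?(ltW TT)// mulr0 wait0 subrr.
have cid : {within D, continuous (fun c : R => c)}.
  by apply: continuous_subspaceT => c; exact: cvg_id.
have [T0 T0D maxT] := compact_EVT_max D0 cD cid.
have [] : D T0 by exact: set_mem.
rewrite /= in_itv/= => /andP[T00 T0T] Tw.
exists T0; split => //.
  move=> c c0 cT cE; apply: maxT; apply/mem_set; split; rewrite /= ?in_itv/= ?c0//.
  by rewrite cE subrr.
have i1 := control_integrable_oo hA (lexx 0) T0T.
have i2 := integrable_oo_cst 0 T0 (A0 P).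
have iB : mu.-integrable `]0, T0[ (EFin \o (fun s => A s - A0 P)).
  by have := @integrableB _ _ R mu _ (measurable_itv `]0, T0[) (EFin \o A)
    (EFin \o cst (A0 P)) i1 i2; exact.
have mf := measurable_int _ iB.
have pos s : 0 < s -> s < T0 -> 0 <= A s - A0 P.
  by move=> s0 sT; have [] := control_bounds hA s0 (lt_le_trans sT T0T); rewrite subr_ge0.
have int0 : \int[mu]_(s in `]0, T0[) (A s - A0 P) = 0.
  rewrite RintegralB// (_ : \int[mu]_(s in `]0, T0[) A s = - wait A T0); last by rewrite opprK.
  have := Rintegral_oo_cst (A0 P) T00; rewrite /= subr0 => ->.
  have /andP[_] := wait_bounds hA (lexx 0) T00 T0T; rewrite wait0 !subr0 => w1.
  move: Tw w1; lra.
have /(ae_eq_integral_abs mu (measurable_itv `]0, T0[) mf) ae0 :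
    (\int[mu]_(s in `]0%R, T0[) `|(EFin \o (fun s => A s - A0 P)%R) s| = 0)%E.
  transitivity (\int[mu]_(s in `]0%R, T0[) (A s - A0 P)%:E)%E.
    apply: eq_integral => s /set_mem; rewrite /= in_itv/= => /andP[s0 sT].
    by rewrite ger0_norm// pos.
  have ifin : (\int[mu]_(s in `]0%R, T0[) (A s - A0 P)%:E)%E \is a fin_num.
    by apply: integrable_fin_num => //; exact: iB.
  by rewrite -(fineK ifin) -[fine _]/(\int[mu]_(s in `]0, T0[) (A s - A0 P)) int0.
move: ae0 => [N [mN N0 subN]].
exists (N `|` [set T0]); split.
- by apply: measurableU => //; exact: measurable_set1.
- by rewrite null_set_setU//; exact: lebesgue_measure_set1.
move=> s /= h; have [->|sT0] := eqVneq s T0; first by right.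
left; apply: subN => /= h2; apply: h; rewrite in_itv/= => /andP[s0 sT] As.
rewrite ltNge; apply/negP => le.
have lt : s < T0 by rewrite lt_neqAle sT0.
have := h2; rewrite in_itv/= s0 lt => /(_ isT)[] /eqP; rewrite subr_eq0 => /eqP E.
by move: As; rewrite E ltxx.
Qed.

Lemma minus_condition (gminus : R -> R -> R -> R) :
  path_selection (@path_minus R) P A gminus ->
  {ae mu, forall s, s \in `]0, T[ -> A0 P < A s ->
     \int[mu]_(t in `]s, T[)
        (\int[mu]_x (phi x t * \1_[set r | gminus x t r = 0] s)) - df (A s) >= 0}.
Proof.
move=> hminus.
have [T0 [T00 T0T T0max aeT0]] := minimal_control_time.
pose entry (z : plane) := entry_last P A z.2 (Num.max z.1 0).
have mentry : measurable_fun setT entry := entry_last_measurable hP hA.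
have shape x t : x != 0 -> 0 < t -> t < T -> ~ kinked P A t x ->
    (~~ through P A x t /\ forall s, 0 < s -> s < t -> gminus x t s != 0) \/
    exists t1, [/\ extremal_pair P A x t t1 (gminus x t),
      forall s, T0 < s -> (t1 <= s <= leave t x) = (entry (t, x) <= s <= leave t x) &
      forall z, optimal_times P A x t z -> z.1 <= t1 \/ z.1 <= T0].
  move=> x0 t0 tT nk; have hd := uvalue_differentiable hP hA x0 t0 tT nk.
  have [|[nJ nz]|[t1 [ep t1e et1 Hz]]] := @path_minus_shape _ _ hP _ hA x t x0 t0 (ltW tT) hd (gminus x t).
  - by apply: hminus => //; rewrite in_itv/= t0.
  - by left.
  right; exists t1; split => //.
    move=> s T0s; rewrite /entry /= max_l ?(ltW t0)//.
    case: et1 => [le|wE]; first by rewrite (_ : t1 = entry_last P A x t)//; apply/eqP; rewrite eq_le t1e.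
    have /andP[e0 eT] := entry_last_bounds hP hA x t.
    have eT0 : entry_last P A x t <= T0 by exact: T0max.
    by rewrite (ltW (le_lt_trans eT0 T0s)) (ltW (le_lt_trans (le_trans t1e eT0) T0s)).
  move=> z oz; have [[z1 z12 z2] _] := oz.
  have [?|wE] := Hz z oz; [by left|right].
  exact: T0max z1 (le_trans z12 z2) wE.
(* Room 1/(n+1) above A0 for lowering the control, together with the cut at T0, which removes only a
   null set of times where A > A0. *)
pose F n : set R := (`]0, T[%classic `&` [set s | A0 P + n.+1%:R^-1 <= A s]) `&` `]T0, +oo[%classic.
have mF n : measurable (F n : set (measurableTypeR R)).
  by apply: measurableI => //; exact: (control_level_measurable (A0 P + n.+1%:R^-1) false).
have FT n : F n `<=` `]0, T[ by move=> s [[]].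
have adm n (E : set R) : measurable (E : set (measurableTypeR R)) -> E `<=` F n ->
    admissible_test entry E (-1 * n.+1%:R^-1).
  move=> mE EF; rewrite mulN1r; set e : R := n.+1%:R^-1.
  have e0 : 0 < e by rewrite invr_gt0.
  have hAe : control P (perturbed E A (- e) 1).
    apply: perturbed_test_control => // s Es s0 sT.
    have [[_ /= As] _] := EF _ Es; have [a1 a2] := control_bounds hA s0 sT.
    by rewrite -/e in As; apply/andP; split; lra.
  split => // x t x0 t0 tT nk J.
  have [[/negP//]|[t1 [[_ op _ _] sE Hz]]] := shape x t x0 t0 tT nk.
  exists t1; split => //; last first.
    by move=> s /EF[_]; rewrite /= in_itv/= andbT; exact: sE.
  (* With the negative size - e, the largest rate means the least mass of E between entrance and
     departure: leave first, enter last. An entrance z.1 beyond t1 is at most T0, and E has no point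
     before T0. *)
  move=> z oz; have [_ Bz] := optimal_times_argmin hP hA oz.
  have [w Bw [lE minw]] := leave_firstP hP hA x t.
  have [[z1 z12 z2] _] := Bz; have [[w1 w12 w2] _] := Bw.
  have [[/= o1 o12 o2] _] := op.
  have /andP[occ2 _] := occupation_bounds mE (le_trans w1 w12) (minw _ Bz).
  have occ1 : occupation E z.1 <= occupation E t1.
    have [zt|zT] := Hz z oz; first by have /andP[] := occupation_bounds mE z1 zt; rewrite subr_ge0.
    have -> : occupation E z.1 = 0.
      rewrite /occupation; transitivity (\int[mu]_(r in `]0, z.1[) (cst (0 : R) r)).
        apply: eq_Rintegral => r /set_mem; rewrite /= in_itv/= => /andP[_ rz].
        rewrite indicE memNset// => /EF[_]; rewrite /= in_itv/= andbT => Tr.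
        by have := lt_trans Tr rz; rewrite ltNge zT.
      by rewrite Rintegral_oo_cst// mul0r.
    have /andP[] := occupation_bounds mE (lexx 0) o1.
    by rewrite (_ : occupation E 0 = 0) ?subr0// /occupation set_itv_ge ?bnd_simp// Rintegral_set0.
  rewrite /occupied /= lE !mulNr lerN2 ler_pM2l//; lra.
have sign := pointwise_sign mentry mF FT adm.
have := ae_and sign aeT0.
apply: ae_sub => s [Hs HT]; rewrite in_itv/= => /andP[s0 sT] As.
have Ts : T0 < s by apply: HT => //; rewrite in_itv/= s0.
have [k hk] := ltr_add_invr As.
have := Hs (ex_intro _ k (conj (conj _ (ltW hk)) _)).
rewrite /= !in_itv/= s0 sT Ts mulN1r => /(_ isT isT) gap.
rewrite (@rest_gain_section entry gminus)//; first by move: gap; rewrite opprB.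
move=> x t x0 st tT nk; have t0 := lt_trans s0 st.
have [[nJ nz]|[t1 [[J _ hz _] sE _]]] := shape x t x0 t0 tT nk.
  rewrite /waits_at /= max_l ?(ltW t0)// (negbTE nJ) /=; split => // g0.
  by have := nz s s0 st; rewrite g0 eqxx.
by rewrite /waits_at /= max_l ?(ltW t0)// J -sE//; exact (hz s s0 st).
Qed.

End pointwise_conditions.

Theorem theorem4p2 (R : realType) (P : junction R)
    (hP : standing_assumptions P)
    (phi : R -> R -> R) (hphi : continuous_compact_support P phi)
    (f : R -> R)
    (f_convex : @convex_function R R^o `[A0 P, 0] f)
    (f_C1 : C1_on `[A0 P, 0] f)
    (Abar : R -> R) (hAbar : minimizer P phi f Abar)
    (gplus gminus : R -> R -> R -> R)
    (hplus : path_selection (@path_plus R) P Abar gplus)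
    (hminus : path_selection (@path_minus R) P Abar gminus) :
  {ae @lebesgue_measure R, forall s, s \in `]0, horizon P[ -> Abar s < 0 ->
     \int[lebesgue_measure]_(t in `]s, horizon P[)
        (\int[lebesgue_measure]_x
           (phi x t * \1_[set r | gplus x t r = 0] s))
     - derive_within `[A0 P, 0] f (Abar s) <= 0}
  /\
  {ae @lebesgue_measure R, forall s, s \in `]0, horizon P[ -> A0 P < Abar s ->
     \int[lebesgue_measure]_(t in `]s, horizon P[)
        (\int[lebesgue_measure]_x
           (phi x t * \1_[set r | gminus x t r = 0] s))
     - derive_within `[A0 P, 0] f (Abar s) >= 0}.
Proof.
have [_ bA] := hAbar.1; split.
- apply: ae_sub (plus_condition hP hphi f_convex f_C1 hAbar hplus) => s H sT As.
  by have := H sT As; rewrite slope_extE//; exact: bA.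
- apply: ae_sub (minus_condition hP hphi f_convex f_C1 hAbar hminus) => s H sT As.
  by have := H sT As; rewrite slope_extE//; exact: bA.
Qed.
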